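(* The (inverse) Madelung transform $$\mathbf{M}:\Psi = H^\infty(\mathbb{R}^n;\mathbb{C})\to\mathfrak{s}^*,\qquad \mathbf{M}(\psi) = (\mu,\rho) = \left(\mathrm{Im}\,(\bar\psi\nabla\psi),\ \bar\psi\psi\right),$$ is a Poisson map sending the bracket $\{\cdot,\cdot\}_{\mathrm{NLS}}$ on $\Psi$ to the compressible fluid (Lie-Poisson) bracket $\{\cdot,\cdot\}_{\mathrm{CF}}$ on $\mathfrak{s}^*$. That is, for all admissible functionals $F,G$ on $\mathfrak{s}^*$, $$\{F\circ\mathbf{M},\,G\circ\mathbf{M}\}_{\mathrm{NLS}} = \{F,G\}_{\mathrm{CF}}\circ\mathbf{M} .$$
   Context: Function spaces: $H^\infty(\mathbb{R}^n;E) := \bigcap_{k\ge 0}H^k(\mathbb{R}^n;E)$ for $E=\mathbb{R},\mathbb{C},\mathbb{R}^n$, with their natural Fréchet topologies. Bracket on $\Psi$: $\Psi$ is regarded as a real vector space with real inner product $\langle f,g\rangle := \mathrm{Re}\int_{\mathbb{R}^n}\bar f g\,dx$. For a functional $F$ on $\Psi$, its gradient $\nabla F(\psi)\in\Psi$ is defined by $\frac{d}{d\epsilon}F(\psi+\epsilon\phi)|_{\epsilon=0} = \langle \nabla F(\psi),\phi\rangle$ for $\phi\in\Psi$, and for functionals admitting such gradients $$\{F,G\}_{\mathrm{NLS}}(\psi) = \langle \nabla F(\psi), -\tfrac{i}{2}\nabla G(\psi)\rangle .$$ Bracket on $\mathfrak{s}^*$: $\mathfrak{s} = \mathrm{vect}(\mathbb{R}^n)\ltimes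 H^\infty(\mathbb{R}^n;\mathbb{R})$, with $\mathrm{vect}(\mathbb{R}^n)=H^\infty(\mathbb{R}^n;\mathbb{R}^n)$, is the Lie algebra of the semidirect product group $\mathrm{Diff}(\mathbb{R}^n)\ltimes H^\infty(\mathbb{R}^n;\mathbb{R})$. Its smooth dual $\mathfrak{s}^*$ consists of pairs $(\mu,\rho)$, where $\mu$ is a 1-form (identified with a vector field via the Euclidean metric, $\mu\in H^\infty(\mathbb{R}^n;\mathbb{R}^n)$) and $\rho$ is a density (identified with a function, $\rho\in H^\infty(\mathbb{R}^n;\mathbb{R})$), paired with $(v,\alpha)\in\mathfrak{s}$ by $\int_{\mathbb{R}^n}(\rho\alpha+\mu\cdot v)\,dx$. A functional $F$ on $\mathfrak{s}^*$ is called admissible if it is a smooth functional whose derivative at each point is represented by an $L^2$ gradient: there are $\frac{\delta F}{\delta\mu}\in H^\infty(\mathbb{R}^n;\mathbb{R}^n)$ and $\frac{\delta F}{\delta\rho}\in H^\infty(\mathbb{R}^n;\mathbb{R})$, depending on $(\mu,\rho)$, such that the derivative of $F$ at $(\mu,\rho)$ in the direction $(\nu,\sigma)$ equals $\int_{\mathbb{R}^n}\left(\frac{\delta F}{\delta\mu}\cdot\nu+\frac{\delta F}{\delta\rho}\,\sigma\right)dx$. For admissible $F,G$, $$\{F,G\}_{\mathrm{CF}}(\mu,\rho) = \int_{\mathbb{R}^n}\mu\cdot\left[\left(\tfrac{\delta G}{\delta\mu}\cdot\nabla\right)\tfrac{\delta F}{\delta\mu}-\left(\tfrac{\delta F}{\delta\mu}\cdot\nabla\right)\tfrac{\delta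 G}{\delta\mu}\right]dx+\int_{\mathbb{R}^n}\rho\left[\left(\tfrac{\delta G}{\delta\mu}\cdot\nabla\right)\tfrac{\delta F}{\delta\rho}-\left(\tfrac{\delta F}{\delta\mu}\cdot\nabla\right)\tfrac{\delta G}{\delta\rho}\right]dx .$$ *)

(* Defs.v *)
From HB Require Import structures.
From mathcomp Require Import all_boot all_order all_algebra.
From mathcomp Require Import complex.
From mathcomp Require Import all_classical all_reals all_analysis.

Set Implicit Arguments.
Unset Strict Implicit.
Unset Printing Implicit Defensive.
Import Order.TTheory GRing.Theory Num.Theory.
Import numFieldNormedType.Exports.
Local Open Scope classical_set_scope.
Local Open Scope ring_scope.

(* The Borel sigma-algebra of R^n, generated by the n coordinate maps as the
   library does for n.-tuple. *)
Definition rV_display : measure_display.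
Proof. exact: default_measure_display. Qed.

Section measurable_rV.
Context {R : realType} (n : nat).

Definition rV_coord (i : 'I_n) (v : 'rV[R]_n) : measurableTypeR R := v ord0 i.

Let rV_set0 : g_sigma_preimage rV_coord set0.
Proof. exact: sigma_algebra0. Qed.

Let rV_setC A : g_sigma_preimage rV_coord A -> g_sigma_preimage rV_coord (~` A).
Proof. exact: sigma_algebraC. Qed.

Let rV_bigcup (F : _^nat) : (forall i, g_sigma_preimage rV_coord (F i)) ->
  g_sigma_preimage rV_coord (\bigcup_i (F i)).
Proof. exact: sigma_algebra_bigcup. Qed.

HB.instance Definition _ := @isMeasurable.Build rV_display
  'rV[R]_n (g_sigma_preimage rV_coord) rV_set0 rV_setC rV_bigcup.

End measurable_rV.

Section rV_cons.
Context {R : realType}.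
Local Notation TR := (measurableTypeR R).

Lemma measurable_rV_coord n (i : 'I_n) :
  measurable_fun [set: 'rV[R]_n] (rV_coord i).
Proof.
move=> _ Y mY; rewrite setTI; apply: sub_sigma_algebra => /=.
rewrite -bigcup_seq/=; exists i => /=; first by rewrite mem_index_enum.
by exists Y => //; rewrite setTI.
Qed.

Lemma measurable_rVP d (T : measurableType d) n (f : T -> 'rV[R]_n) :
  (forall i, measurable_fun [set: T] (rV_coord i \o f)) ->
  measurable_fun [set: T] f.
Proof.
move=> mf _ A; rewrite setTI /measurable/= => sA.
pose G := [set B : set 'rV[R]_n | measurable (f @^-1` B)].
suff: G A by [].
move: A sA; apply: smallest_sub.
  split => [|B GB|B GB].
  - by rewrite /G/= preimage_set0.
  - by rewrite /G/= setTD preimage_setC; exact: measurableC.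
  - by rewrite /G/= preimage_bigcup; exact: bigcupT_measurable.
rewrite -bigcup_seq => B [i _ [Y mY <-]].
by rewrite /G/= setTI -comp_preimage -[X in measurable X]setTI; exact: mf.
Qed.

Definition rV_cons n (p : TR * 'rV[R]_n) : 'rV[R]_n.+1 :=
  \row_i (if unlift ord0 i is Some j then p.2 ord0 j else p.1).

Definition rV_uncons n (v : 'rV[R]_n.+1) : TR * 'rV[R]_n :=
  (v ord0 ord0, \row_j v ord0 (lift ord0 j)).

Lemma rV_consK n : cancel (@rV_cons n) (@rV_uncons n).
Proof.
move=> [a v]; rewrite /rV_uncons /rV_cons mxE unlift_none; congr pair.
by apply/rowP => j; rewrite !mxE liftK.
Qed.

Lemma measurable_rV_cons n : measurable_fun setT (@rV_cons n).
Proof.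
apply: measurable_rVP => i.
case: (unliftP ord0 i) => [j|] ->.
- rewrite (_ : _ \o _ = rV_coord j \o snd).
    by apply: measurableT_comp => //; exact: measurable_rV_coord.
  by apply/funext => p /=; rewrite /rV_coord mxE liftK.
- rewrite (_ : _ \o _ = fst); first exact: measurable_fst.
  by apply/funext => p /=; rewrite /rV_coord mxE unlift_none.
Qed.

Lemma measurable_rV_uncons n : measurable_fun setT (@rV_uncons n).
Proof.
apply: measurable_fun_pair => /=; first exact: (measurable_rV_coord ord0).
apply: measurable_rVP => i.
rewrite (_ : _ \o _ = rV_coord (lift ord0 i)); first exact: measurable_rV_coord.
by apply/funext => v /=; rewrite /rV_coord mxE.
Qed.

End rV_cons.

Section push_cons.
Context {R : realType} (n : nat).
Variable m : {sigma_finite_measure set 'rV[R]_n -> \bar R}.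

Definition push_cons : set 'rV[R]_n.+1 -> \bar R :=
  pushforward (@lebesgue_measure R \x m)%E (@rV_cons R n).

Let push_cons_measurable A : measurable A -> measurable (@rV_cons R n @^-1` A).
Proof.
by move=> mA; rewrite -[X in measurable X]setTI; exact: measurable_rV_cons.
Qed.

Let push_cons0 : push_cons set0 = 0%E.
Proof. by rewrite /push_cons /pushforward preimage_set0 measure0. Qed.

Let push_cons_ge0 A : (0 <= push_cons A)%E.
Proof. exact: (@measure_ge0 _ _ _ (@lebesgue_measure R \x m)%E). Qed.

Let push_cons_sigma_additive : semi_sigma_additive push_cons.
Proof.
move=> F mF tF mUF; rewrite /push_cons /pushforward preimage_bigcup.
apply: measure_semi_sigma_additive.
- by move=> k; exact: push_cons_measurable.
- apply/trivIsetP => /= i j _ _ ij; rewrite -preimage_setI.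
  by move/trivIsetP : tF => /(_ _ _ _ _ ij) ->//; rewrite preimage_set0.
- by rewrite -preimage_bigcup; exact: push_cons_measurable.
Qed.

HB.instance Definition _ := isMeasure.Build _ _ _ push_cons
  push_cons0 push_cons_ge0 push_cons_sigma_additive.

Let push_cons_sigma_finite : sigma_finite setT push_cons.
Proof.
have /sigma_finiteP[F [TF ndF Foo]] := sigma_finiteT (@lebesgue_measure R).
have /sigma_finiteP[G [TG ndG Goo]] := sigma_finiteT m.
exists (fun k => @rV_uncons R n @^-1` (F k `*` G k)).
  rewrite -preimage_bigcup; apply/seteqP; split => // v _ /=.
  have [i _ Fi] : (\bigcup_i F i) (rV_uncons v).1 by rewrite -TF.
  have [j _ Gj] : (\bigcup_i G i) (rV_uncons v).2 by rewrite -TG.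
  exists (maxn i j) => //; split.
  - by move: Fi; exact/subsetPset/ndF/leq_maxl.
  - by move: Gj; exact/subsetPset/ndG/leq_maxr.
move=> k; have [mF Fk] := Foo k; have [mG Gk] := Goo k; split.
  rewrite -[X in measurable X]setTI.
  by apply: measurable_rV_uncons => //; exact: measurableX.
rewrite /push_cons /pushforward -comp_preimage.
rewrite (_ : _ \o _ = id) ?preimage_id; last first.
  by apply/funext => p /=; rewrite rV_consK.
by rewrite product_measure1E// lte_mul_pinfty// ge0_fin_numE.
Qed.

HB.instance Definition _ := Measure_isSigmaFinite.Build _ _ _ push_cons
  push_cons_sigma_finite.

End push_cons.

(* n-dimensional Lebesgue measure, through R^(n+1) = R x R^n. *)
Fixpoint leb (R : realType) (n : nat) :
    {sigma_finite_measure set 'rV[R]_n -> \bar R} :=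
  match n with
  | 0 => \d_(0 : 'rV[R]_0)
  | n'.+1 => push_cons (leb R n')
  end.
Arguments leb {R} n.

Section Sobolev.
Context {R : realType} {n : nat}.
Local Notation Rn := 'rV[R]_n.
Implicit Types (f : Rn -> R) (alpha : 'I_n -> nat).

(* Classical partial derivatives; [partials [:: i; j] f] is d_i (d_j f). *)
Definition partials (s : seq 'I_n) f : Rn -> R :=
  foldr (fun i h => 'D_(delta_mx ord0 i) h) f s.

Definition morder alpha : nat := \sum_i alpha i.

Definition mpartial alpha f : Rn -> R :=
  partials (flatten [seq nseq (alpha i) i | i <- enum 'I_n]) f.

(* C_c^oo(R^n).  All iterated partials being (Frechet) differentiable makes them
   continuous, so this is infinite continuous differentiability. *)
Definition test_fun : set (Rn -> R) :=
  [set phi | (forall s x, differentiable (partials s phi) x) /\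
             compact (closure [set x | phi x != 0])].

Definition L2 : set (Rn -> R) := [set f | f \in Lfun (leb n) 2%:E].

Definition is_wderiv alpha f (g : Rn -> R) : Prop :=
  forall phi, test_fun phi ->
    \int[leb n]_x (f x * mpartial alpha phi x) =
    (-1) ^+ morder alpha * \int[leb n]_x (g x * phi x).

(* Elements of Sobolev spaces are represented by functions; a weak derivative
   is determined up to a.e. equality only, and [wderiv] chooses one in L^2. *)
Definition wderiv alpha f : Rn -> R :=
  xget (fun=> 0) [set g | L2 g /\ is_wderiv alpha f g].

Definition Hk (k : nat) : set (Rn -> R) :=
  [set f | L2 f /\ forall alpha, (morder alpha <= k)%N ->
     exists g, L2 g /\ is_wderiv alpha f g].

Definition Hinf : set (Rn -> R) := \bigcap_k Hk k.

Definition HinfV : set (Rn -> Rn) :=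
  [set u | forall i, Hinf (fun x => u x ord0 i)].

Definition HinfC : set (Rn -> R[i]) :=
  [set psi | Hinf (fun x => complex.Re (psi x)) /\
             Hinf (fun x => complex.Im (psi x))].

(* Multi-indices of order <= k have entries <= k. *)
Definition Hnorm (k : nat) f : R :=
  Num.sqrt (\sum_(a : {ffun 'I_n -> 'I_k.+1} | (morder (fun i => a i) <= k)%N)
    \int[leb n]_x (wderiv (fun i => a i) f x) ^+ 2).

Definition wpartial (i : 'I_n) f : Rn -> R := wderiv (fun j => (j == i) : nat) f.

Definition wpartialC (i : 'I_n) (psi : Rn -> R[i]) : Rn -> R[i] := fun x =>
  (wpartial i (fun y => complex.Re (psi y)) x +i*
   wpartial i (fun y => complex.Im (psi y)) x)%C.

Definition integralC (h : Rn -> R[i]) : R[i] :=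
  (\int[leb n]_x complex.Re (h x) +i* \int[leb n]_x complex.Im (h x))%C.

Definition innerC (f g : Rn -> R[i]) : R :=
  complex.Re (integralC (fun x => (f x)^*%C * g x)).

Definition is_gradC (F : (Rn -> R[i]) -> R) (psi g : Rn -> R[i]) : Prop :=
  HinfC g /\ forall phi, HinfC phi ->
    is_derive (0 : R) (1 : R)
      (fun eps : R => F (fun x => psi x + (eps%:C)%C * phi x)) (innerC g phi).

(* A gradient is unique up to a.e. equality when it exists. *)
Definition gradC (F : (Rn -> R[i]) -> R) (psi : Rn -> R[i]) : Rn -> R[i] :=
  xget (fun=> 0) [set g | is_gradC F psi g].

Definition bracket_NLS (F G : (Rn -> R[i]) -> R) (psi : Rn -> R[i]) : R :=
  innerC (gradC F psi) (fun x => - ('i%C / 2%:R) * gradC G psi x).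

Definition momdens : Type := ((Rn -> Rn) * (Rn -> R))%type.

(* 1-forms and densities are identified with vector fields and functions through
   the Euclidean structure. *)
Definition sdual : set momdens := [set m | HinfV m.1 /\ Hinf m.2].

Definition sadd_scale (m : momdens) (t : R) (w : momdens) : momdens :=
  (fun x => m.1 x + t *: w.1 x, fun x => m.2 x + t * w.2 x).

(* Increasing in k, the seminorms [snorm k] define the Frechet topology of sdual. *)
Definition snorm (k : nat) (m : momdens) : R :=
  \sum_i Hnorm k (fun x => m.1 x ord0 i) + Hnorm k m.2.

Definition sdist (k : nat) (m m' : momdens) : R :=
  snorm k (sadd_scale m (-1) m').

(* Iterated directional derivative d^r F (m; v_1, ..., v_r) of a functional. *)
Fixpoint dirD (F : momdens -> R) (vs : seq momdens) (m : momdens) : R :=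
  if vs is v :: vs' then
    derive1 (fun t : R => dirD F vs' (sadd_scale m t v)) 0
  else F m.

(* Smoothness on the Frechet space sdual, in the sense of Michal-Bastiani (and
   Hamilton): all iterated directional derivatives exist, and
   d^r F : sdual x sdual^r -> R is continuous for every r.  Since continuity is
   for the Sobolev norms, a smooth functional takes the same value on a.e. equal
   representatives. *)
Definition smooth_functional (F : momdens -> R) : Prop :=
  forall r : nat,
  (forall (vs : r.-tuple momdens) (v m : momdens),
     (forall i, sdual (tnth vs i)) -> sdual v -> sdual m ->
     derivable (fun t : R => dirD F vs (sadd_scale m t v)) 0 1) /\
  (forall (vs : r.-tuple momdens) (m : momdens),
     (forall i, sdual (tnth vs i)) -> sdual m ->
     forall e : R, 0 < e -> exists (k : nat) (d : R), 0 < d /\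
     forall (vs' : r.-tuple momdens) (m' : momdens),
       (forall i, sdual (tnth vs' i)) -> sdual m' ->
       sdist k m' m < d -> (forall i, sdist k (tnth vs' i) (tnth vs i) < d) ->
       `|dirD F vs' m' - dirD F vs m| < e).

Definition dotv (u v : Rn) : R := \sum_i u ord0 i * v ord0 i.

Definition is_sgrad (F : momdens -> R) (m g : momdens) : Prop :=
  [/\ HinfV g.1, Hinf g.2 & forall w, sdual w ->
    is_derive (0 : R) (1 : R) (fun t : R => F (sadd_scale m t w))
      (\int[leb n]_x (dotv (g.1 x) (w.1 x) + g.2 x * w.2 x))].

Definition admissible (F : momdens -> R) : Prop :=
  smooth_functional F /\ forall m, sdual m -> exists g, is_sgrad F m g.

(* (delta F / delta mu, delta F / delta rho), unique up to a.e. equality. *)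
Definition sgrad (F : momdens -> R) (m : momdens) : momdens :=
  xget (fun=> 0, fun=> 0) [set g | is_sgrad F m g].

Definition advect (u : Rn -> Rn) (f : Rn -> R) : Rn -> R :=
  fun x => \sum_i u x ord0 i * wpartial i f x.

Definition advectV (u v : Rn -> Rn) : Rn -> Rn :=
  fun x => \row_j advect u (fun y => v y ord0 j) x.

Definition bracket_CF (F G : momdens -> R) (m : momdens) : R :=
  let Fmu := (sgrad F m).1 in let Frho := (sgrad F m).2 in
  let Gmu := (sgrad G m).1 in let Grho := (sgrad G m).2 in
  (\int[leb n]_x dotv (m.1 x) (advectV Gmu Fmu x - advectV Fmu Gmu x)) +
  \int[leb n]_x (m.2 x * (advect Gmu Frho x - advect Fmu Grho x)).

Definition madelung (psi : Rn -> R[i]) : momdens :=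
  (fun x => \row_i complex.Im ((psi x)^*%C * wpartialC i psi x),
   fun x => complex.Re ((psi x)^*%C * psi x)).

End Sobolev.

(* Main.v *)
From HB Require Import structures.
Require Import Defs.
From mathcomp Require Import all_boot all_order all_algebra.
From mathcomp Require Import complex.
From mathcomp Require Import all_classical all_reals all_analysis.
From mathcomp Require Import measurable_realfun ring lra.

Set Implicit Arguments.
Unset Strict Implicit.
Unset Printing Implicit Defensive.
Import Order.TTheory GRing.Theory Num.Theory.
Import numFieldNormedType.Exports.
Local Open Scope classical_set_scope.
Local Open Scope ring_scope.

(** Why the transform is a Poisson map.  For a functional F of (mu, rho) with
    gradient (u, f) at M(psi), the chain rule and an integration by parts give

      grad (F o M)(psi) = 2 f psi - i (2 u . grad psi + (div u) psi),

    that is, 2 f psi - 2i L_u psi where L_u = u . grad + (div u) / 2 is the Lie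
    derivative of half-densities.  Multiplication operators commute, the
    operators L_u are antisymmetric, and L_u g - g L_u = u . grad g and
    L_u L_v - L_v L_u = L_[u, v]; inserted in the bracket on wave functions,
    these relations produce the semidirect product bracket.  Here the
    commutator computation is done under the integral sign:
    [bracket_pointwise] shows that the densities of the two brackets differ by
    explicit divergences, whose integrals vanish.

    The analysis behind it is that functions with all weak derivatives in L^2
    form an algebra on which the usual calculus holds almost everywhere.
    - Test functions detect inequalities ([L2_bounded_test]).  A set is
      approximable when its indicator function is the limit of smooth functions
      with values in [0, 1], in the L^1 space of a given finite measure.
      Approximable sets form a sigma-algebra, and the function exp(-1/x) shows
      that half-spaces belong to it.
    - Such functions are bounded ([Hinf_bounded]).  The correlation of f with a
      test function phi is a function whose derivatives are the correlations of
      the weak derivatives of f.  A one-dimensional Sobolev inequality, iterated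
      over the coordinates, and Young's inequality then bound the integral of
      f phi by a multiple of the L^1 norm of phi.
    - Boundedness of the second derivatives yields a Taylor formula uniform
      almost everywhere ([ae_taylor]), whence the Leibniz rule
      ([weak_partialM]), stability under products ([HinfM]) and integration by
      parts ([integration_by_parts_Hinf]).

    For the chain rule, M(psi + t phi) equals m + t A + t^2 B almost
    everywhere, with m = M(psi) and B = M(phi).  A smooth functional does not
    distinguish functions that are equal almost everywhere
    ([smooth_functional_ae]), and by the mean value theorem the term t^2 B does
    not contribute to the derivative at t = 0 ([is_derive_parabola]). *)

(** * Lebesgue measure on row vectors *)

Section measure_rV.
Context {R : realType}.
Local Notation TR := (measurableTypeR R).

Lemma rV_cons0 n (a : R) (v : 'rV[R]_n) : rV_cons (a, v) ord0 ord0 = a.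
Proof. by rewrite /rV_cons mxE unlift_none. Qed.

Lemma rV_consS n (a : R) (v : 'rV[R]_n) j :
  rV_cons (a, v) ord0 (lift ord0 j) = v ord0 j.
Proof. by rewrite /rV_cons mxE liftK. Qed.

Lemma rV_consD n (a b : R) (v w : 'rV[R]_n) :
  rV_cons (a, v) + rV_cons (b, w) = rV_cons (a + b, v + w).
Proof.
apply/rowP => i; rewrite mxE.
by case: (unliftP ord0 i) => [j|] ->; rewrite ?rV_consS ?rV_cons0// mxE.
Qed.

Lemma rV_unconsK n : cancel (@rV_uncons R n) (@rV_cons R n).
Proof.
move=> v; apply/rowP => i.
by case: (unliftP ord0 i) => [j|] ->; rewrite ?rV_consS ?rV_cons0//= mxE.
Qed.

Lemma ge0_integral_leb0 (f : 'rV[R]_0 -> \bar R) : (forall x, 0 <= f x)%E ->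
  measurable_fun [set: 'rV[R]_0] f -> (\int[@leb R 0]_x f x = f 0%R)%E.
Proof. by move=> f0 mf; rewrite integral_dirac// diracT mul1e. Qed.

Lemma ge0_integral_lebS n (f : 'rV[R]_n.+1 -> \bar R) :
  (forall x, 0 <= f x)%E -> measurable_fun setT f ->
  (\int[@leb R n.+1]_x f x =
   \int[@lebesgue_measure R \x @leb R n]_p f (rV_cons p))%E.
Proof.
move=> f0 mf.
have mc := @measurable_rV_cons R n.
have := @ge0_integral_pushforward _ _ _ _ _ _ mc
  (@lebesgue_measure R \x @leb R n)%E setT f measurableT mf (fun y _ => f0 y).
by rewrite preimage_setT => <-; exact: eq_measure_integral.
Qed.

Lemma measurable_cons_comp n (f : 'rV[R]_n.+1 -> \bar R) :
  measurable_fun setT f -> measurable_fun setT (f \o @rV_cons R n).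
Proof. by move=> mf; exact: (measurableT_comp mf (@measurable_rV_cons R n)). Qed.

(** The measure on R^(n+1) is an image of the product of the measures on R and
    R^n: inductions on the dimension use Tonelli's theorem in the first
    coordinate. *)
Lemma tonelli_lebS n (f : 'rV[R]_n.+1 -> \bar R) :
  (forall x, 0 <= f x)%E -> measurable_fun setT f ->
  (\int[@leb R n.+1]_x f x =
   \int[@leb R n]_y \int[@lebesgue_measure R]_s f (rV_cons (s, y)))%E.
Proof.
move=> f0 mf; rewrite ge0_integral_lebS//.
rewrite (fubini_tonelli2 (f \o @rV_cons R n) (measurable_cons_comp mf) _)// => p; exact: f0.
Qed.

Lemma lebesgue_measureD (a : R) (A : set TR) : measurable A ->
  pushforward (@lebesgue_measure R) ((fun x => x + a) : TR -> TR) A =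
  lebesgue_measure A.
Proof.
move=> mA; apply/esym/lebesgue_measure_unique => //=.
  exact: measurable_funD.
move=> mD _ [[x y]] _ <-; rewrite /pushforward.
rewrite (_ : _ @^-1` _ = `](x - a), (y - a)]%classic); last first.
  by apply/seteqP; split => t /=; rewrite !in_itv/= ltrBlDr lerBrDr.
rewrite !lebesgue_measure_itv/= !lte_fin ltrD2r.
by case: ifP => // _; rewrite -!EFinB; congr EFin; ring.
Qed.

Lemma ge0_integral_translationR (a : R) (f : R -> \bar R) :
  (forall x, 0 <= f x)%E -> measurable_fun setT f ->
  (\int[@lebesgue_measure R]_x f (x + a)%R = \int[@lebesgue_measure R]_x f x)%E.
Proof.
move=> f0 mf.
have mD : measurable_fun setT ((fun x => x + a) : TR -> TR).
  exact: measurable_funD.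
have := @ge0_integral_pushforward _ _ _ _ _ _ mD
  (@lebesgue_measure R) setT f measurableT mf (fun y _ => f0 y).
rewrite preimage_setT => <-; apply: eq_measure_integral => A mA _.
exact: lebesgue_measureD.
Qed.

Lemma measurable_rV_add n (a : 'rV[R]_n) :
  measurable_fun setT (fun x : 'rV[R]_n => x + a).
Proof.
apply: measurable_rVP => i.
rewrite (_ : _ \o _ = fun x => rV_coord i x + a ord0 i); last first.
  by apply/funext => x; rewrite /rV_coord /= mxE.
by apply: measurable_funD => //; exact: measurable_rV_coord.
Qed.

(** By induction on the dimension: translate the first coordinate by the
    invariance of the measure on R, and the others by the induction hypothesis. *)
Lemma ge0_integral_translation n (a : 'rV[R]_n) (f : 'rV[R]_n -> \bar R) :
  (forall x, 0 <= f x)%E -> measurable_fun setT f ->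
  (\int[@leb R n]_x f (x + a)%R = \int[@leb R n]_x f x)%E.
Proof.
elim: n a f => [|n IH] a f f0 mf.
  by congr integral; apply/funext => x; congr f; apply/rowP => -[].
have mfa : measurable_fun setT (fun x : 'rV[R]_n.+1 => f (x + a)).
  exact: (measurableT_comp mf (@measurable_rV_add n.+1 a)).
rewrite (tonelli_lebS (fun x => f0 (x + a)) mfa) (tonelli_lebS f0 mf).
rewrite -[a]rV_unconsK; case: (rV_uncons a) => a0 a1.
have mc := measurable_cons_comp mf.
rewrite -[RHS](IH a1); last 2 first.
- by move=> y; exact: integral_ge0.
- exact: (@measurable_fun_fubini_tonelli_G _ _ _ _ _ (@lebesgue_measure R)
    (f \o @rV_cons R n) mc (fun p => f0 _)).
apply: eq_integral => y _.
rewrite -(@ge0_integral_translationR a0 (fun s => f (rV_cons (s, y + a1))))//.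
  by apply: eq_integral => s _; rewrite rV_consD.
exact: (measurable_fun_pair1 (f := f \o @rV_cons R n) (y + a1) mc).
Qed.

End measure_rV.
Section integral_rV.
Context {R : realType} {n : nat}.
Local Notation Rn := 'rV[R]_n.
Local Notation mu := (@leb R n).

(** The sigma-algebra is generated by the coordinates; it contains an open set
    because this is a countable union of cubes with rational centres and radii. *)
Lemma continuous_measurable_rV (f : Rn -> R) :
  continuous f -> measurable_fun setT f.
Proof.
move=> cf; apply: (measurability _ (RGenOpens.measurableE R)) => _ [_ [a [b ->] <-]].
rewrite setTI; set U := f @^-1` _.
have oU : open U by apply: open_comp => //; exact: interval_open.
pose box (c : 'rV[rat]_n * rat) : set Rn :=
  [set x | forall i, `|x ord0 i - ratr (c.1 ord0 i)| < ratr c.2].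
have mbox c : measurable (box c).
  rewrite (_ : box c = \bigcap_(i in [set: 'I_n])
      (rV_coord i @^-1` [set t | `|t - ratr (c.1 ord0 i)| < ratr c.2])).
    apply: fin_bigcap_measurable => // i _.
    rewrite -[X in measurable X]setTI; apply: measurable_rV_coord => //.
    rewrite (_ : mkset _ = ball (ratr (c.1 ord0 i) : R) (ratr c.2)).
    - exact: measurable_ball.
    - by apply/seteqP; split => t /=; rewrite /ball/= distrC.
  by apply/seteqP; split=> x /= h i; [move=> _|]; exact: h.
rewrite (_ : U = \bigcup_(c : 'rV[rat]_n * rat)
    (if `[< box c `<=` U >] then box c else set0)); last first.
  apply/seteqP; split=> [x Ux|x [c _]]; last by case: asboolP => // bU; exact: bU.
  have /nbhs_ballP[e /= e0 xeU] : nbhs x U by exact: open_nbhs_nbhs.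
  have [r /andP[r0 re]] : exists r : rat, (0 < ratr r :> R) && (ratr r < e / 2 :> R).
    have [r] := @rat_in_itvoo R 0 (e / 2) (divr_gt0 e0 (ltr0Sn _ 1)).
    by rewrite in_itv/=; exists r.
  have /choice[c cP] : forall i, exists q : rat, `|x ord0 i - ratr q| < ratr r.
    move=> i; have [|q] := @rat_in_itvoo R (x ord0 i - ratr r) (x ord0 i).
      by rewrite ltrBlDr ltrDl.
    rewrite in_itv/= => /andP[q1 q2]; exists q.
    by rewrite ltr_norml; apply/andP; split; lra.
  exists (\row_i c i, r) => //; case: asboolP => [_ i|]; first by rewrite mxE.
  case=> y /= yb; apply: xeU; split=> // i j; rewrite !ord1 /ball/=.
  have := yb j; have := cP j; rewrite mxE => h1 h2.
  rewrite -(subrK (ratr (c j)) (x ord0 j)) -addrA.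
  by rewrite (le_lt_trans (ler_normD _ _))// [X in _ + X]distrC; lra.
apply: countable_bigcupT_measurable; first exact: countableP.
by move=> c; case: ifP.
Qed.

Lemma integral_translation (a : Rn) (f : Rn -> \bar R) :
  measurable_fun setT f -> (\int[mu]_x f (x + a)%R = \int[mu]_x f x)%E.
Proof.
move=> mf; rewrite integralE [RHS]integralE; congr (_ - _)%E.
- rewrite -[RHS](ge0_integral_translation a)//; last exact: measurable_funepos.
  by apply: eq_integral => x _; rewrite !funeposE.
- rewrite -[RHS](ge0_integral_translation a)//; last exact: measurable_funeneg.
  by apply: eq_integral => x _; rewrite !funenegE.
Qed.

Lemma measurable_translation d (T : measurableType d) (a : Rn) (f : Rn -> T) :
  measurable_fun setT f -> measurable_fun setT (fun x : Rn => f (x + a)).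
Proof. by move=> mf; exact: (measurableT_comp mf (@measurable_rV_add R n a)). Qed.

Lemma Rintegral_translation (a : Rn) (f : Rn -> R) :
  measurable_fun setT f -> \int[mu]_x f (x + a) = \int[mu]_x f x.
Proof.
by move=> mf; congr fine; apply: (integral_translation a (f := EFin \o f)); exact/measurable_EFinP.
Qed.

Lemma ae_translation (a : Rn) (P : set Rn) :
  {ae mu, forall x, P x} -> {ae mu, forall x, P (x + a)}.
Proof.
move=> [N [mN N0 PN]]; exists ((fun x => x + a) @^-1` N); split.
- by rewrite -[X in measurable X]setTI; exact: measurable_rV_add.
- have mi : measurable_fun setT (fun x : Rn => (\1_N x)%:E : \bar R).
    by apply/measurable_EFinP.
  transitivity (\int[mu]_x (\1_N (x + a))%:E)%E; last first.
    by rewrite (integral_translation a mi) integral_indic// setIT.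
  rewrite -[RHS]/(\int[mu]_x (\1_(+%R^~ a @^-1` N) x)%:E)%E integral_indic ?setIT//.
  by rewrite -[X in measurable X]setTI; exact: measurable_rV_add.
- by move=> x /= nP; exact: PN.
Qed.

Lemma L2P (f : Rn -> R) : L2 f <->
  measurable_fun setT f /\ (\int[mu]_x (f x ^+ 2)%:E < +oo)%E.
Proof.
split=> [fL|[mf foo]].
  split.
    by move: fL; rewrite /L2/= inE => /andP[]; rewrite inE.
  have /integrableP[_] := Lfun2_integrable_sqr fL.
  by under eq_integral do rewrite /= ger0_norm ?sqr_ge0//.
rewrite /L2/= inE; apply/andP; split; rewrite inE//= /finite_norm unlock.
rewrite poweR_lty//.
under eq_integral do rewrite /= powR_mulrn// -normrX ger0_norm ?sqr_ge0//.
by [].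
Qed.

Lemma L2_measurable (f : Rn -> R) : L2 f -> measurable_fun setT f.
Proof. by move=> /L2P[]. Qed.

Lemma L2_integrableM (f g : Rn -> R) : L2 f -> L2 g ->
  mu.-integrable setT (fun x => (f x * g x)%:E).
Proof. by move=> Lf Lg; have /Lfun1_integrable := Lfun2_mul_Lfun1 Lf Lg. Qed.

Lemma L2_integrable_sqr (f : Rn -> R) : L2 f ->
  mu.-integrable setT (fun x => (f x ^+ 2)%:E).
Proof. by move=> Lf; exact: Lfun2_integrable_sqr. Qed.

Lemma L2D (f g : Rn -> R) : L2 f -> L2 g -> L2 (fun x => f x + g x).
Proof.
move=> Lf Lg; have [mf mg] := (L2_measurable Lf, L2_measurable Lg).
apply/L2P; split; first exact: measurable_funD.
have fgi : mu.-integrable setT (fun x => (f x ^+ 2)%:E + (f x ^+ 2)%:E +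
    ((g x ^+ 2)%:E + (g x ^+ 2)%:E))%E.
  by apply: integrableD => //; apply: integrableD => //; exact: L2_integrable_sqr.
have /integrableP[mfg] := fgi; apply: le_lt_trans.
apply: ge0_le_integral => //.
- by move=> x _; rewrite lee_fin sqr_ge0.
- by apply/measurable_EFinP; apply: measurable_funX; exact: measurable_funD.
- exact: measurableT_comp.
move=> x _; rewrite -!EFinD /= lee_fin ger0_norm; last by nra.
by have := sqr_ge0 (f x - g x); nra.
Qed.

Lemma L2_le (f g : Rn -> R) : L2 f -> measurable_fun setT g ->
  {ae mu, forall x, `|g x| <= `|f x|} -> L2 g.
Proof.
move=> Lf mg gf; apply/L2P; split=> //.
have /L2P[mf] := Lf; apply: le_lt_trans.
apply: ae_ge0_le_integral => //.
- by move=> x _; rewrite lee_fin sqr_ge0.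
- by apply/measurable_EFinP; exact: measurable_funX.
- by move=> x _; rewrite lee_fin sqr_ge0.
- by apply/measurable_EFinP; exact: measurable_funX.
apply: filterS gf => x gfx _; rewrite lee_fin.
by rewrite -(real_normK (num_real (g x))) -(real_normK (num_real (f x))) lerXn2r ?nnegrE.
Qed.

Lemma L2_ae (f g : Rn -> R) : L2 f -> measurable_fun setT g ->
  {ae mu, forall x, g x = f x} -> L2 g.
Proof.
by move=> Lf mg gf; apply: (L2_le Lf mg); apply: filterS gf => x ->.
Qed.

Lemma L2Z (a : R) (f : Rn -> R) : L2 f -> L2 (fun x => a * f x).
Proof.
move=> Lf; have /L2P[mf foo] := Lf; apply/L2P; split; first exact: measurable_funM.
under eq_integral do rewrite exprMn EFinM.
rewrite integralZl//; last exact: L2_integrable_sqr.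
by rewrite lte_mul_pinfty// lee_fin sqr_ge0.
Qed.

Lemma L2_bounded_mul (M : R) (f g : Rn -> R) : measurable_fun setT f ->
  {ae mu, forall x, `|f x| <= M} -> L2 g -> L2 (fun x => f x * g x).
Proof.
move=> mf fM Lg; apply: (L2_le (L2Z M Lg)).
  by apply: measurable_funM => //; exact: L2_measurable.
apply: filterS fM => x fM; rewrite !normrM ler_wpM2r//.
by rewrite (le_trans fM)// ler_norm.
Qed.

Lemma L2_translation (a : Rn) (f : Rn -> R) : L2 f -> L2 (fun x => f (x + a)).
Proof.
move=> /L2P[mf foo]; apply/L2P; split; first exact: measurable_translation.
rewrite (integral_translation a (f := fun x => (f x ^+ 2)%:E))//.
by apply/measurable_EFinP; exact: measurable_funX.
Qed.

Lemma eq_Rintegral_ae (f g : Rn -> R) : measurable_fun setT f ->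
  measurable_fun setT g -> {ae mu, forall x, f x = g x} ->
  \int[mu]_x f x = \int[mu]_x g x.
Proof.
move=> mf mg fg; congr fine; apply: ae_eq_integral => //; try exact/measurable_EFinP.
by apply: filterS fg => x ->.
Qed.

End integral_rV.
(** * Smooth functions *)

Section directional_derivative.
Context {R : realType}.

Lemma is_derive_lineP (V : normedModType R) (f : V -> R) (x v : V) (d : R) :
  is_derive x v f d <-> is_derive (0 : R) 1 (fun t : R => f (x + t *: v)) d.
Proof.
have E : (fun h : R => h^-1 *: ((f \o shift x) (h *: v) - f x)) =
    (fun h : R => h^-1 *: (((fun t : R => f (x + t *: v)) \o shift 0) (h *: 1) -
                           f (x + 0 *: v))).
  apply/funext => h /=; rewrite scale0r !addr0; congr (_ *: (f _ - _)).
  by rewrite addrC; congr (_ + _ *: _); rewrite /GRing.scale/= mulr1.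
by split=> -[h1 h2]; apply: DeriveDef; move: h1 h2; rewrite /derivable /derive E.
Qed.

Lemma is_derive_line (V : normedModType R) (f : V -> R) (x v : V) (t d : R) :
  is_derive (x + t *: v) v f d -> is_derive t 1 (fun t : R => f (x + t *: v)) d.
Proof.
move=> /is_derive_lineP h; apply/is_derive_lineP; move: h.
rewrite (_ : (fun s : R => f (x + t *: v + s *: v)) =
             (fun s : R => f (x + (t + s *: 1) *: v)))//.
by apply/funext => s; rewrite -addrA -scalerDl /GRing.scale/= mulr1.
Qed.

(** Remainders are estimated below by explicit multiples of h^2. *)
Lemma is_derive_quadratic (f : R -> R) (x d C e : R) : 0 < e ->
  (forall h, `|h| < e -> `|f (x + h) - f x - h * d| <= C * h ^+ 2) ->
  is_derive x 1 f d.
Proof.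
move=> e0 H.
have K : h^-1 *: ((f \o shift x) (h *: (1 : R)) - f x) @[h --> 0^'] --> d.
  apply/cvgrPdist_lt => r r0; near=> h.
  have h0 : h != 0 by near: h; exact: nbhs_dnbhs_neq.
  have hn : 0 < `|h| by rewrite normr_gt0.
  rewrite /= /GRing.scale/= mulr1 [h + x]addrC distrC.
  rewrite (_ : _ - d = h^-1 * (f (x + h) - f x - h * d)); last by field.
  rewrite normrM normfV mulrC ltr_pdivrMr//.
  have he : `|h| < e.
    by near: h; apply: dnbhs0_lt.
  have hC : `|h| < r / (`|C| + 1) by near: h; apply: dnbhs0_lt; rewrite divr_gt0// ltr_wpDl.
  rewrite (le_lt_trans (H h he))// -real_normK ?num_real//.
  rewrite ltr_pdivlMr in hC; last by rewrite ltr_wpDl.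
  have := ler_norm C; nra.
by apply: DeriveDef; [apply/cvg_ex; exists d|exact/cvg_lim].
Unshelve. all: by end_near. Qed.

End directional_derivative.

Section smooth.
Context {R : realType} {n : nat}.
Local Notation Rn := 'rV[R]_n.
Local Notation e_ i := (delta_mx ord0 i : Rn).
Implicit Types f g : Rn -> R.

Definition smooth f := forall s x, differentiable (partials s f) x.

(** Smoothness by coinduction: it suffices to exhibit a class of differentiable
    functions that is stable under partial derivatives. *)
Lemma smooth_coind (S : set (Rn -> R)) :
  (forall f, S f -> forall x, differentiable f x) ->
  (forall f i, S f -> S ('D_(e_ i) f)) -> S `<=` smooth.
Proof.
move=> dS DS f Sf s x; apply: dS; elim: s => //= i s; exact: DS.
Qed.

Lemma smooth_diff f : smooth f -> forall x, differentiable f x.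
Proof. by move=> sf; exact: (sf [::]). Qed.

Lemma partials_cat s t f : partials (s ++ t) f = partials s (partials t f).
Proof. by rewrite /partials foldr_cat. Qed.

Lemma smooth_partials f s : smooth f -> smooth (partials s f).
Proof. by move=> sf t x; rewrite -partials_cat. Qed.

Lemma smoothD1 f i : smooth f -> smooth ('D_(e_ i) f).
Proof. exact: (@smooth_partials f [:: i]). Qed.

Lemma smooth_derivable f x v : smooth f -> derivable f x v.
Proof. by move=> sf; apply: diff_derivable; exact: smooth_diff. Qed.

Lemma smooth_line f x i t : smooth f ->
  is_derive (t : R) (1 : R) (fun t : R => f (x + t *: e_ i)) ('D_(e_ i) f (x + t *: e_ i)).
Proof. by move=> sf; apply/is_derive_line/derivableP; exact: smooth_derivable. Qed.

Lemma smooth_continuous f : smooth f -> continuous f.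
Proof. by move=> sf x; apply: differentiable_continuous; exact: smooth_diff. Qed.

Lemma smooth_measurable f : smooth f -> measurable_fun setT f.
Proof. by move=> sf; apply: continuous_measurable_rV; exact: smooth_continuous. Qed.

(** Sums are needed even for products alone, since the derivative of a product
    is a sum of products. *)
Inductive smooth_alg : (Rn -> R) -> Prop :=
| smooth_alg_base f : smooth f -> smooth_alg f
| smooth_alg_add f g : smooth_alg f -> smooth_alg g -> smooth_alg (fun x => f x + g x)
| smooth_alg_mul f g : smooth_alg f -> smooth_alg g -> smooth_alg (fun x => f x * g x).

Lemma smooth_algP f : smooth_alg f -> smooth f.
Proof.
have dS g : smooth_alg g -> forall x, differentiable g x.
  elim=> [h|h k _ dh _ dk|h k _ dh _ dk] x; first exact: smooth_diff.
  - exact: differentiableD.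
  - exact: differentiableM.
apply: smooth_coind => // {}f i.
elim=> [h sh|h k Sh dh Sk dk|h k Sh dh Sk dk].
- by apply: smooth_alg_base; exact: smoothD1.
- rewrite (_ : 'D_(e_ i) _ = fun x => 'D_(e_ i) h x + 'D_(e_ i) k x).
    exact: smooth_alg_add.
  by apply/funext => x; rewrite deriveD//; apply: diff_derivable; exact: dS.
- rewrite (_ : 'D_(e_ i) _ = fun x => h x * 'D_(e_ i) k x + k x * 'D_(e_ i) h x).
    by apply: smooth_alg_add; exact: smooth_alg_mul.
  by apply/funext => x; rewrite deriveM//; apply: diff_derivable; exact: dS.
Qed.

Lemma smoothD f g : smooth f -> smooth g -> smooth (fun x => f x + g x).
Proof. by move=> sf sg; apply: smooth_algP; apply: smooth_alg_add; exact: smooth_alg_base. Qed.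

Lemma smoothM f g : smooth f -> smooth g -> smooth (fun x => f x * g x).
Proof. by move=> sf sg; apply: smooth_algP; apply: smooth_alg_mul; exact: smooth_alg_base. Qed.

Lemma smooth_cst (a : R) : smooth (fun=> a).
Proof.
apply: (@smooth_coind (range (fun a : R => fun=> a : R))); last by exists a.
- by move=> _ [b _ <-] x; exact: differentiable_cst.
- move=> _ i [b _ <-]; exists 0 => //; apply/funext => x.
  by rewrite derive_cst.
Qed.

Lemma smooth_prod (I : Type) (r : seq I) (F : I -> Rn -> R) :
  (forall i, smooth (F i)) -> smooth (fun x => \prod_(i <- r) F i x).
Proof.
move=> sF; elim: r => [|i r IH].
  by under eq_fun do rewrite big_nil; exact: smooth_cst.
by under eq_fun do rewrite big_cons; exact: smoothM.
Qed.

Lemma derive_affine f (c : R) (a x : Rn) i : smooth f ->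
  'D_(e_ i) (fun x => f (c *: x + a)) x = c * 'D_(e_ i) f (c *: x + a).
Proof.
move=> sf; apply: derive_val; apply/is_derive_lineP.
rewrite (_ : (fun _ => _) = (fun s : R => f (c *: x + a + s *: e_ i)) \o ( *%R c)).
  rewrite mulrC; apply: is_derive1_comp.
    rewrite mulr0; apply: is_derive_eq; first exact: smooth_line.
    by rewrite scale0r addr0.
  by apply: is_derive_eq; rewrite [LHS]mulr1.
by apply/funext => t /=; rewrite scalerDr scalerA addrAC.
Qed.

Lemma smooth_affine f (c : R) (a : Rn) : smooth f -> smooth (fun x => f (c *: x + a)).
Proof.
move=> sf; apply: (@smooth_coind [set g | exists h k,
  smooth h /\ g = fun x => k * h (c *: x + a)]); last first.
  by exists f, 1; split=> //; apply/funext => x; rewrite mul1r.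
- move=> _ i [h [k [sh ->]]]; exists ('D_(e_ i) h), (k * c); split.
    exact: smoothD1.
  apply/funext => x; rewrite deriveMl ?derive_affine ?mulrA//.
  apply: diff_derivable; apply: (@differentiable_comp _ _ _ _ (fun x => c *: x + a) h).
    by apply: differentiableD => //; exact: differentiableZ.
  exact: smooth_diff.
- move=> _ [h [k [sh ->]]] x; apply: differentiableM => //.
  apply: (@differentiable_comp _ _ _ _ (fun x => c *: x + a) h).
    by apply: differentiableD => //; exact: differentiableZ.
  exact: smooth_diff.
Qed.

End smooth.
(** * The flat function exp(-1/x) *)

Section flat.
Context {R : realType}.
Implicit Types p : {poly R}.

(** The function p(1/x) exp(-1/x), extended by 0: all derivatives of
    exp(-1/x) have this form, which is what a proof by coinduction needs. *)
Definition flat p (x : R) : R := if 0 < x then p.[x^-1] * expR (- x^-1) else 0.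

(** The inequality y / k <= exp (y / k), raised to the power k. *)
Lemma pow_expR_bounded (k : nat) (y : R) : 0 < y ->
  y ^+ k * expR (- y) <= k%:R ^+ k.
Proof.
case: k => [|k] y0; first by rewrite !expr0 mul1r -expR0 ler_expR; lra.
have k0 : (0 : R) < k.+1%:R by [].
pose z := y / k.+1%:R; have yE : y = k.+1%:R * z by rewrite mulrC divfK ?gt_eqF.
have z0 : 0 < z by rewrite divr_gt0.
have -> : expR (- y) = expR (- z) ^+ k.+1 by rewrite yE -mulrN expRM_natl.
rewrite -exprMn lerXn2r ?nnegrE//; first by rewrite mulr_ge0 ?expR_ge0// ltW.
rewrite yE -mulrA ler_piMr// expRN ler_pdivrMr ?expR_gt0// mul1r.
by have := expR_ge1Dx z; lra.
Qed.

Lemma horner_expR_bounded p (k : nat) :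
  exists C, forall y, 0 < y -> `|p.[y]| * y ^+ k * expR (- y) <= C.
Proof.
elim/poly_ind: p k => [|p c IH] k.
  by exists 0 => y _; rewrite horner0 normr0 !mul0r.
have [C hC] := IH k.+1; exists (C + `|c| * k%:R ^+ k) => y y0.
rewrite hornerD hornerMX hornerC.
have h1 := hC y y0; have h2 := pow_expR_bounded k y0.
have h3 := ler_normD (p.[y] * y) c.
rewrite normrM (gtr0_norm y0) in h3.
have h4 : 0 <= y ^+ k * expR (- y) by rewrite mulr_ge0 ?expR_ge0// exprn_ge0// ltW.
rewrite (le_trans (y := (`|p.[y]| * y + `|c|) * (y ^+ k * expR (- y))))//.
  by rewrite -mulrA ler_wpM2r.
rewrite mulrDl lerD//.
- by rewrite (le_trans _ h1)// exprS !mulrA.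
- by rewrite ler_wpM2l.
Qed.

(** For y = 1/x this says that p(y) y^2 exp(-y) is bounded.  It makes the
    derivative at the origin vanish. *)
Lemma flat_quadratic p : exists C, forall x, `|flat p x| <= C * x ^+ 2.
Proof.
have [C hC] := horner_expR_bounded p 2; exists C => x; rewrite /flat.
have C0 : 0 <= C.
  apply: le_trans (hC 1 ltr01).
  by rewrite !mulr_ge0 ?expR_ge0// exprn_ge0.
case: ifPn => [x0|_]; last by rewrite normr0 mulr_ge0 ?sqr_ge0.
rewrite -ler_pdivrMr ?exprn_gt0// normrM (ger0_norm (expR_ge0 _)).
rewrite (le_trans _ (hC x^-1 _)) ?invr_gt0// exprVn.
by rewrite mulrAC.
Qed.

(** The derivative of p(1/x) exp(-1/x) is (p - p')(1/x) x^(-2) exp(-1/x). *)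
Lemma is_derive_flat p (x : R) :
  is_derive x 1 (flat p) (flat ('X^2 * (p - p^`())) x).
Proof.
have [x0|x0|->] := ltgtP x 0.
- apply: (@near_eq_is_derive _ R R (cst 0)) => //.
    rewrite /flat; near=> y; rewrite ifF//; apply/negbTE; rewrite -leNgt ltW//.
    by near: y; exact: lt_nbhsl.
  by apply: is_derive_eq; rewrite /flat ifF//; apply/negbTE; rewrite -leNgt ltW.
- apply: (@near_eq_is_derive _ R R (fun y : R => p.[y^-1] * expR (- y^-1))) => //.
    rewrite /flat; near=> y; rewrite ifT//.
    by near: y; exact: lt_nbhsr.
  rewrite /flat x0.
  have xn0 : x != 0 by rewrite gt_eqF.
  have dV : is_derive x 1 (fun y : R => y^-1) (- x ^- 2).
    apply: is_derive_eq; first exact: is_deriveV.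
    by rewrite [LHS]mulr1.
  have d1 := @is_derive1_comp R (horner p) _ _ _ _ (is_derive_poly p x^-1) dV.
  have d2 := @is_derive1_comp R expR (- [eta GRing.inv]) _ _ _
    (is_derive_expR (- x^-1)) (is_deriveN dV).
  have d12 := is_deriveM d1 d2; apply: (is_derive_eq d12).
  rewrite /GRing.scale/= hornerM hornerXn hornerD hornerN exprVn; ring.
- have [C hC] := flat_quadratic p.
  rewrite {2}/flat ltxx; apply: (@is_derive_quadratic _ _ _ _ C 1) => // h _.
  by rewrite add0r mulr0 subr0 {2}/flat ltxx subr0.
Unshelve. all: by end_near. Qed.

Lemma flat1_ge0 x : 0 <= flat 1 x.
Proof. by rewrite /flat; case: ifP => // _; rewrite hornerC mul1r expR_ge0. Qed.

Lemma flat1_le1 x : flat 1 x <= 1.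
Proof.
rewrite /flat; case: ifP => // x0; rewrite hornerC mul1r -expR0 ler_expR.
by rewrite oppr_le0 invr_ge0 ltW.
Qed.

Lemma flat1_gt0 x : (0 < flat 1 x) = (0 < x).
Proof.
by rewrite /flat; case: ifP => // _; rewrite ?ltxx// hornerC mul1r expR_gt0.
Qed.

(** Rescaled, the flat function tends to the indicator function of x > 0. *)
Lemma flat1_cvg (x : R) : (0 < x) -> flat 1 (k.+1%:R * x) @[k --> \oo] --> (1 : R).
Proof.
move=> x0.
rewrite (_ : (fun k => _) = fun k : nat => expR (- (k.+1%:R^-1 * x^-1))); last first.
  by apply/funext => k; rewrite /flat mulr_gt0// hornerC mul1r invfM.
rewrite -[X in _ --> X]expR0; apply: continuous_cvg; first exact: continuous_expR.
rewrite -[X in _ --> X]oppr0; apply: cvgN.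
rewrite -[X in _ --> X](mul0r x^-1); apply: cvgMl; exact: cvg_harmonic.
Qed.

Lemma smooth_flat_coord n p (i : 'I_n) (c d : R) :
  smooth (fun x : 'rV[R]_n => flat p (c * x ord0 i + d)).
Proof.
have dl (x : 'rV[R]_n) : differentiable (fun x : 'rV[R]_n => c * x ord0 i + d) x.
  apply: differentiableD => //; apply: differentiableZ.
  exact: differentiable_coord.
have df q (x : 'rV[R]_n) : differentiable (fun x : 'rV[R]_n => flat q (c * x ord0 i + d)) x.
  apply: (@differentiable_comp _ _ _ _ (fun x : 'rV[R]_n => c * x ord0 i + d)) => //.
  by apply/derivable1_diffP; have := is_derive_flat q (c * x ord0 i + d); case.
apply: (@smooth_coind _ _ [set g | exists q k,
  g = fun x : 'rV[R]_n => k * flat q (c * x ord0 i + d)]); last first.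
  by exists p, 1; apply/funext => x; rewrite mul1r.
- move=> _ j [q [k ->]].
  exists ('X^2 * (q - q^`())), (k * (c * (j == i)%:R)); apply/funext => x.
  rewrite deriveMl; last exact: diff_derivable.
  rewrite -[RHS]mulrA; congr (_ * _).
  apply: derive_val; apply/is_derive_lineP.
  have dd : is_derive (0 : R) 1 (fun t : R => t * (c * (j == i)%:R) + (c * x ord0 i + d))
      (c * (j == i)%:R).
    by apply: is_derive_eq; rewrite /GRing.scale/=; ring.
  have d1 := @is_derive1_comp R (flat q) _ _ _ _ (is_derive_flat q _) dd.
  rewrite (_ : (fun t : R => _) = flat q \o
      (fun t : R => t * (c * (j == i)%:R) + (c * x ord0 i + d))).
    by apply: (is_derive_eq d1); rewrite mul0r add0r mulrC.
  by apply/funext => t /=; rewrite !mxE eqxx/= [i == j]eq_sym; congr flat; ring.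
- by move=> _ [q [k ->]] x; exact: differentiableM.
Qed.

End flat.
(** * Test functions *)

Section box.
Context {R : realType}.

Definition box n (M : R) : set 'rV[R]_n := [set x | forall i, `|x ord0 i| <= M].

Lemma measurable_box n (M : R) : measurable (@box n M).
Proof.
rewrite (_ : @box n M = \bigcap_(i in [set: 'I_n])
    (rV_coord i @^-1` [set t | `|t| <= M])).
  apply: fin_bigcap_measurable => // i _.
  rewrite -[X in measurable X]setTI; apply: measurable_rV_coord => //.
  rewrite (_ : mkset _ = `[- M, M]%classic); first exact: measurable_itv.
  by apply/seteqP; split => t /=; rewrite in_itv/= ler_norml.
by apply/seteqP; split=> x /= h i; [move=> _|]; exact: h.
Qed.

(** The indicator function of a cube is a product, so that its integral in the
    first coordinate is a multiple of the indicator function of a cube of one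
    dimension less. *)
Lemma leb_box_lty n (M : R) : (@leb R n (@box n M) < +oo)%E.
Proof.
elim: n => [|n IH]; first by rewrite (le_lt_trans (@probability_le1 _ _ _ _ _ _))// ?ltry//;
  exact: measurable_box.
have mi k : measurable_fun setT (fun x : 'rV[R]_k => (\1_(@box k M) x)%:E : \bar R).
  by apply/measurable_EFinP; apply: measurable_indic; exact: measurable_box.
have -> : @leb R n.+1 (@box n.+1 M) = (\int[@leb R n.+1]_x (\1_(@box n.+1 M) x)%:E)%E.
  by rewrite integral_indic ?setIT//; exact: measurable_box.
rewrite tonelli_lebS//.
rewrite (_ : (fun y => _) = (fun y => (\int[@lebesgue_measure R]_s
    (\1_(`[- M, M]%classic) s)%:E)%E * (\1_(@box n M) y)%:E)%E); last first.
  apply/funext => y; rewrite -ge0_integralZr//; last first.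
    by apply/measurable_EFinP; apply: measurable_indic; exact: measurable_itv.
  apply: eq_integral => s _; rewrite -EFinM !indicE -natrM mulnb; congr (_%:R%:E).
  congr (nat_of_bool _).
  apply/idP/andP => [/set_mem h|[/set_mem h1 /set_mem h2]].
    split; apply/mem_set => /=.
    - by have := h ord0; rewrite rV_cons0 in_itv/= ler_norml.
    - by move=> i; have := h (lift ord0 i); rewrite rV_consS.
  apply/mem_set => i; case: (unliftP ord0 i) => [j|] ->.
  - by rewrite rV_consS; exact: h2.
  - by rewrite rV_cons0 ler_norml; move: h1; rewrite /= in_itv.
rewrite ge0_integralZl//; last 2 first.
- exact: mi.
- exact: integral_ge0.
rewrite !integral_indic ?setIT//; last exact: measurable_box.
by apply: lte_mul_pinfty => //=; rewrite lebesgue_measure_itv/=; case: ifP.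
Qed.

End box.

Section test_functions.
Context {R : realType} {n : nat}.
Local Notation Rn := 'rV[R]_n.
Local Notation mu := (@leb R n).
Local Notation e_ i := (delta_mx ord0 i : Rn).
Implicit Types f phi : Rn -> R.

Lemma coord_le_norm (x : Rn) i : `|x ord0 i| <= `|x|.
Proof.
have /mapP[j Hj ->] : `|x ord0 i| \in [seq `|x y.1 y.2| | y : 'I_1 * 'I_n].
  by apply/mapP; exists (ord0, i) => //=; rewrite mem_enum.
by rewrite [leRHS]/Num.norm /= mx_normrE; apply/bigmax_geP; right => /=; exists j.
Qed.

Lemma norm_le_coord (x : Rn) M : 0 <= M -> (forall i, `|x ord0 i| <= M) -> `|x| <= M.
Proof.
move=> M0 h; rewrite [leLHS]/Num.norm/= mx_normrE; apply/bigmax_leP; split=> // -[i j] _.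
by rewrite ord1.
Qed.

Lemma test_funP phi : test_fun phi <->
  smooth phi /\ exists M, forall x, phi x != 0 -> box M x.
Proof.
split=> [[sphi cphi]|[sphi [M hM]]]; split=> //.
- have [M [Mr hM]] := compact_bounded cphi.
  exists (M + 1) => x x0 i; apply: le_trans (coord_le_norm x i) _.
  by apply: hM; [rewrite ltrDl|exact: subset_closure].
- apply: bounded_closed_compact; last exact: closed_closure.
  have cb : closed [set x : Rn | `|x| <= `|M|].
    rewrite (_ : mkset _ = (fun x : Rn => `|x|) @^-1` [set t | t <= `|M|])//.
    by apply: closed_comp => [x _|]; [exact: norm_continuous|exact: closed_le].
  exists `|M|; split; first exact: num_real.
  move=> N MN x xS /=; rewrite ltW// (le_lt_trans _ MN)//.
  suff : closure [set x | phi x != 0] `<=` [set x : Rn | `|x| <= `|M|] by apply.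
  rewrite [X in _ `<=` X](closure_id _).1//; apply: closure_subset => y y0.
  by apply: norm_le_coord => // i; rewrite (le_trans (hM y y0 i))// ler_norm.
Qed.

Lemma test_smooth phi : test_fun phi -> smooth phi.
Proof. by case/test_funP. Qed.

Lemma test_support phi : test_fun phi -> exists M, forall x, ~ box M x -> phi x = 0.
Proof.
case/test_funP => _ [M hM]; exists M => x xM.
by apply/eqP; apply: contrapT => /negP/hM.
Qed.

Lemma test_mul phi f : test_fun phi -> smooth f -> test_fun (fun x => phi x * f x).
Proof.
move=> /test_funP[sp [M hM]] sf; apply/test_funP; split; first exact: smoothM.
by exists M => x; rewrite mulf_eq0 negb_or => /andP[+ _]; exact: hM.
Qed.

Lemma testZ (a : R) phi : test_fun phi -> test_fun (fun x => a * phi x).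
Proof.
move=> tp; rewrite (_ : (fun _ => _) = fun x => phi x * a).
  by apply: test_mul => //; exact: smooth_cst.
by apply/funext => x; rewrite mulrC.
Qed.

(** Off a large cube, phi vanishes in a neighbourhood of each point. *)
Lemma test_partial phi i : test_fun phi -> test_fun ('D_(e_ i) phi).
Proof.
move=> /test_funP[sp [M hM]]; apply/test_funP; split; first exact: smoothD1.
exists `|M| => x; apply: contra_neqP => /existsNP[j /negP]; rewrite -ltNge => Mx.
rewrite (@near_eq_derive _ _ _ phi (cst 0)) ?derive_cst//.
have : nbhs x [set y : Rn | `|M| < `|y ord0 j|].
  have : continuous (fun y : Rn => `|y ord0 j|).
    by move=> y; apply: continuous_comp; [exact: coord_continuous|exact: norm_continuous].
  by move=> /(_ x)/cvgr_gt; apply.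
apply: filterS => y My; apply/eqP; apply: contrapT => /negP/hM/(_ j).
by apply/negP; rewrite -ltNge (le_lt_trans (ler_norm M)).
Qed.

Lemma test_partials phi s : test_fun phi -> test_fun (partials s phi).
Proof. by move=> tp; elim: s => //= i s; exact: test_partial. Qed.

Lemma test_affine phi (c : R) (a : Rn) : c != 0 -> test_fun phi ->
  test_fun (fun x => phi (c *: x + a)).
Proof.
move=> c0 /test_funP[sp [M hM]]; apply/test_funP; split; first exact: smooth_affine.
exists (`|c|^-1 * (M + `|a|)) => x /hM + i => /(_ i); rewrite !mxE => h.
rewrite mulrC ler_pdivlMr ?normr_gt0// mulrC -normrM.
rewrite -[_ * _](addrK (a ord0 i)) (le_trans (ler_normB _ _))// lerD//.
exact: coord_le_norm.
Qed.

Lemma test_translation phi (a : Rn) : test_fun phi -> test_fun (fun x => phi (x + a)).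
Proof.
move=> tp; have := test_affine a (oner_neq0 R) tp.
by under [X in test_fun X -> _]eq_fun do rewrite scale1r.
Qed.

Lemma derive_translation phi (a x : Rn) i : smooth phi ->
  'D_(e_ i) (fun x => phi (x + a)) x = 'D_(e_ i) phi (x + a).
Proof.
move=> sp; have := derive_affine 1 a x i sp; rewrite mul1r scale1r => <-.
rewrite (_ : (fun y => phi (1 *: y + a)) = fun y => phi (y + a))//.
by apply/funext => y; rewrite scale1r.
Qed.

Lemma test_bounded phi : test_fun phi -> exists2 C, 0 <= C & forall x, `|phi x| <= C.
Proof.
move=> [sp cp]; have cphi := smooth_continuous (sp : smooth phi).
have /compact_bounded[C [_ hC]] :=
  continuous_compact (@continuous_subspaceT _ _ _ _ cphi) cp.
exists `|C + 1| => // x; have [->|x0] := eqVneq (phi x) 0; first by rewrite normr0.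
rewrite (le_trans _ (ler_norm _))//; apply: hC; first by rewrite ltrDl.
by exists x => //; exact: subset_closure.
Qed.

Lemma test_measurable phi : test_fun phi -> measurable_fun setT phi.
Proof. by move=> tp; apply: smooth_measurable; exact: test_smooth. Qed.

Lemma integrable_bounded_box (C M : R) :
  mu.-integrable setT (fun x => (C * \1_(box M) x)%:E).
Proof.
under eq_fun do rewrite EFinM.
have mB := @measurable_box R n M.
apply: integrableZl => //; apply/integrableP; split.
  by apply/measurable_EFinP; exact: measurable_indic.
rewrite (eq_integral (fun x => (\1_(box M) x)%:E)).
  by rewrite integral_indic// setIT leb_box_lty.
by move=> x _; rewrite gee0_abs// lee_fin.
Qed.

Lemma L2_box (M : R) : L2 (fun x : Rn => \1_(box M) x : R).
Proof.
apply/L2P; split; first by apply: measurable_indic; exact: measurable_box.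
rewrite (_ : (fun x => _) = fun x => (\1_(@box R n M) x)%:E).
  rewrite integral_indic// ?setIT; [exact: leb_box_lty|exact: measurable_box].
by apply/funext => x; rewrite indicE; case: (_ \in _); rewrite ?expr1n ?expr0n.
Qed.

Lemma test_le_box phi : test_fun phi ->
  exists C M, 0 <= C /\ forall x, `|phi x| <= C * \1_(box M) x.
Proof.
move=> tp; have [C C0 hC] := test_bounded tp; have [M hM] := test_support tp.
exists C, M; split=> // x; rewrite indicE.
have [xM|/negP xM] := boolP (x \in _); first by rewrite mulr1.
by rewrite hM ?normr0 ?mulr0// => h; apply: xM; exact: mem_set.
Qed.

Lemma test_L2 phi : test_fun phi -> L2 phi.
Proof.
move=> tp; have [C [M [C0 h]]] := test_le_box tp.
apply: (L2_le (L2Z C (L2_box M)) (test_measurable tp)).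
by apply: aeW => x; rewrite [leRHS]ger0_norm// (le_trans _ (h x)).
Qed.

Lemma test_integrable phi : test_fun phi -> mu.-integrable setT (EFin \o phi).
Proof.
move=> tp; have [C [M [C0 h]]] := test_le_box tp.
apply: (le_integrable measurableT _ _ (integrable_bounded_box C M)).
  by apply/measurable_EFinP; exact: test_measurable.
by move=> x _; rewrite lee_fin [leRHS]ger0_norm// (le_trans _ (h x)).
Qed.

(** A product of flat functions of the distances to the faces of a cube. *)
Definition cube_bump (M : R) (x : Rn) : R :=
  \prod_(i < n) (flat 1 (1 * x ord0 i + M) * flat 1 (-1 * x ord0 i + M)).

Lemma test_cube_bump M : test_fun (cube_bump M).
Proof.
apply/test_funP; split.
  by apply: smooth_prod => i; apply: smoothM; exact: smooth_flat_coord.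
exists M => x /prodf_neq0 h i; have := h i isT.
rewrite mulf_eq0 negb_or => /andP[h1 h2].
have : 0 < flat 1 (1 * x ord0 i + M) by rewrite lt0r h1 flat1_ge0.
have : 0 < flat 1 (-1 * x ord0 i + M) by rewrite lt0r h2 flat1_ge0.
rewrite !flat1_gt0 => {}h1 {}h2.
by rewrite ler_norml; apply/andP; split; lra.
Qed.

Lemma cube_bump_ge0 M x : 0 <= cube_bump M x.
Proof. by apply: prodr_ge0 => i _; rewrite mulr_ge0 ?flat1_ge0. Qed.

Lemma cube_bump_gt0 M (x : Rn) : (forall i, `|x ord0 i| < M) -> 0 < cube_bump M x.
Proof.
move=> h; apply: prodr_gt0 => i _; have := h i; rewrite ltr_norml => /andP[h1 h2].
by rewrite mulr_gt0 ?flat1_gt0//; lra.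
Qed.

End test_functions.
(** * Symmetry of second derivatives *)

Section Schwarz.
Context {R : realType} {n : nat}.
Local Notation Rn := 'rV[R]_n.
Local Notation e_ i := (delta_mx ord0 i : Rn).
Implicit Types f phi : Rn -> R.

Lemma MVT_increment (u du : R -> R) (h : R) : 0 < h ->
  (forall t, is_derive (t : R) (1 : R) u (du t)) ->
  exists2 c, 0 < c < h & u h - u 0 = h * du c.
Proof.
move=> h0 du_.
have cu : {within `[0, h], continuous u}.
  apply: derivable_within_continuous => t _; exact: (@ex_derive _ _ _ _ _ _ _ (du_ t)).
have [c + ->] := MVT h0 (fun t _ => du_ t) cu.
by rewrite in_itv/= subr0 mulrC => ch; exists c.
Qed.

(** The mean value theorem in direction i for the difference in direction j,
    then in direction j. *)
Lemma second_difference f (x : Rn) i j h : smooth f -> 0 < h ->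
  exists s t, [/\ 0 < s < h, 0 < t < h &
  f (x + h *: e_ i + h *: e_ j) - f (x + h *: e_ i) - (f (x + h *: e_ j) - f x) =
  h * (h * 'D_(e_ j) ('D_(e_ i) f) (x + s *: e_ i + t *: e_ j))].
Proof.
move=> sf h0.
pose p r := f (x + h *: e_ j + r *: e_ i) - f (x + r *: e_ i).
have dp t : is_derive (t : R) (1 : R) p ('D_(e_ i) f (x + h *: e_ j + t *: e_ i) -
                             'D_(e_ i) f (x + t *: e_ i)).
  by apply: is_deriveB; exact: smooth_line.
have [s sh ps] := MVT_increment h0 dp.
pose q r := 'D_(e_ i) f (x + s *: e_ i + r *: e_ j).
have dq t : is_derive (t : R) (1 : R) q ('D_(e_ j) ('D_(e_ i) f) (x + s *: e_ i + t *: e_ j)).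
  by apply: smooth_line; exact: smoothD1.
have [t th qt] := MVT_increment h0 dq.
exists s, t; split=> //; rewrite -qt.
move: ps; rewrite /p /q !scale0r !addr0 => ps.
by rewrite [x + h *: e_ i + _]addrAC ps [x + h *: e_ j + _]addrAC.
Qed.

Lemma dist_lt_add (u v z r : R) : `|u - z| < r -> `|v - z| < r -> `|u - v| < r + r.
Proof.
move=> uz vz; rewrite (_ : u - v = (u - z) - (v - z)); last by ring.
by rewrite (le_lt_trans (ler_normB _ _))// ltrD.
Qed.

(** The second difference is symmetric in the two directions, so the two mixed
    derivatives have a common value arbitrarily close to x; they are continuous. *)
Lemma Schwarz f i j : smooth f ->
  'D_(e_ i) ('D_(e_ j) f) = 'D_(e_ j) ('D_(e_ i) f).
Proof.
move=> sf; apply/funext => x.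
set a := 'D_(e_ i) ('D_(e_ j) f); set b := 'D_(e_ j) ('D_(e_ i) f).
have ca : continuous a := smooth_continuous (smoothD1 i (smoothD1 j sf)).
have cb : continuous b := smooth_continuous (smoothD1 j (smoothD1 i sf)).
apply/eqP; rewrite -subr_eq0; apply: contraT => ab0.
pose r := `|a x - b x| / 2.
have r0 : 0 < r by rewrite divr_gt0// normr_gt0.
have : nbhs x [set y | `|a x - a y| < r /\ `|b x - b y| < r].
  by apply: filterI; [have /cvgrPdist_lt := ca x|have /cvgrPdist_lt := cb x]; apply.
move=> /nbhs_ballP[e /= e0 he].
have inb s t k l : 0 < s < e / 2 -> 0 < t < e / 2 ->
    ball x e (x + s *: e_ k + t *: e_ l).
  move=> /andP[s0 se] /andP[t0 te]; rewrite -ball_normE/= -addrA opprD addNKr normrN.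
  rewrite (le_lt_trans (ler_normD _ _))// !normrZ (gtr0_norm s0) (gtr0_norm t0).
  have ne m : `|e_ m| <= 1.
    apply: norm_le_coord => // q; rewrite mxE eqxx/=.
    by case: (q == m); rewrite ?normr0 ?normr1.
  rewrite (le_lt_trans (lerD (ler_piMr (ltW s0) (ne k)) (ler_piMr (ltW t0) (ne l))))//.
  by rewrite [ltRHS]splitr ltrD.
have h0 : 0 < e / 2 by rewrite divr_gt0.
have [s [t [hs ht E1]]] := second_difference x i j sf h0.
have [s' [t' [hs' ht' E2]]] := second_difference x j i sf h0.
have E : b (x + s *: e_ i + t *: e_ j) = a (x + s' *: e_ j + t' *: e_ i).
  have hn : e / 2 != 0 by rewrite gt_eqF.
  apply: (mulfI hn); apply: (mulfI hn); apply: etrans (esym E1) (etrans _ E2).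
  rewrite [x + _ + (e / 2) *: e_ j]addrAC; move: (f _) (f _) (f _) (f _) => u1 u2 u3 u4.
  clear; ring.
have [_ B] := he _ (inb s t i j hs ht); have [A _] := he _ (inb s' t' j i hs' ht').
rewrite E in B; have := dist_lt_add A B.
by rewrite -splitr ltxx.
Qed.

Lemma partials_move f i s t : smooth f ->
  partials (s ++ i :: t) f = partials (i :: s ++ t) f.
Proof.
move=> sf; elim: s => [//|j s IH].
rewrite cat_cons -[LHS]/('D_(e_ j) (partials (s ++ i :: t) f)) IH.
exact: (Schwarz j i (smooth_partials (s ++ t) sf)).
Qed.

Lemma partials_perm f s t : smooth f -> perm_eq s t -> partials s f = partials t f.
Proof.
move=> sf; elim: s t => [|i s IH] t st.
  by have /perm_size/esym/size0nil -> := st.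
have it : i \in t by rewrite -(perm_mem st) mem_head.
case/splitPr: it st => t1 t2; rewrite perm_sym perm_catC cat_cons perm_cons perm_catC perm_sym.
by move=> /IH st; rewrite partials_move//= st.
Qed.

Definition dirac_mi (i : 'I_n) : 'I_n -> nat := fun j => (j == i) : nat.

Lemma morder_dirac i : morder (dirac_mi i) = 1%N.
Proof. by rewrite /morder (bigD1 i)//= /dirac_mi eqxx big1 ?addn0// => j /negPf ->. Qed.

Lemma count_mpartial (a : pred 'I_n) (alpha : 'I_n -> nat) :
  count a (flatten [seq nseq (alpha i) i | i <- enum 'I_n]) =
  (\sum_i a i * alpha i)%N.
Proof.
rewrite count_flatten -map_comp sumnE big_map big_enum/=.
by apply: eq_bigr => i _; rewrite /= count_nseq.
Qed.

Lemma mpartialD f (alpha beta : 'I_n -> nat) : smooth f ->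
  mpartial (fun i => alpha i + beta i)%N f = mpartial alpha (mpartial beta f).
Proof.
move=> sf; rewrite /mpartial -partials_cat; apply: partials_perm => //.
apply/permP => a; rewrite count_cat !count_mpartial -big_split.
by apply: eq_bigr => i _; rewrite mulnDr.
Qed.

Lemma mpartial_dirac f i : smooth f -> mpartial (dirac_mi i) f = 'D_(e_ i) f.
Proof.
move=> sf; rewrite -[RHS]/(partials [:: i] f); apply: partials_perm => //.
apply/permP => a; rewrite count_mpartial /= addn0 (bigD1 i)//= /dirac_mi eqxx muln1.
by rewrite big1 ?addn0// => j /negPf ->; rewrite muln0.
Qed.

End Schwarz.

Section derivative_of_correlation.
Context {R : realType} {n : nat}.
Local Notation Rn := 'rV[R]_n.
Local Notation mu := (@leb R n).
Local Notation e_ i := (delta_mx ord0 i : Rn).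

(** Differentiation under the integral sign: for s near t, the derivatives of
    phi (x + s e_i) are dominated by a multiple of the indicator function of one
    cube. *)
Lemma is_derive_correlation (f phi : Rn -> R) i (t : R) : L2 f -> test_fun phi ->
  is_derive t (1 : R) (fun t : R => \int[mu]_x (f x * phi (x + t *: e_ i)))
    (\int[mu]_x (f x * 'D_(e_ i) phi (x + t *: e_ i))).
Proof.
move=> Lf tp; have sp := test_smooth tp.
have [C [M [C0 hC]]] := test_le_box (test_partial i tp).
pose G (x : Rn) := `|f x| * (C * \1_(box (M + `|t| + 1)) x).
have Lab : L2 (fun x => `|f x|).
  apply: (L2_le Lf); last by apply: aeW => x; rewrite normr_id.
  by apply: measurableT_comp => //; exact: L2_measurable.
have d s x : is_derive s (1 : R) (fun s : R => f x * phi (x + s *: e_ i))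
    (f x * 'D_(e_ i) phi (x + s *: e_ i)).
  have d0 := smooth_line x i s sp.
  by apply: (is_derive_eq (is_deriveZ (f x) d0)).
have tI : [set` `]t - 1, t + 1[] t.
  by rewrite /= in_itv/=; apply/andP; split; lra.
have E s x : partial1of2 (fun s x => f x * phi (x + s *: e_ i)) s x =
    f x * 'D_(e_ i) phi (x + s *: e_ i).
  by rewrite partial1of2E; exact: (@derive_val _ _ _ _ _ _ _ (d s x)).
have H := @cvg_differentiation_under_integral R _ _ mu
  (fun s x => f x * phi (x + s *: e_ i)) setT measurableT t (t - 1) (t + 1) tI _ _ G _ _ _.
have K : h^-1 *: ((fun t : R => \int[mu]_x (f x * phi (x + t *: e_ i))) (h + t) -
   \int[mu]_x (f x * phi (x + t *: e_ i))) @[h --> 0^'] -->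
   \int[mu]_x (f x * 'D_(e_ i) phi (x + t *: e_ i)).
  rewrite (_ : \int[mu]_x (f x * 'D_(e_ i) phi (x + t *: e_ i)) =
    \int[mu]_x (partial1of2 (fun s x => f x * phi (x + s *: e_ i)) t x)).
    apply: H.
    - by move=> s _; apply: L2_integrableM => //; apply: test_L2; exact: test_translation.
    - by move=> s x _ _; exact: (@ex_derive _ _ _ _ _ _ _ (d s x)).
    - move=> x; rewrite /G mulr_ge0// mulr_ge0//.
    - by apply: L2_integrableM => //; apply: L2Z; exact: L2_box.
    - move=> s x; rewrite /= in_itv/= => /andP[s1 s2] _; rewrite E normrM ler_wpM2l//.
      rewrite (le_trans (hC _))// ler_wpM2l// !indicE ler_nat.
      have [xM|//] := boolP (_ \in _); rewrite mem_set// => k.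
      move/set_mem: xM => /(_ k); rewrite !mxE => xM.
      have : `|s * (e_ i) ord0 k| <= `|t| + 1.
        rewrite mxE eqxx/= normrM; have : `|s| <= `|t| + 1.
          by have := ler_norm t; have := ler_norm (- t); rewrite normrN ler_norml; lra.
        by case: (k == i); rewrite ?normr1 ?normr0 ?mulr1 ?mulr0//; have := normr_ge0 t; lra.
      rewrite mxE eqxx/= => h; rewrite -[x ord0 k](addrK (s * (k == i)%:R)).
      by rewrite (le_trans (ler_normB _ _))// -addrA lerD.
  by apply: eq_Rintegral => x _; rewrite E.
apply: DeriveDef; first apply/cvg_ex; first eexists.
- by under eq_fun do rewrite /= /GRing.scale/= mulr1; exact: K.
- apply/cvg_lim => //.
  by under eq_fun do rewrite /= /GRing.scale/= mulr1; exact: K.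
Qed.

End derivative_of_correlation.
(** * The fundamental lemma of the calculus of variations *)

Section fundamental_lemma.
Context {R : realType} {n : nat}.
Local Notation Rn := 'rV[R]_n.
Local Notation mu := (@leb R n).
Implicit Types (p w phi : Rn -> R) (A : set Rn).

Lemma Rintegral_dominated_cvg (f_ : nat -> Rn -> R) (f G : Rn -> R) :
  (forall k, measurable_fun setT (f_ k)) ->
  (forall x, f_ k x @[k --> \oo] --> f x) ->
  mu.-integrable setT (EFin \o G) -> (forall k x, `|f_ k x| <= G x) ->
  \int[mu]_x f_ k x @[k --> \oo] --> \int[mu]_x f x.
Proof.
move=> mf cf iG fG.
have mlim : measurable_fun setT f.
  by apply: (@measurable_fun_cvg _ _ _ _ f_) => // x _; exact: cf.
have fi : mu.-integrable setT (EFin \o f).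
  apply: (le_integrable measurableT _ _ iG); first exact/measurable_EFinP.
  move=> x _; rewrite lee_fin /= (le_trans _ (ler_norm _))//.
  have /cvg_norm cn := cf x.
  rewrite -(cvg_lim _ cn)//; apply: limr_le; [exact: cvgP cn|exact: nearW].
have H := @dominated_cvg _ _ _ mu setT measurableT (fun k x => (f_ k x)%:E)
  (EFin \o f) (EFin \o G) _ _ _ iG _.
apply: fine_cvg; rewrite fineK; last exact: integrable_fin_num.
apply: H => //.
- by move=> k; exact/measurable_EFinP.
- by move=> x _; apply: cvg_EFin; [exact: nearW|exact: cf].
- by move=> k x _; rewrite lee_fin.
Qed.

Lemma integrable_mul_le1 p (g : Rn -> R) : mu.-integrable setT (EFin \o p) ->
  measurable_fun setT g -> (forall x, `|g x| <= 1) ->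
  mu.-integrable setT (fun x => (p x * g x)%:E).
Proof.
move=> ip mg g1; apply: (le_integrable measurableT _ _ ip).
  have /integrableP[/measurable_EFinP mp _] := ip.
  by apply/measurable_EFinP; exact: measurable_funM.
by move=> x _; rewrite lee_fin normrM ler_piMr.
Qed.

Lemma integrable_norm p : mu.-integrable setT (EFin \o p) ->
  mu.-integrable setT (EFin \o (fun x => `|p x|)).
Proof. by move=> ip; exact: (integrable_abse ip). Qed.

Definition unit_smooth phi := smooth phi /\ forall x, 0 <= phi x <= 1.

Lemma unit_smooth_compl phi : unit_smooth phi -> unit_smooth (fun x => 1 - phi x).
Proof.
move=> [sp p1]; split; last by move=> x; have := p1 x; lra.
rewrite (_ : (fun x => _) = fun x => 1 + (-1) * phi x).
  by apply: smoothD; [|apply: smoothM => //]; exact: smooth_cst.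
by apply/funext => x; ring.
Qed.

Lemma unit_smooth_mul phi psi : unit_smooth phi -> unit_smooth psi ->
  unit_smooth (fun x => phi x * psi x).
Proof.
move=> [sp p1] [sq q1]; split; first exact: smoothM.
move=> x; have /andP[a b] := p1 x; have /andP[c d] := q1 x.
by rewrite mulr_ge0//= mulr_ile1.
Qed.

Section approximation.
Variable p : Rn -> R.
Hypothesis ip : mu.-integrable setT (EFin \o p).

(** The sets whose indicator function is a limit of smooth functions in the
    space L^1 of the finite measure of density |p|. *)
Definition approximable : set (set Rn) := [set A | measurable A /\
  forall e, 0 < e -> exists2 phi, unit_smooth phi &
    \int[mu]_x (`|p x| * `|\1_A x - phi x|) < e].

Let indic_le1 A (x : Rn) : 0 <= (\1_A x : R) <= 1.
Proof. by rewrite indicE; case: (_ \in _); rewrite ?ler01 ?lexx. Qed.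

Let iapp A phi : measurable A -> unit_smooth phi ->
  mu.-integrable setT (fun x => (`|p x| * `|\1_A x - phi x|)%:E).
Proof.
move=> mA [sp p1]; apply: integrable_mul_le1; first exact: integrable_norm.
  apply: measurableT_comp => //; apply: measurable_funB; last exact: smooth_measurable.
  exact: measurable_indic.
move=> x; rewrite normr_id ler_norml; have := p1 x; have := indic_le1 A x.
by move=> /andP[? ?] /andP[? ?]; apply/andP; split; lra.
Qed.

Let iapp2 A B : measurable A -> measurable B ->
  mu.-integrable setT (fun x => (`|p x| * `|\1_A x - \1_B x|)%:E).
Proof.
move=> mA mB; apply: integrable_mul_le1; first exact: integrable_norm.
  by apply: measurableT_comp => //; apply: measurable_funB; exact: measurable_indic.
move=> x; rewrite normr_id ler_norml; have := indic_le1 B x; have := indic_le1 A x.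
by move=> /andP[? ?] /andP[? ?]; apply/andP; split; lra.
Qed.

Lemma approximableC A : approximable A -> approximable (~` A).
Proof.
move=> [mA hA]; split; first exact: measurableC.
move=> e e0; have [phi up pe] := hA e e0.
exists (fun x => 1 - phi x); first exact: unit_smooth_compl.
apply: le_lt_trans pe; rewrite le_eqVlt; apply/orP; left; apply/eqP.
apply: eq_Rintegral => x _; congr (_ * _); rewrite -normrN; congr `|_|.
by rewrite !indicE in_setC; case: (_ \in _) => /=; ring.
Qed.

Lemma approximableU A B : approximable A -> approximable B -> approximable (A `|` B).
Proof.
move=> [mA hA] [mB hB]; split; first exact: measurableU.
move=> e e0; have e2 : 0 < e / 2 by rewrite divr_gt0.
have [phi up pe] := hA _ e2; have [psi us qe] := hB _ e2.
have uc := unit_smooth_mul (unit_smooth_compl up) (unit_smooth_compl us).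
(* the complement of the union is the intersection of the complements *)
exists (fun x => 1 - (1 - phi x) * (1 - psi x)); first exact: unit_smooth_compl.
apply: (@le_lt_trans _ _ (\int[mu]_x (`|p x| * `|\1_A x - phi x| +
    `|p x| * `|\1_B x - psi x|))); last first.
  by rewrite RintegralD//; [rewrite [ltRHS](splitr e) ltrD|exact: iapp..].
apply: le_Rintegral => //; first by apply: iapp; [exact: measurableU|exact: unit_smooth_compl].
  by rewrite /comp; under eq_fun do rewrite EFinD; apply: integrableD => //; exact: iapp.
move=> x _; rewrite -mulrDr ler_wpM2l//.
have -> : \1_(A `|` B) x = \1_A x + \1_B x - \1_A x * \1_B x :> R.
  by rewrite !indicE in_setU; do 2 case: (_ \in _) => /=; ring.
have -> : \1_A x + \1_B x - \1_A x * \1_B x - (1 - (1 - phi x) * (1 - psi x)) =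
    (\1_A x - phi x) * (1 - \1_B x) + (\1_B x - psi x) * (1 - phi x) by ring.
have /andP[p0 p1] := up.2 x; have /andP[b0 b1] := indic_le1 B x.
rewrite (le_trans (ler_normD _ _))// !normrM lerD// ler_piMr// ger0_norm; lra.
Qed.

Lemma approximable0 : approximable set0.
Proof.
split=> // e e0; exists (fun=> 0).
  by split; [exact: smooth_cst|move=> x; rewrite lexx ler01].
under eq_Rintegral do rewrite indic0 subr0 normr0 mulr0.
by rewrite Rintegral_cst// mul0r.
Qed.

(** Dominated convergence for the measure of density |p|. *)
Lemma approximable_lim (F : nat -> set Rn) A : measurable A ->
  (forall k, approximable (F k)) ->
  (forall x, (\1_(F k) x : R) @[k --> \oo] --> (\1_A x : R)) -> approximable A.
Proof.
move=> mA aF cF; split=> // e e0; have e2 : 0 < e / 2 by rewrite divr_gt0.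
have L : \int[mu]_x (`|p x| * `|\1_A x - \1_(F k) x|) @[k --> \oo] --> (0 : R).
  have -> : (0 : R) = \int[mu]_x (fun=> 0) x by rewrite Rintegral_cst// mul0r.
  have /integrableP[/measurable_EFinP mp _] := ip.
  apply: (@Rintegral_dominated_cvg _ _ (fun x => `|p x|)).
  - move=> k; apply: measurable_funM; first exact: measurableT_comp.
    apply: measurableT_comp => //; apply: measurable_funB; apply: measurable_indic => //.
    by have [] := aF k.
  - move=> x; rewrite -[X in _ --> X](mulr0 `|p x|); apply: cvgMr.
    rewrite -[X in _ --> X](@normr0 _ R); apply: cvg_norm.
    by rewrite -[X in _ --> X](subrr (\1_A x)); apply: cvgB => //; exact: cvg_cst.
  - exact: integrable_norm.
  - move=> k x; rewrite normrM !normr_id ler_piMr// ler_norml.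
    have /andP[? ?] := indic_le1 A x; have /andP[? ?] := indic_le1 (F k) x.
    by apply/andP; split; lra.
have /cvgrPdist_lt/(_ _ e2)[k _ /(_ k (leqnn k))/=] := L.
rewrite distrC subr0 => Lk; have [mF /(_ _ e2)[phi up pe]] := aF k.
exists phi => //.
apply: (@le_lt_trans _ _ (\int[mu]_x (`|p x| * `|\1_A x - \1_(F k) x| +
    `|p x| * `|\1_(F k) x - phi x|))); last first.
  rewrite RintegralD//; [|exact: iapp2|exact: iapp].
  by rewrite [ltRHS](splitr e) ltrD// (le_lt_trans (ler_norm _)).
apply: le_Rintegral => //; first exact: iapp.
  by rewrite /comp; under eq_fun do rewrite EFinD; apply: integrableD => //;
    [exact: iapp2|exact: iapp].
by move=> x _; rewrite -mulrDr ler_wpM2l// (le_trans _ (ler_normD _ _))// addrA subrK.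
Qed.

Lemma approximable_bigcup (F : nat -> set Rn) :
  (forall k, approximable (F k)) -> approximable (\bigcup_k F k).
Proof.
move=> aF; apply: (@approximable_lim (fun k => \big[setU/set0]_(i < k) F i)).
- by apply: bigcupT_measurable => k; have [] := aF k.
- elim=> [|k IH]; first by rewrite big_ord0; exact: approximable0.
  by rewrite big_ord_recr/=; exact: approximableU.
- move=> x; have [[k _ Fk]|nF] := pselect ((\bigcup_k F k) x).
    apply: cvg_near_cst; exists k.+1 => // m /= km.
    rewrite !indicE !mem_set//; first by exists k.
    by rewrite -bigcup_mkord; exists k.
  apply: cvg_near_cst; exists 0%N => // m _ /=.
  rewrite !indicE !memNset// -bigcup_mkord => -[k _ Fk]; apply: nF; by exists k.
Qed.

(** The flat function of k (x_i - c) tends to the indicator function as k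
    tends to infinity. *)
Lemma approximable_halfspace (i : 'I_n) (c : R) :
  approximable [set x : Rn | c < x ord0 i].
Proof.
have mH : measurable [set x : Rn | c < x ord0 i].
  rewrite (_ : mkset _ = rV_coord i @^-1` `]c, +oo[%classic).
    by rewrite -[X in measurable X]setTI; apply: measurable_rV_coord => //; exact: measurable_itv.
  by apply/seteqP; split=> x /=; rewrite in_itv/= andbT.
split=> // e e0.
pose phi (k : nat) (x : Rn) := flat 1 (k.+1%:R * x ord0 i + (- (k.+1%:R * c))).
have up k : unit_smooth (phi k).
  by split; [exact: smooth_flat_coord|move=> x; rewrite flat1_ge0 flat1_le1].
have L : \int[mu]_x (`|p x| * `|\1_[set x : Rn | c < x ord0 i] x - phi k x|) @[k --> \oo] --> (0 : R).
  have -> : (0 : R) = \int[mu]_x (fun=> 0) x by rewrite Rintegral_cst// mul0r.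
  have /integrableP[/measurable_EFinP mp _] := ip.
  apply: (@Rintegral_dominated_cvg _ _ (fun x => `|p x|)).
  - move=> k; apply: measurable_funM; first exact: measurableT_comp.
    apply: measurableT_comp => //; apply: measurable_funB; first exact: measurable_indic.
    by apply: smooth_measurable; have [] := up k.
  - move=> x; rewrite -[X in _ --> X](mulr0 `|p x|); apply: cvgMr.
    rewrite -[X in _ --> X](@normr0 _ R); apply: cvg_norm.
    rewrite -[X in _ --> X](subrr (\1_[set x : Rn | c < x ord0 i] x)).
    apply: cvgB; first exact: cvg_cst.
    rewrite indicE; have [xc|xc] := ltP c (x ord0 i).
      rewrite mem_set//= /phi; under eq_fun do rewrite -mulrN -mulrDr.
      by apply: flat1_cvg; rewrite subr_gt0.
    rewrite memNset//=; last by apply/negP; rewrite -leNgt.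
    apply: cvg_near_cst; apply: nearW => k; rewrite /phi /flat ifF//.
    by apply/negbTE; rewrite -leNgt -mulrN -mulrDr pmulr_rle0// subr_le0.
  - exact: integrable_norm.
  - move=> k x; rewrite normrM !normr_id ler_piMr// ler_norml.
    have /andP[? ?] := indic_le1 [set x : Rn | c < x ord0 i] x.
    have /andP[? ?] := (up k).2 x.
    by apply/andP; split; lra.
have /cvgrPdist_lt/(_ _ e0)[k _ /(_ k (leqnn k))/=] := L.
rewrite distrC subr0 => Lk; exists (phi k) => //.
exact: le_lt_trans (ler_norm _) Lk.
Qed.

(** Approximable sets form a sigma-algebra, and half-spaces generate the Borel
    sets. *)
Lemma approximable_measurable A : measurable A -> approximable A.
Proof.
have sC : sigma_algebra setT approximable.
  split=> [|B aB|F aF]; first exact: approximable0.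
  - by rewrite setTD; exact: approximableC.
  - exact: approximable_bigcup.
rewrite /measurable/=; apply: smallest_sub => //.
rewrite -bigcup_seq => B [i _ [Y mY <-]]; rewrite setTI.
suff h : (@measurable _ (measurableTypeR R)) `<=`
    [set Y | approximable (rV_coord i @^-1` Y)] by exact: h.
rewrite RGenOInfty.measurableE; apply: smallest_sub.
  split=> [|Z aZ|F aF] /=.
  - by rewrite preimage_set0; exact: approximable0.
  - by rewrite setTD preimage_setC; exact: approximableC.
  - by rewrite preimage_bigcup; exact: approximable_bigcup.
move=> _ [c ->] /=; rewrite (_ : _ @^-1` _ = [set x : Rn | c < x ord0 i]).
  exact: approximable_halfspace.
by apply/seteqP; split=> x /=; rewrite in_itv/= andbT.
Qed.

(** The indicator function of the set where p is positive is a limit of smooth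
    functions phi, so that the integral of p over this set is at most 0. *)
Lemma le0_ae_smooth : (forall phi, unit_smooth phi -> \int[mu]_x (p x * phi x) <= 0) ->
  {ae mu, forall x, p x <= 0}.
Proof.
move=> hp; have /integrableP[/measurable_EFinP mp _] := ip.
pose A := [set x | 0 < p x].
have mA : measurable A.
  rewrite (_ : A = p @^-1` `]0, +oo[%classic); last first.
    by apply/seteqP; split=> x /=; rewrite in_itv/= andbT.
  by rewrite -[X in measurable X]setTI; apply: mp => //; exact: measurable_itv.
have [_ aA] := approximable_measurable mA.
have iA : mu.-integrable setT (fun x => (p x * \1_A x)%:E).
  apply: integrable_mul_le1 => // x; have /andP[a0 a1] := indic_le1 A x.
  by rewrite ger0_norm.
have I0 : \int[mu]_x (p x * \1_A x) <= 0.
  rewrite leNgt; apply/negP => /aA[phi up]; apply/negP; rewrite -leNgt.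
  have ip1 : mu.-integrable setT (fun x => (p x * phi x)%:E).
    apply: integrable_mul_le1 => //; first exact: smooth_measurable up.1.
    by move=> x; have /andP[h0 h1] := up.2 x; rewrite ger0_norm.
  apply: (@le_trans _ _ (\int[mu]_x (p x * phi x + `|p x| * `|\1_A x - phi x|))).
    apply: le_Rintegral => //.
      by rewrite /comp; under eq_fun do rewrite EFinD; apply: integrableD => //; exact: iapp.
    move=> x _; rewrite -lerBlDl -mulrBr -normrM; exact: ler_norm.
  by rewrite RintegralD//; [have := hp _ up; lra|exact: iapp].
have pA0 x : 0 <= p x * \1_A x.
  rewrite indicE; have [xA|_] := boolP (x \in A); last by rewrite mulr0.
  by rewrite mulr1 ltW//; move/set_mem: xA.
have /ae_eq_integral_abs h : (\int[mu]_x `|(p x * \1_A x)%:E| = 0)%E.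
  rewrite (eq_integral (fun x => (p x * \1_A x)%:E)); last first.
    by move=> x _; rewrite gee0_abs// lee_fin.
  rewrite -[LHS]fineK; last exact: integrable_fin_num.
  by congr EFin; apply/eqP; rewrite eq_le I0/= Rintegral_ge0.
have := h measurableT (measurable_int _ iA).
apply: filterS => x /(_ I) [] /eqP; rewrite leNgt mulf_eq0 indicE.
by have [xA|/negP xA _] := boolP (x \in A); [rewrite oner_eq0 orbF => /eqP ->; rewrite ltxx|
  apply/negP => px; apply: xA; exact: mem_set].
Qed.

End approximation.

Lemma ae_cubes (P : Rn -> Prop) :
  (forall N : nat, {ae mu, forall x : Rn, (forall i, `|x ord0 i| < N%:R) -> P x}) ->
  {ae mu, forall x, P x}.
Proof.
move=> h; have /ae_foralln := h; apply: filterS => x hx.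
have [N hN] : exists N : nat, `|x| < N%:R.
  by exists (Num.truncn `|x|).+1; rewrite truncnS_gt.
by apply: (hx N) => i; rewrite (le_lt_trans (coord_le_norm x i)).
Qed.

(** Multiplication by the bump function b of a large cube makes (w - C) b
    integrable and turns smooth functions into test functions. *)
Lemma L2_le_ae_test (C : R) w : L2 w ->
  (forall phi, test_fun phi -> (forall x, 0 <= phi x) ->
    \int[mu]_x (w x * phi x) <= C * \int[mu]_x phi x) ->
  {ae mu, forall x, w x <= C}.
Proof.
move=> Lw hw; apply: ae_cubes => N.
pose b : Rn -> R := cube_bump N%:R; have tb : test_fun b := test_cube_bump _.
have iwb : mu.-integrable setT (fun x => (w x * b x)%:E).
  by apply: L2_integrableM => //; exact: test_L2.
have ib : mu.-integrable setT (fun x => (C * b x)%:E).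
  by under eq_fun do rewrite EFinM; apply: integrableZl => //; exact: test_integrable.
have ip : mu.-integrable setT (EFin \o (fun x => w x * b x - C * b x)).
  by rewrite /comp; under eq_fun do rewrite EFinB; exact: integrableB.
apply: filterS (@le0_ae_smooth _ ip _) => [x hx xN|phi [sp p1]].
  have b0 : 0 < b x by exact: cube_bump_gt0.
  by rewrite -(ler_pM2r b0); lra.
have tbp : test_fun (fun x => b x * phi x) by exact: test_mul.
have := hw _ tbp (fun x => mulr_ge0 (cube_bump_ge0 _ x) (andP (p1 x)).1).
rewrite -subr_le0 -RintegralZl//; last exact: test_integrable.
rewrite -RintegralB//; last 2 first.
- by apply: L2_integrableM => //; exact: test_L2.
- by apply: (test_integrable (testZ C tbp)).
by apply: le_trans; rewrite le_eqVlt; apply/orP; left; apply/eqP; apply: eq_Rintegral => x _; ring.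
Qed.

(** Turns an estimate by duality into an almost everywhere bound; all pointwise
    bounds below are obtained in this way. *)
Lemma L2_bounded_test (C : R) w : L2 w ->
  (forall phi, test_fun phi -> `|\int[mu]_x (w x * phi x)| <= C * \int[mu]_x `|phi x|) ->
  {ae mu, forall x, `|w x| <= C}.
Proof.
move=> Lw hw.
have h1 : {ae mu, forall x, w x <= C}.
  apply: L2_le_ae_test => // phi tp p0; rewrite (le_trans (ler_norm _))// (le_trans (hw _ tp))//.
  by rewrite le_eqVlt; apply/orP; left; apply/eqP; congr (_ * _); apply: eq_Rintegral => x _; rewrite ger0_norm.
have h2 : {ae mu, forall x, -1 * w x <= C}.
  apply: L2_le_ae_test; first exact: L2Z.
  move=> phi tp p0.
  have -> : \int[mu]_x (-1 * w x * phi x) = - \int[mu]_x (w x * phi x).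
    rewrite -[RHS]mulN1r -RintegralZl//; last by apply: L2_integrableM => //; exact: test_L2.
    by apply: eq_Rintegral => x _; rewrite mulrA.
  rewrite (le_trans (ler_norm _))// normrN (le_trans (hw _ tp))//.
  by rewrite le_eqVlt; apply/orP; left; apply/eqP; congr (_ * _); apply: eq_Rintegral => x _; rewrite ger0_norm.
apply: filterS2 h1 h2 => x a b; rewrite ler_norml; apply/andP; split; lra.
Qed.

Lemma eq_ae_test (f g : Rn -> R) : L2 f -> L2 g ->
  (forall phi, test_fun phi -> \int[mu]_x (f x * phi x) = \int[mu]_x (g x * phi x)) ->
  {ae mu, forall x, f x = g x}.
Proof.
move=> Lf Lg fg; have LNg := L2Z (-1) Lg.
have h : {ae mu, forall x, `|f x + -1 * g x| <= 0}.
  apply: L2_bounded_test; first exact: L2D.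
  move=> phi tp; rewrite mul0r.
  have Lp := test_L2 tp.
  rewrite (_ : \int[mu]_x ((f x + -1 * g x) * phi x) =
    \int[mu]_x (f x * phi x - g x * phi x)); last first.
    by apply: eq_Rintegral => x _; ring.
  by rewrite RintegralB//; [rewrite fg// subrr normr0|exact: L2_integrableM..].
by apply: filterS h => x; rewrite normr_le0 mulN1r subr_eq0 => /eqP.
Qed.

End fundamental_lemma.
(** * Weak derivatives and the space of functions with all of them in L^2 *)

Section weak_derivatives.
Context {R : realType} {n : nat}.
Local Notation Rn := 'rV[R]_n.
Local Notation mu := (@leb R n).
Local Notation e_ i := (delta_mx ord0 i : Rn).
Implicit Types (f g h phi : Rn -> R) (alpha beta : 'I_n -> nat).

(** Weak derivatives of first order; those of higher order are obtained by
    iterating them. *)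
Definition weak_partial i f g := forall phi, test_fun phi ->
  \int[mu]_x (f x * 'D_(e_ i) phi x) = - \int[mu]_x (g x * phi x).

Lemma test_mpartial phi alpha : test_fun phi -> test_fun (mpartial alpha phi).
Proof. by move=> tp; exact: test_partials. Qed.

Lemma integrable_test f phi : L2 f -> test_fun phi ->
  mu.-integrable setT (fun x => (f x * phi x)%:E).
Proof. by move=> Lf tp; apply: L2_integrableM => //; exact: test_L2. Qed.

Lemma is_wderiv_dirac i f g : is_wderiv (dirac_mi i) f g <-> weak_partial i f g.
Proof.
split=> h phi tp; have := h phi tp; rewrite morder_dirac expr1 mulN1r;
  by rewrite mpartial_dirac//; exact: test_smooth.
Qed.

Lemma is_wderiv_unique alpha f g g' : L2 g -> L2 g' ->
  is_wderiv alpha f g -> is_wderiv alpha f g' -> {ae mu, forall x, g x = g' x}.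
Proof.
move=> Lg Lg' fg fg'; apply: eq_ae_test => // phi tp.
have s0 : (-1) ^+ morder alpha != 0 :> R by rewrite expf_neq0// oppr_eq0 oner_eq0.
by apply: (mulfI s0); rewrite -fg// -fg'.
Qed.

Lemma is_wderivD alpha f g f' g' : L2 f -> L2 g -> L2 f' -> L2 g' ->
  is_wderiv alpha f f' -> is_wderiv alpha g g' ->
  is_wderiv alpha (fun x => f x + g x) (fun x => f' x + g' x).
Proof.
move=> Lf Lg Lf' Lg' ff' gg' phi tp; have tm := test_mpartial alpha tp.
under eq_Rintegral do rewrite mulrDl.
rewrite RintegralD//; [|exact: integrable_test..].
under [in RHS]eq_Rintegral do rewrite mulrDl.
rewrite RintegralD//; [|exact: integrable_test..].
by rewrite ff'// gg'// mulrDr.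
Qed.

Lemma is_wderivZ alpha (a : R) f f' : L2 f -> L2 f' ->
  is_wderiv alpha f f' -> is_wderiv alpha (fun x => a * f x) (fun x => a * f' x).
Proof.
move=> Lf Lf' ff' phi tp; have tm := test_mpartial alpha tp.
under eq_Rintegral do rewrite -mulrA.
rewrite RintegralZl//; last exact: integrable_test.
under [in RHS]eq_Rintegral do rewrite -mulrA.
rewrite RintegralZl//; last exact: integrable_test.
by rewrite ff'// mulrCA.
Qed.

Lemma is_wderiv_ae alpha f g f' : measurable_fun setT f -> measurable_fun setT g ->
  {ae mu, forall x, f x = g x} -> is_wderiv alpha f f' -> is_wderiv alpha g f'.
Proof.
move=> mf mg fg ff' phi tp; rewrite -ff'//.
have mp := test_measurable (test_mpartial alpha tp).
apply: eq_Rintegral_ae; [exact: measurable_funM..|].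
by apply: filterS fg => x ->.
Qed.

Lemma Hinf_L2 f : Hinf f -> L2 f.
Proof. by move=> /(_ 0%N I)[]. Qed.

Lemma Hinf_measurable f : Hinf f -> measurable_fun setT f.
Proof. by move=> /Hinf_L2; exact: L2_measurable. Qed.

Lemma HinfP f : Hinf f <->
  L2 f /\ forall alpha, exists g, L2 g /\ is_wderiv alpha f g.
Proof.
split=> [Hf|[Lf hf] k _]; last by split=> // alpha _; exact: hf.
split=> [|alpha]; first exact: Hinf_L2.
by have [_ /(_ alpha (leqnn _))] := Hf (morder alpha) I.
Qed.

Lemma wderivP alpha f : Hinf f -> L2 (wderiv alpha f) /\ is_wderiv alpha f (wderiv alpha f).
Proof.
move=> /HinfP[_ /(_ alpha)[g hg]].
exact: (@xgetPex _ (fun=> 0) [set g | L2 g /\ is_wderiv alpha f g]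
  (ex_intro _ g hg)).
Qed.

Lemma wderiv_unique alpha f g : Hinf f -> L2 g -> is_wderiv alpha f g ->
  {ae mu, forall x, wderiv alpha f x = g x}.
Proof.
by move=> /(wderivP alpha)[Lw ww] Lg fg; exact: (is_wderiv_unique Lw Lg ww fg).
Qed.

Lemma weak_partialP i f : Hinf f -> weak_partial i f (wpartial i f).
Proof. by move=> /(wderivP (dirac_mi i))[_ /is_wderiv_dirac]. Qed.

Lemma wpartial_unique i f g : Hinf f -> L2 g -> weak_partial i f g ->
  {ae mu, forall x, wpartial i f x = g x}.
Proof. by move=> Hf Lg /is_wderiv_dirac; exact: wderiv_unique. Qed.

(** S is stable under weak derivatives, so that the integrations by parts can be
    iterated along s. *)
Lemma weak_partials (S : set (Rn -> R)) (s : seq 'I_n) f : S f ->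
  (forall f i, S f -> exists2 g, S g & weak_partial i f g) ->
  exists2 g, S g & forall phi, test_fun phi ->
    \int[mu]_x (f x * partials s phi x) = (-1) ^+ size s * \int[mu]_x (g x * phi x).
Proof.
move=> + hS; elim: s f => [|i s IH] f Sf.
  by exists f => // phi _; rewrite mul1r.
have [g Sg fg] := hS f i Sf; have [h Sh gh] := IH g Sg; exists h => // phi tp.
by rewrite /= fg ?gh ?exprS ?mulN1r ?mulNr//; exact: test_partials.
Qed.

(** It suffices to exhibit a class of L^2 functions stable under first order
    weak derivatives. *)
Lemma Hinf_coind (S : set (Rn -> R)) : S `<=` L2 ->
  (forall f i, S f -> exists2 g, S g & weak_partial i f g) -> S `<=` Hinf.
Proof.
move=> SL hS f Sf; apply/HinfP; split; first exact: SL.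
move=> alpha.
have [g Sg fg] := weak_partials (flatten [seq nseq (alpha i) i | i <- enum 'I_n]) Sf hS.
exists g; split; first exact: SL.
move=> phi tp; rewrite fg//; congr ((-1) ^+ _ * _).
rewrite -(@count_predT _) count_mpartial /morder.
by apply: eq_bigr => i _; rewrite mul1n.
Qed.

(** The derivative of f for the multi-index e_i + alpha is a derivative for alpha
    of the i-th partial of f: the order of the derivatives of a test function
    does not matter. *)
Lemma Hinf_wderiv_wpartial alpha i f : Hinf f ->
  is_wderiv alpha (wpartial i f) (wderiv (fun j => dirac_mi i j + alpha j)%N f).
Proof.
move=> Hf phi tp; have sp := test_smooth tp.
have [_ W] := wderivP (fun j => dirac_mi i j + alpha j)%N Hf.
have tm := test_mpartial alpha tp.
have E := weak_partialP i Hf tm.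
rewrite -[LHS]opprK -E.
rewrite (_ : \int[mu]_x _ = \int[mu]_x
    (f x * mpartial (fun j => dirac_mi i j + alpha j)%N phi x)); last first.
  by rewrite mpartialD// mpartial_dirac//; exact: test_smooth.
rewrite W// /morder big_split/= -/(morder (dirac_mi i)) morder_dirac.
by rewrite exprS mulN1r mulNr opprK.
Qed.

Lemma Hinf_wpartial i f : Hinf f -> Hinf (wpartial i f).
Proof.
move=> Hf; apply/HinfP; split=> [|alpha]; first by have [] := wderivP (dirac_mi i) Hf.
exists (wderiv (fun j => dirac_mi i j + alpha j)%N f); split.
  by have [] := wderivP (fun j => dirac_mi i j + alpha j)%N Hf.
exact: Hinf_wderiv_wpartial.
Qed.

(** Two integrations by parts against a test function, whose derivatives
    commute. *)
Lemma wpartial_comm i j f : Hinf f ->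
  {ae mu, forall x, wpartial i (wpartial j f) x = wpartial j (wpartial i f) x}.
Proof.
move=> Hf; apply: wpartial_unique; [exact: Hinf_wpartial| |].
  by apply: Hinf_L2; do 2 apply: Hinf_wpartial.
move=> phi tp.
have S x : 'D_(e_ i) ('D_(e_ j) phi) x = 'D_(e_ j) ('D_(e_ i) phi) x.
  exact: (congr1 (fun u : Rn -> R => u x) (Schwarz i j (test_smooth tp))).
have E1 := weak_partialP j Hf (test_partial i tp).
have E2 := weak_partialP i Hf (test_partial j tp).
have E3 := weak_partialP j (Hinf_wpartial i Hf) tp.
apply: etrans E3; apply: oppr_inj; apply: etrans (esym E1) (etrans _ E2).
apply: eq_Rintegral => x _; apply: (congr1 (fun z => f x * z)); exact: esym (S x).
Qed.

Lemma HinfD f g : Hinf f -> Hinf g -> Hinf (fun x => f x + g x).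
Proof.
move=> Hf Hg; apply/HinfP; split; first by apply: L2D; exact: Hinf_L2.
move=> alpha; have [L1 w1] := wderivP alpha Hf; have [L2 w2] := wderivP alpha Hg.
exists (fun x => wderiv alpha f x + wderiv alpha g x); split; first exact: L2D.
by apply: is_wderivD => //; exact: Hinf_L2.
Qed.

Lemma HinfZ (a : R) f : Hinf f -> Hinf (fun x => a * f x).
Proof.
move=> Hf; apply/HinfP; split; first by apply: L2Z; exact: Hinf_L2.
move=> alpha; have [L1 w1] := wderivP alpha Hf.
exists (fun x => a * wderiv alpha f x); split; first exact: L2Z.
by apply: is_wderivZ => //; exact: Hinf_L2.
Qed.

Lemma HinfB f g : Hinf f -> Hinf g -> Hinf (fun x => f x - g x).
Proof.
move=> Hf Hg; under [X in Hinf X]eq_fun do rewrite -mulN1r.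
by apply: HinfD => //; exact: HinfZ.
Qed.

Lemma Hinf0 : Hinf ((fun=> 0) : Rn -> R).
Proof.
apply: (@Hinf_coind [set (fun=> 0) : Rn -> R]) => // [_ ->|_ i ->].
  apply/L2P; split; first exact: measurable_cst.
  by rewrite expr0n integral0.
exists (fun=> 0) => // phi tp.
by rewrite -[X in X = - _]opprK; congr (- _); under eq_Rintegral do rewrite mul0r;
  under [in RHS]eq_Rintegral do rewrite mul0r; rewrite Rintegral_cst// mul0r oppr0.
Qed.

Lemma Hinf_sum (I : Type) (r : seq I) (F : I -> Rn -> R) :
  (forall i, Hinf (F i)) -> Hinf (fun x => \sum_(i <- r) F i x).
Proof.
move=> hF; elim: r => [|i r IH].
  by under eq_fun do rewrite big_nil; exact: Hinf0.
by under eq_fun do rewrite big_cons; exact: HinfD.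
Qed.

Lemma Hinf_ae f g : Hinf f -> measurable_fun setT g ->
  {ae mu, forall x, f x = g x} -> Hinf g.
Proof.
move=> Hf mg fg; have Lf := Hinf_L2 Hf; apply/HinfP; split.
  by apply: (L2_ae Lf mg); apply: filterS fg => x ->.
move=> alpha; have [Lw w] := wderivP alpha Hf.
exists (wderiv alpha f); split=> //.
exact: (is_wderiv_ae (L2_measurable Lf) mg fg w).
Qed.

Lemma wderivD alpha f g : Hinf f -> Hinf g -> {ae mu, forall x,
  wderiv alpha (fun x => f x + g x) x = wderiv alpha f x + wderiv alpha g x}.
Proof.
move=> Hf Hg; have [L1 w1] := wderivP alpha Hf; have [L2 w2] := wderivP alpha Hg.
apply: (wderiv_unique (HinfD Hf Hg) (L2D L1 L2)).
by apply: is_wderivD => //; exact: Hinf_L2.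
Qed.

Lemma wderivZ alpha (a : R) f : Hinf f -> {ae mu, forall x,
  wderiv alpha (fun x => a * f x) x = a * wderiv alpha f x}.
Proof.
move=> Hf; have [L1 w1] := wderivP alpha Hf.
apply: (wderiv_unique (HinfZ a Hf) (L2Z a L1)).
by apply: is_wderivZ => //; exact: Hinf_L2.
Qed.

Lemma wderiv_ae alpha f g : Hinf f -> measurable_fun setT g ->
  {ae mu, forall x, f x = g x} ->
  {ae mu, forall x, wderiv alpha f x = wderiv alpha g x}.
Proof.
move=> Hf mg fg; have [L1 w1] := wderivP alpha Hf.
have h := wderiv_unique (Hinf_ae Hf mg fg) L1
  (is_wderiv_ae (Hinf_measurable Hf) mg fg w1).
by apply: filterS h => x ->.
Qed.

End weak_derivatives.
(** * Sobolev embedding *)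

Section sobolev1.
Context {R : realType}.
Local Notation mu1 := (@lebesgue_measure R).

Lemma continuous_derive (u du : R -> R) :
  (forall t, is_derive (t : R) (1 : R) u (du t)) -> continuous u.
Proof.
move=> h t; apply: differentiable_continuous; apply/derivable1_diffP.
exact: (@ex_derive _ _ _ _ _ _ _ (h t)).
Qed.

(** The value u(a)^2 is the integral over [a, a+1] of the derivative of
    -(1 + a - s) u(s)^2, which is at most 2 (u^2 + u'^2). *)
Lemma sqr_le_integral (u v w : R -> R) (a : R) :
  (forall t, is_derive (t : R) (1 : R) u (v t)) ->
  (forall t, is_derive (t : R) (1 : R) v (w t)) ->
  ((u a ^+ 2)%:E <= \int[mu1]_s (2 * (u s ^+ 2 + v s ^+ 2))%:E)%E.
Proof.
move=> du dv; have cu := continuous_derive du; have cv := continuous_derive dv.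
pose G s := (s - (1 + a)) * (u s * u s).
pose g s := u s * u s + (s - (1 + a)) * (u s * v s + u s * v s).
have dG (s : R) : is_derive s (1 : R) G (g s).
  have d1 : is_derive s (1 : R) (fun s : R => s - (1 + a)) 1.
    by apply: is_derive_eq; rewrite subr0.
  have d2 := is_deriveM (du s) (du s).
  have d3 := is_deriveM d1 d2.
  by apply: (is_derive_eq d3); rewrite /g /GRing.scale/= ?fctE; ring.
have cg : continuous g.
  by move=> s; apply: cvgD; [apply: cvgM; exact: cu|apply: cvgM;
    [apply: cvgB; [exact: cvg_id|exact: cvg_cst]|apply: cvgD; apply: cvgM; (exact: cu || exact: cv)]].
have cG := continuous_derive dG.
have a1 : a < a + 1 by rewrite ltrDl.
have FTC : (\int[mu1]_(s in `[a, (a + 1)%R]) (g s)%:E = (u a ^+ 2)%:E)%E.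
  rewrite (@continuous_FTC2 _ g G)//.
  - by rewrite -EFinB /G; congr EFin; ring.
  - exact: continuous_subspaceT.
  - split.
    + by move=> s _; exact: (@ex_derive _ _ _ _ _ _ _ (dG s)).
    + by apply: cvg_at_right_filter; exact: cG.
    + by apply: cvg_at_left_filter; exact: cG.
  - by move=> s _; rewrite derive1E; exact: (@derive_val _ _ _ _ _ _ _ (dG s)).
have ch : continuous (fun s => 2 * (u s ^+ 2 + v s ^+ 2)).
  move=> s; apply: cvgM; first exact: cvg_cst.
  by apply: cvgD; (under eq_fun do rewrite expr2;
    apply: cvgM; (exact: cu || exact: cv)).
rewrite -FTC; apply: (@le_trans _ _
    (\int[mu1]_(s in `[a, (a + 1)%R]) (2 * (u s ^+ 2 + v s ^+ 2))%:E)%E).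
  apply: le_integral => //.
  - by apply: continuous_compact_integrable; [exact: segment_compact|exact: continuous_subspaceT].
  - by apply: continuous_compact_integrable; [exact: segment_compact|exact: continuous_subspaceT].
  move=> s; rewrite inE/= in_itv/= => /andP[s1 s2]; rewrite lee_fin /g.
  have := sqr_ge0 (u s); have := sqr_ge0 (v s).
  have := sqr_ge0 (u s + v s); have := sqr_ge0 (u s - v s).
  clear -s1 s2; move: (u s) (v s) => p q h1 h2 h3 h4.
  have : `|(s - (1 + a)) * (p * q + p * q)| <= p ^+ 2 + q ^+ 2.
    rewrite normrM (le_trans (y := 1 * `|p * q + p * q|))//.
      by rewrite ler_wpM2r// ler_norml; apply/andP; split; lra.
    by rewrite mul1r ler_norml; apply/andP; split; lra.
  by move=> /(le_trans (ler_norm _)); lra.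
apply: ge0_subset_integral => //.
- by apply/measurable_EFinP; exact: continuous_measurable_fun.
- by move=> s _; rewrite lee_fin mulr_ge0// addr_ge0// sqr_ge0.
Qed.

End sobolev1.

Section sobolev_pointwise.
Context {R : realType}.

Lemma rV_cons_deltaS n (a t : R) (y : 'rV[R]_n) i :
  rV_cons (a, y) + t *: delta_mx ord0 (lift ord0 i) = rV_cons (a, y + t *: delta_mx ord0 i).
Proof.
rewrite (_ : t *: delta_mx _ _ = rV_cons (0, t *: delta_mx ord0 i)).
  by rewrite rV_consD addr0.
apply/rowP => k; case: (unliftP ord0 k) => [j|] ->.
  by rewrite rV_consS !mxE eqxx/= (inj_eq lift_inj).
by rewrite rV_cons0 !mxE (negPf (neq_lift _ _)) mulr0.
Qed.

Lemma rV_cons_delta0 n (a t : R) (y : 'rV[R]_n) :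
  rV_cons (a, y) + t *: delta_mx ord0 ord0 = rV_cons (a + t, y).
Proof.
rewrite (_ : t *: delta_mx _ _ = rV_cons (t, 0)); first by rewrite rV_consD addr0.
apply/rowP => k; case: (unliftP ord0 k) => [j|] ->.
  by rewrite rV_consS !mxE [lift _ _ == _]eq_sym (negPf (neq_lift _ _)) andbF mulr0.
by rewrite rV_cons0 !mxE !eqxx mulr1.
Qed.

(** The one-dimensional estimate, iterated over the coordinates, bounds the
    square of a function at a point by L^2 norms of derivatives of order at most
    one in each coordinate.  Here d s stands for the derivative of d [::] along
    the word s. *)
Lemma sobolev_pointwise n : exists ls : seq (seq 'I_n), exists2 C : R, 0 <= C &
  forall d : seq 'I_n -> 'rV[R]_n -> R,
  (forall s, measurable_fun setT (d s)) ->
  (forall s i x, is_derive x (delta_mx ord0 i) (d s) (d (i :: s) x)) ->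
  forall x, ((d [::] x ^+ 2)%:E <=
    \sum_(l <- ls) C%:E * \int[@leb R n]_y (d l y ^+ 2)%:E)%E.
Proof.
elim: n => [|n [ls [C C0 IH]]].
  exists [:: [::]], 1 => // d md _ x; rewrite big_seq1 mul1e.
  rewrite ge0_integral_leb0//.
  - by rewrite (_ : x = 0)//; apply/rowP => -[].
  - by move=> y; rewrite lee_fin sqr_ge0.
  - by apply/measurable_EFinP; exact: measurable_funX.
pose up (s : seq 'I_n) : seq 'I_n.+1 := map (lift ord0) s.
(* each old word is used without and with a derivative in the new coordinate *)
exists (flatten [seq [:: up l; ord0 :: up l] | l <- ls]), (C * 2).
  by rewrite mulr_ge0.
move=> d md dd x; rewrite -[x]rV_unconsK; case: (rV_uncons x) => a y0.
pose d' (s : seq 'I_n) (y : 'rV[R]_n) := d (up s) (rV_cons (a, y)).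
have md' s : measurable_fun setT (d' s).
  exact: (measurable_fun_pair2 a (measurableT_comp (md (up s)) (@measurable_rV_cons R n))).
have dd' s i y : is_derive y (delta_mx ord0 i) (d' s) (d' (i :: s) y).
  apply/is_derive_lineP; have /is_derive_lineP := dd (up s) (lift ord0 i) (rV_cons (a, y)).
  rewrite (_ : (fun t : R => d (up s) _) =
    (fun t : R => d' s (y + t *: delta_mx ord0 i)))//.
  by apply/funext => t; rewrite /d' rV_cons_deltaS.
apply: le_trans (IH d' md' dd' y0) _.
rewrite big_flatten big_map; apply: lee_sum => l _.
rewrite big_cons big_seq1.
have msq s : measurable_fun setT (fun z : 'rV[R]_n.+1 => (d s z ^+ 2)%:E : \bar R).
  by apply/measurable_EFinP; exact: measurable_funX.
have sq0 s (z : 'rV[R]_n.+1) : (0 <= (d s z ^+ 2)%:E :> \bar R)%E by rewrite lee_fin sqr_ge0.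
rewrite -[leRHS]/(_ + _)%E -ge0_muleDr ?integral_ge0// EFinM -muleA; apply: lee_wpmul2l => //.
rewrite -ge0_integralD// -ge0_integralZl//; last 2 first.
- exact: emeasurable_funD.
- by move=> z _; rewrite adde_ge0.
rewrite tonelli_lebS; last 2 first.
- by move=> z; rewrite mule_ge0// adde_ge0.
- by apply: measurable_funeM; exact: emeasurable_funD.
apply: ge0_le_integral => //.
- by move=> y _; rewrite lee_fin sqr_ge0.
- by apply/measurable_EFinP; exact: measurable_funX.
- have mh : measurable_fun setT (fun z : 'rV[R]_n.+1 =>
    2%:E * ((d (up l) z ^+ 2)%:E + (d (ord0 :: up l) z ^+ 2)%:E))%E.
    by apply: measurable_funeM; exact: emeasurable_funD.
  apply: (@measurable_fun_fubini_tonelli_G _ _ _ _ _ (@lebesgue_measure R) _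
    (measurable_cons_comp mh)) => p.
  by rewrite /= mule_ge0// adde_ge0.
move=> y _; rewrite /d'.
have dl (s : seq 'I_n.+1) (t : R) : is_derive t (1 : R) (fun t : R => d s (rV_cons (t, y)))
    (d (ord0 :: s) (rV_cons (t, y))).
  apply/is_derive_lineP; have /is_derive_lineP := dd s ord0 (rV_cons (t, y)).
  rewrite (_ : (fun r : R => d s _) = (fun r : R => d s (rV_cons (t + r *: 1, y))))//.
  by apply/funext => r; rewrite rV_cons_delta0 [r *: 1]mulr1.
apply: le_trans (sqr_le_integral a (dl (up l)) (dl (ord0 :: up l))) _.
by under eq_integral do rewrite EFinM EFinD.
Qed.

End sobolev_pointwise.
Section bounded.
Context {R : realType} {n : nat}.
Local Notation Rn := 'rV[R]_n.
Local Notation mu := (@leb R n).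
Local Notation e_ i := (delta_mx ord0 i : Rn).
Implicit Types (f g h phi : Rn -> R).

(** The convolution of f with the reflection of phi; this form involves the
    translations of f only. *)
Definition correlation f phi (a : Rn) : R := \int[mu]_x (f (x + a) * phi x).

Lemma measurable_rV_addp : measurable_fun setT (fun p : Rn * Rn => p.1 + p.2).
Proof.
apply: measurable_rVP => i.
rewrite (_ : _ \o _ = fun p : Rn * Rn => rV_coord i p.1 + rV_coord i p.2); last first.
  by apply/funext => x; rewrite /rV_coord /= mxE.
have mc := @measurable_rV_coord R n i.
by apply: measurable_funD;
  [exact: (measurableT_comp mc measurable_fst)|exact: (measurableT_comp mc measurable_snd)].
Qed.

Lemma measurable_correlation f phi : measurable_fun setT f -> measurable_fun setT phi ->
  measurable_fun setT (correlation f phi).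
Proof.
move=> mf mphi.
pose k (p : Rn * Rn) : \bar R := (f (p.1 + p.2) * phi p.1)%:E.
have mk : measurable_fun setT k.
  apply/measurable_EFinP; apply: measurable_funM.
    exact: (measurableT_comp mf measurable_rV_addp).
  exact: (measurableT_comp mphi measurable_fst).
rewrite (_ : correlation f phi = fine \o (fun a => \int[mu]_x k^\+ (x, a) -
    \int[mu]_x k^\- (x, a))%E).
  apply: measurableT_comp; first exact: fine_measurable.
  apply: emeasurable_funB.
  - exact: (@measurable_fun_fubini_tonelli_G _ _ _ _ _ mu _
      (measurable_funepos mk) (funepos_ge0 k)).
  - exact: (@measurable_fun_fubini_tonelli_G _ _ _ _ _ mu _
      (measurable_funeneg mk) (funeneg_ge0 k)).
apply/funext => a; rewrite /correlation /Rintegral /=; congr fine.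
rewrite integralE; congr (_ - _)%E; apply: eq_integral => x _.
  by rewrite !funeposE.
by rewrite !funenegE.
Qed.

Lemma correlationE f phi a : L2 f -> test_fun phi ->
  correlation f phi a = \int[mu]_x (f x * phi (x - a)).
Proof.
move=> Lf tp; rewrite -(@Rintegral_translation R n a (fun x => f x * phi (x - a))).
  by apply: eq_Rintegral => x _; rewrite addrK.
apply: measurable_funM; first exact: L2_measurable.
by apply: (measurable_translation (- a)); exact: test_measurable.
Qed.

(** The derivative is first taken on phi, under the integral sign, and then
    moved to f by the definition of weak derivatives. *)
Lemma is_derive_correlation_weak f f' phi i (t : R) : L2 f -> L2 f' ->
  weak_partial i f f' -> test_fun phi ->
  is_derive t (1 : R) (fun t : R => correlation f phi (t *: e_ i))
    (correlation f' phi (t *: e_ i)).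
Proof.
move=> Lf Lf' ff' tp.
rewrite (_ : (fun t : R => _) =
  (fun s : R => \int[mu]_x (f x * phi (x + s *: e_ i))) \o -%R); last first.
  by apply/funext => s /=; rewrite correlationE// scaleNr.
have d1 := is_derive_correlation i (- t) Lf tp.
have d2 := @is_derive1_comp R _ -%R _ _ _ d1 (is_deriveNid t 1).
apply: (is_derive_eq d2); rewrite correlationE// mulrN1.
have tt := test_translation (- (t *: e_ i)) tp.
apply: oppr_inj; rewrite opprK; apply: etrans (ff' _ tt); apply: eq_Rintegral => x _.
rewrite scaleNr; apply: (congr1 (fun z => f x * z)).
by rewrite derive_translation//; exact: test_smooth.
Qed.

Lemma correlationDa f phi a b : L2 f -> test_fun phi ->
  correlation f phi (a + b) = correlation f (fun x => phi (x - a)) b.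
Proof.
move=> Lf tp; rewrite !correlationE//; last exact: test_translation.
by apply: eq_Rintegral => x _; rewrite opprD addrAC addrA.
Qed.

(** The Cauchy-Schwarz inequality for f and sgn k in the measure of density
    |k|. *)
Lemma sqr_Rintegral_le f k :
  mu.-integrable setT (fun x => (`|k x|)%:E) ->
  mu.-integrable setT (fun x => (f x * k x)%:E) ->
  mu.-integrable setT (fun x => (f x ^+ 2 * `|k x|)%:E) ->
  (\int[mu]_x (f x * k x)) ^+ 2 <=
  (\int[mu]_x `|k x|) * \int[mu]_x (f x ^+ 2 * `|k x|).
Proof.
move=> ik ifk if2k.
set P := \int[mu]_x `|k x|; set Q := \int[mu]_x (f x ^+ 2 * `|k x|).
set B := \int[mu]_x (f x * k x).
(* the integral of (f - l sgn k)^2 |k| *)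
have H (l : R) : 0 <= Q - 2 * l * B + l ^+ 2 * P.
  have i2 : mu.-integrable setT (fun x => (2 * l * (f x * k x))%:E).
    by under eq_fun do rewrite EFinM; exact: integrableZl.
  have i3 : mu.-integrable setT (fun x => (l ^+ 2 * `|k x|)%:E).
    by under eq_fun do rewrite EFinM; exact: integrableZl.
  have i1 : mu.-integrable setT (fun x => (f x ^+ 2 * `|k x| - 2 * l * (f x * k x))%:E).
    by under eq_fun do rewrite EFinB; exact: integrableB.
  rewrite /Q /B /P -!RintegralZl// -RintegralB// -RintegralD//.
  apply: Rintegral_ge0 => x _.
  rewrite (_ : k x = Num.sg (k x) * `|k x|); last by rewrite mulr_sg_norm.
  rewrite normrM normr_id; have [->|k0] := eqVneq (k x) 0.
    by rewrite sgr0 normr0 !(mulr0, mul0r); lra.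
  rewrite normr_sg k0 mul1r.
  have s2 : Num.sg (k x) ^+ 2 = 1 by rewrite sqr_sg k0.
  rewrite (_ : _ + _ = (f x - l * Num.sg (k x)) ^+ 2 * `|k x|).
    by rewrite mulr_ge0// sqr_ge0.
  by rewrite sqrrB exprMn s2; ring.
have P0 : 0 <= P by exact: Rintegral_ge0.
have [P1|P1] := eqVneq P 0.
  suff -> : B = 0 by rewrite P1 expr0n mul0r.
  apply/eqP; apply: contraT => B0.
  (* for P = 0 the polynomial is affine; at this l its value is -1 *)
  have := H ((Q + 1) / (2 * B)); rewrite P1 mulr0 addr0.
  rewrite (_ : 2 * ((Q + 1) / (2 * B)) * B = Q + 1); first lra.
  by field.
have {}P0 : 0 < P by rewrite lt0r P1.
have := H (B / P).
rewrite (_ : _ + _ = Q - B ^+ 2 / P); last by field.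
by rewrite subr_ge0 ler_pdivrMr// mulrC.
Qed.

(** Young's inequality: Cauchy-Schwarz for the measure of density |phi|, then
    Tonelli and the invariance of the measure under translations. *)
Lemma correlation_L2_le g phi : L2 g -> test_fun phi ->
  (\int[mu]_a (correlation g phi a ^+ 2)%:E <=
   (\int[mu]_x `|phi x|)%:E ^+ 2 * \int[mu]_x (g x ^+ 2)%:E)%E.
Proof.
move=> Lg tp; have mphi := test_measurable tp; have mg := L2_measurable Lg.
have iphi := integrable_norm (test_integrable tp).
have [C C0 hC] := test_bounded tp.
have ig2 a : mu.-integrable setT (fun x => (g (x + a) ^+ 2 * `|phi x|)%:E).
  have h := L2_integrable_sqr (L2_translation a Lg).
  have hC2 : mu.-integrable setT (fun x => (C * g (x + a) ^+ 2)%:E).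
    by under eq_fun do rewrite EFinM; exact: integrableZl.
  apply: (le_integrable measurableT _ _ hC2).
    apply/measurable_EFinP; apply: measurable_funM; last exact: measurableT_comp.
    by apply: measurable_funX; exact: measurable_translation.
  move=> x _; rewrite lee_fin !normrM normr_id [leRHS]mulrC ler_wpM2l//.
  by rewrite (le_trans (hC x))// ler_norm.
set P := \int[mu]_x `|phi x|; have P0 : 0 <= P by exact: Rintegral_ge0.
pose k (p : Rn * Rn) : \bar R := (P%:E * (g (p.1 + p.2) ^+ 2 * `|phi p.1|)%:E)%E.
have mk : measurable_fun setT k.
  apply: measurable_funeM; apply/measurable_EFinP; apply: measurable_funM.
    apply: measurable_funX; exact: (measurableT_comp mg measurable_rV_addp).
  by apply: measurableT_comp => //; exact: (measurableT_comp mphi measurable_fst).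
have k0 p : (0 <= k p)%E by apply: mule_ge0; rewrite lee_fin// mulr_ge0// sqr_ge0.
apply: (@le_trans _ _ (\int[mu]_a \int[mu]_x k (x, a))%E).
  apply: ge0_le_integral => //.
  - by move=> a _; rewrite lee_fin sqr_ge0.
  - apply/measurable_EFinP; apply: measurable_funX; exact: measurable_correlation.
  - exact: (@measurable_fun_fubini_tonelli_G _ _ _ _ _ mu _ mk k0).
  move=> a _; rewrite /k/= ge0_integralZl//; last 2 first.
  - by have /integrableP[] := ig2 a.
  - by move=> x _; rewrite lee_fin mulr_ge0// sqr_ge0.
  rewrite -[X in (P%:E * X)%E]fineK; last exact: integrable_fin_num (ig2 a).
  rewrite -EFinM lee_fin; apply: sqr_Rintegral_le => //.
  by apply: integrable_test => //; exact: L2_translation.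
rewrite -(fubini_tonelli k mk k0).
rewrite (_ : (fun x => _) = (fun x => (P%:E * \int[mu]_y (g y ^+ 2)%:E) * (`|phi x|)%:E)%E).
  rewrite ge0_integralZl; first last.
  - by apply: mule_ge0; [rewrite lee_fin|apply: integral_ge0 => x _; rewrite lee_fin sqr_ge0].
  - by move=> x _; rewrite lee_fin.
  - by apply/measurable_EFinP; exact: measurableT_comp.
  - by [].
  rewrite -[X in (_ * X)%E]fineK; last exact: integrable_fin_num iphi.
  by rewrite -/P expe2 muleAC.
have mg2 : measurable_fun setT (fun y : Rn => (g y ^+ 2)%:E : \bar R).
  by apply/measurable_EFinP; exact: measurable_funX.
apply/funext => x; rewrite /k /=.
under eq_integral do rewrite EFinM [in X in (_ * X)%E]addrC.
rewrite -muleA ge0_integralZl; first last.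
- by rewrite lee_fin.
- by move=> y _; apply: mule_ge0; rewrite lee_fin// sqr_ge0.
- apply: emeasurable_funM; last exact: measurable_cst.
  exact: (measurable_translation x mg2).
- by [].
congr (_ * _)%E; rewrite ge0_integralZr; first last.
- by rewrite lee_fin.
- by move=> y _; rewrite lee_fin sqr_ge0.
- exact: (measurable_translation x mg2).
- by [].
by congr (_ * _)%E; rewrite -(integral_translation x mg2).
Qed.

Definition wpartials (s : seq 'I_n) f : Rn -> R := foldr (@wpartial R n) f s.

Lemma Hinf_wpartials s f : Hinf f -> Hinf (wpartials s f).
Proof. by move=> Hf; elim: s => //= i s; exact: Hinf_wpartial. Qed.

(** The pointwise estimate is applied at 0 to the correlations of f with a test
    function phi.  By Young's inequality it bounds the integral of f phi by a
    multiple of the L^1 norm of phi, which is an L^infinity bound of f. *)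
Lemma Hinf_bounded f : Hinf f -> exists2 M : R, 0 <= M & {ae mu, forall x, `|f x| <= M}.
Proof.
move=> Hf; have [ls [C C0 S]] := @sobolev_pointwise R n.
pose K := \sum_(l <- ls) C * \int[mu]_x (wpartials l f x ^+ 2).
have K0 : 0 <= K.
  apply: sumr_ge0 => l _; rewrite mulr_ge0//; apply: Rintegral_ge0 => x _; exact: sqr_ge0.
exists (Num.sqrt K); first exact: sqrtr_ge0.
apply: L2_bounded_test; first exact: Hinf_L2.
move=> phi tp; set P := \int[mu]_x `|phi x|.
have P0 : 0 <= P by exact: Rintegral_ge0.
pose d s := correlation (wpartials s f) phi.
have Hs s := Hinf_wpartials s Hf.
have md s : measurable_fun setT (d s).
  by apply: measurable_correlation; [exact: Hinf_measurable|exact: test_measurable].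
have dd s i x : is_derive x (e_ i) (d s) (d (i :: s) x).
  apply/is_derive_lineP.
  have tt := test_translation (- x) tp.
  have := is_derive_correlation_weak 0 (Hinf_L2 (Hs s)) (Hinf_L2 (Hs (i :: s)))
    (weak_partialP i (Hs s)) tt.
  rewrite -correlationDa//; last exact: Hinf_L2.
  rewrite scale0r addr0.
  rewrite (_ : (fun t : R => correlation _ _ _) = (fun t : R => d s (x + t *: e_ i)))//.
  by apply/funext => t; rewrite /d correlationDa//; exact: Hinf_L2.
have := S d md dd 0.
rewrite /d {1}/correlation/=; under eq_Rintegral do rewrite addr0.
move=> H; have : ((\int[mu]_x (f x * phi x)) ^+ 2 <= P ^+ 2 * K).
  rewrite -lee_fin; apply: le_trans H _.
  rewrite /K mulr_sumr -sumEFin; apply: lee_sum => l _.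
  have iw := L2_integrable_sqr (Hinf_L2 (Hs l)).
  rewrite mulrCA EFinM; apply: lee_wpmul2l; first by rewrite lee_fin.
  apply: le_trans (correlation_L2_le (Hinf_L2 (Hs l)) tp) _.
  rewrite -[X in (_ * X)%E]fineK; last exact: integrable_fin_num iw.
  by rewrite -EFin_expe -EFinM.
move=> H2; rewrite -sqrtr_sqr -[P]ger0_norm// -sqrtr_sqr -sqrtrM//.
by rewrite mulrC in H2; exact: ler_wsqrtr.
Qed.

End bounded.
(** * The algebra of functions with square integrable derivatives *)

Section leibniz.
Context {R : realType} {n : nat}.
Local Notation Rn := 'rV[R]_n.
Local Notation mu := (@leb R n).
Local Notation e_ i := (delta_mx ord0 i : Rn).
Implicit Types (f g h phi : Rn -> R).

Lemma taylor_le (u du ddu : R -> R) (C : R) :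
  (forall t, is_derive (t : R) (1 : R) u (du t)) ->
  (forall t, is_derive (t : R) (1 : R) du (ddu t)) ->
  (forall t, `|ddu t| <= C) ->
  forall t, `|u t - u 0 - t * du 0| <= C * t ^+ 2.
Proof.
move=> hu hdu hC.
have C0 : 0 <= C by rewrite (le_trans _ (hC 0)).
have key (v dv ddv : R -> R) (t : R) :
  (forall t, is_derive (t : R) (1 : R) v (dv t)) ->
  (forall t, is_derive (t : R) (1 : R) dv (ddv t)) ->
  (forall t, `|ddv t| <= C) -> 0 < t -> `|v t - v 0 - t * dv 0| <= C * t ^+ 2.
  move=> hv hdv hCv t0.
  have [c /andP[c0 ct] vE] := MVT_increment t0 hv.
  have [b _ dvE] := MVT_increment c0 hdv.
  rewrite vE -mulrBr dvE !normrM (gtr0_norm t0) (gtr0_norm c0).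
  rewrite [C * _]mulrC expr2 -mulrA ler_wpM2l ?(ltW t0)//.
  by apply: ler_pM => //; [exact: ltW|exact: ltW].
move=> t; have [t0|t0|<-] := ltgtP 0 t; first exact: (key u du ddu).
- have N0 : 0 < - t by rewrite oppr_gt0.
  have d1 (s : R) : is_derive s (1 : R) (u \o -%R) (- du (- s)).
    by apply: (is_derive_eq (@is_derive1_comp R u -%R _ _ _ (hu _) (is_deriveNid s 1))); rewrite mulrN1.
  have d2 (s : R) : is_derive s (1 : R) (fun s => - du (- s)) (ddu (- s)).
    have d0 := @is_derive1_comp R du -%R _ _ _ (hdu _) (is_deriveNid s 1).
    by apply: (is_derive_eq (is_deriveN d0)); rewrite mulrN1 opprK.
  have := key _ _ _ _ d1 d2 (fun s => hC (- s)) N0.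
  by rewrite /= opprK oppr0 mulrNN sqrrN.
- by rewrite subrr mul0r subrr normr0 expr0n mulr0.
Qed.

Lemma Rintegral_bounded_le (M : R) f phi : L2 f -> test_fun phi ->
  {ae mu, forall x, `|f x| <= M} ->
  `|\int[mu]_x (f x * phi x)| <= M * \int[mu]_x `|phi x|.
Proof.
move=> Lf tp fM; have ifp := integrable_test Lf tp.
have ip := integrable_norm (test_integrable tp).
rewrite (le_trans (le_normr_Rintegral measurableT ifp))// -RintegralZl//.
have mf := L2_measurable Lf; have mp := test_measurable tp.
have iM : mu.-integrable setT (fun x => (M * `|phi x|)%:E).
  by under eq_fun do rewrite EFinM; exact: integrableZl.
rewrite -subr_ge0 -RintegralB//; last exact: (integrable_norm ifp).
rewrite /Rintegral; apply: fine_ge0.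
have mh : measurable_fun setT (fun x => M * `|phi x| - `|f x * phi x|).
  apply: measurable_funB; first by apply: measurable_funM => //; exact: measurableT_comp.
  by apply: measurableT_comp => //; exact: measurable_funM.
rewrite (@ae_eq_integral _ _ _ mu setT
  (fun x => (`|M * `|phi x| - `|f x * phi x| |)%:E))//.
- by apply: integral_ge0 => x _; rewrite lee_fin.
- exact/measurable_EFinP.
- by apply/measurable_EFinP; exact: measurableT_comp.
apply: filterS fM => x fM _; congr EFin; rewrite [RHS]ger0_norm// subr_ge0 normrM.
exact: ler_wpM2r.
Qed.

(** Taylor's formula with a remainder that is uniform almost everywhere; it is
    obtained by testing, from Taylor's formula for the correlations of f. *)
Lemma ae_taylor f i : Hinf f -> exists2 M : R, 0 <= M & forall t : R,
  {ae mu, forall x, `|f (x + t *: e_ i) - f x - t * wpartial i f x| <= M * t ^+ 2}.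
Proof.
move=> Hf; have Hf1 := Hinf_wpartial i Hf; have Hf2 := Hinf_wpartial i Hf1.
have [M M0 hM] := Hinf_bounded Hf2; exists M => // t.
have Lf := Hinf_L2 Hf; have Lf1 := Hinf_L2 Hf1; have Lf2 := Hinf_L2 Hf2.
have Lt := L2_translation (t *: e_ i) Lf.
suff : {ae mu, forall x, `|f (x + t *: e_ i) + (-1 * f x + - t * wpartial i f x)| <= M * t ^+ 2}.
  by apply: filterS => x; rewrite mulN1r mulNr addrA.
have LN := L2Z (-1) Lf; have LN1 := L2Z (- t) Lf1.
apply: L2_bounded_test; first by apply: L2D => //; exact: L2D.
move=> phi tp.
pose u s := correlation f phi (s *: e_ i).
pose du s := correlation (wpartial i f) phi (s *: e_ i).
pose ddu s := correlation (wpartial i (wpartial i f)) phi (s *: e_ i).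
have hu s : is_derive (s : R) (1 : R) u (du s).
  by apply: is_derive_correlation_weak => //; exact: weak_partialP.
have hdu s : is_derive (s : R) (1 : R) du (ddu s).
  by apply: is_derive_correlation_weak => //; exact: weak_partialP.
have hddu s : `|ddu s| <= M * \int[mu]_x `|phi x|.
  apply: Rintegral_bounded_le => //; first exact: L2_translation.
  exact: (@ae_translation R n (s *: e_ i) [set x | `|wpartial i (wpartial i f) x| <= M]).
have := taylor_le hu hdu hddu t.
rewrite mulrAC; apply: le_trans; rewrite le_eqVlt; apply/orP; left; apply/eqP; congr `|_|.
rewrite /u /du scale0r /correlation.
under [X in _ = _ - X - _]eq_Rintegral do rewrite addr0.
under [X in _ = _ - _ - t * X]eq_Rintegral do rewrite addr0.
have i1 := integrable_test Lt tp.
have i2 := integrable_test LN tp; have i3 := integrable_test LN1 tp.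
rewrite (_ : \int[mu]_x _ = \int[mu]_x (f (x + t *: e_ i) * phi x +
    ((-1 * f x) * phi x + (- t * wpartial i f x) * phi x))); last first.
  by apply: eq_Rintegral => x _; rewrite !mulrDl.
have i23 : mu.-integrable setT (fun x => ((-1 * f x) * phi x +
    (- t * wpartial i f x) * phi x)%:E).
  by under eq_fun do rewrite EFinD; exact: integrableD.
rewrite RintegralD// RintegralD// -addrA; congr (_ + (_ + _)).
- rewrite -[RHS]mulN1r -RintegralZl//; last exact: integrable_test.
  by apply: eq_Rintegral => x _; rewrite mulrA.
- rewrite -[RHS]mulNr -RintegralZl//; last exact: integrable_test.
  by apply: eq_Rintegral => x _; rewrite mulrA.
Qed.

Lemma L2_mul_Hinf f g : Hinf f -> L2 g -> L2 (fun x => f x * g x).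
Proof.
move=> Hf Lg; have [M _ hM] := Hinf_bounded Hf.
by apply: L2_bounded_mul hM Lg; exact: Hinf_measurable.
Qed.

(** The derivative at t = 0 of the correlation W of f g with phi is computed in
    two ways: on phi, which is the left-hand side, and from the Taylor
    expansions of f and g, which is the right-hand side. *)
Lemma weak_partialM f g i : Hinf f -> Hinf g ->
  weak_partial i (fun x => f x * g x)
    (fun x => wpartial i f x * g x + f x * wpartial i g x).
Proof.
move=> Hf Hg phi tp.
set f1 := wpartial i f; set g1 := wpartial i g.
have Hf1 : Hinf f1 by exact: Hinf_wpartial.
have Hg1 : Hinf g1 by exact: Hinf_wpartial.
have Lg := Hinf_L2 Hg; have Lg1 := Hinf_L2 Hg1.
have Lfg : L2 (fun x => f x * g x) by exact: L2_mul_Hinf.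
have Lf1g : L2 (fun x => f1 x * g x) by exact: L2_mul_Hinf.
have Lfg1 : L2 (fun x => f x * g1 x) by exact: L2_mul_Hinf.
have Lh : L2 (fun x => f1 x * g x + f x * g1 x) by exact: L2D.
have [Mf Mf0 hMf] := ae_taylor i Hf; have [Mg Mg0 hMg] := ae_taylor i Hg.
have [Bf Bf0 hBf] := Hinf_bounded Hf; have [Bg Bg0 hBg] := Hinf_bounded Hg.
have [Bf1 Bf10 hBf1] := Hinf_bounded Hf1; have [Bg1 Bg10 hBg1] := Hinf_bounded Hg1.
pose W (t : R) := correlation (fun x => f x * g x) phi (t *: e_ i).
(* bounds the coefficient of t^2 in the product of the Taylor expansions *)
pose K := (Mf * Bg + (Bf + Bf1) * Mg + Bf1 * Bg1).
set D := \int[mu]_x ((f1 x * g x + f x * g1 x) * phi x).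
have D1 : is_derive (0 : R) (1 : R) W (- \int[mu]_x (f x * g x * 'D_(e_ i) phi x)).
  rewrite (_ : W = (fun s : R => \int[mu]_x (f x * g x * phi (x + s *: e_ i))) \o -%R).
    have d1 := is_derive_correlation i (- 0) Lfg tp.
    have d2 := @is_derive1_comp R _ -%R _ _ _ d1 (is_deriveNid (0 : R) (1 : R)).
    apply: (is_derive_eq d2); rewrite mulrN1; apply: (congr1 (fun z : R => - z)).
    by apply: eq_Rintegral => x _; rewrite oppr0 scale0r addr0.
  by apply/funext => s /=; rewrite /W correlationE// scaleNr.
suff D2 : is_derive (0 : R) (1 : R) W D.
  have e1 := @derive_val _ _ _ _ _ _ _ D1; have e2 := @derive_val _ _ _ _ _ _ _ D2.
  by apply: oppr_inj; rewrite opprK; apply: etrans (esym e1) e2.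
apply: (@is_derive_quadratic _ _ _ _ (K * \int[mu]_x `|phi x|) 1) => // t t1.
rewrite add0r.
have Lft := L2_translation (t *: e_ i) Lfg.
pose r x := f (x + t *: e_ i) * g (x + t *: e_ i) + (-1 * (f x * g x) +
  - t * (f1 x * g x + f x * g1 x)).
have Lr : L2 r by apply: L2D => //; apply: L2D; exact: L2Z.
have -> : W t - W 0 - t * D = \int[mu]_x (r x * phi x).
  rewrite /W /D /correlation scale0r.
  under [X in _ - X - _ = _]eq_Rintegral do rewrite addr0.
  have i1 := integrable_test Lft tp.
  have i2 := integrable_test (L2Z (-1) Lfg) tp.
  have i3 := integrable_test (L2Z (- t) Lh) tp.
  rewrite (_ : \int[mu]_x (r x * phi x) = \int[mu]_x
     (f (x + t *: e_ i) * g (x + t *: e_ i) * phi x +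
     ((-1 * (f x * g x)) * phi x + (- t * (f1 x * g x + f x * g1 x)) * phi x))); last first.
    by apply: eq_Rintegral => x _; rewrite /r !mulrDl.
  have i23 : mu.-integrable setT (fun x => ((-1 * (f x * g x)) * phi x +
      (- t * (f1 x * g x + f x * g1 x)) * phi x)%:E).
    by under eq_fun do rewrite EFinD; exact: integrableD.
  rewrite RintegralD// RintegralD// -[LHS]addrA; congr (_ + (_ + _)).
  - rewrite -[LHS]mulN1r -RintegralZl//; last exact: integrable_test.
    by apply: eq_Rintegral => x _; rewrite mulrA.
  - rewrite -[LHS]mulNr -RintegralZl//; last exact: integrable_test.
    by apply: eq_Rintegral => x _; rewrite mulrA.
rewrite mulrAC; apply: Rintegral_bounded_le => //.
have hBgt := @ae_translation R n (t *: e_ i) [set x | `|g x| <= Bg] hBg.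
have t1' : `|t| <= 1 by exact: ltW.
have pointwise (a b c d ft gt : R) : `|a| <= Bf -> `|b| <= Bf1 -> `|c| <= Bg1 ->
    `|gt| <= Bg -> `|ft - a - t * b| <= Mf * t ^+ 2 -> `|gt - d - t * c| <= Mg * t ^+ 2 ->
    `|ft * gt + (-1 * (a * d) + - t * (b * d + a * c))| <= K * t ^+ 2.
  clear -t1' Mf0 Mg0 Bf0 Bg0 Bf10 Bg10 => ha hb hc hg hf hd.
  have -> : ft * gt + (-1 * (a * d) + - t * (b * d + a * c)) =
    (ft - a - t * b) * gt + (a + t * b) * (gt - d - t * c) + t ^+ 2 * (b * c) by ring.
  have -> : K * t ^+ 2 = Mf * t ^+ 2 * Bg + (Bf + Bf1) * (Mg * t ^+ 2) +
    t ^+ 2 * (Bf1 * Bg1) by rewrite /K; ring.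
  rewrite (le_trans (ler_normD _ _))// lerD//; last first.
    by rewrite normrM ger0_norm ?sqr_ge0// ler_wpM2l ?sqr_ge0// normrM ler_pM.
  rewrite (le_trans (ler_normD _ _))// lerD//; rewrite normrM ler_pM//.
  rewrite (le_trans (ler_normD _ _))// lerD// normrM.
  by rewrite -[leRHS]mul1r ler_pM.
have A : {ae mu, forall x, [/\ `|f x| <= Bf, `|f1 x| <= Bf1 & `|g1 x| <= Bg1]}.
  by apply: filterS3 hBf hBf1 hBg1 => x.
apply: filterS2 A (filterI (filterI (hMf t) (hMg t)) hBgt) => x [a b c] [[d e] m].
exact: (pointwise (f x) (f1 x) (g1 x) (g x) (f (x + t *: e_ i)) (g (x + t *: e_ i))).
Qed.

End leibniz.
Section algebra.
Context {R : realType} {n : nat}.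
Local Notation Rn := 'rV[R]_n.
Local Notation mu := (@leb R n).
Local Notation e_ i := (delta_mx ord0 i : Rn).
Implicit Types (f g h phi : Rn -> R).

(** This class is stable under weak derivatives by the Leibniz rule, and
    contained in L^2 since one factor of each product is bounded. *)
Inductive Hinf_products : (Rn -> R) -> Prop :=
| Hinf_product f g : Hinf f -> Hinf g -> Hinf_products (fun x => f x * g x)
| Hinf_productsD f g : Hinf_products f -> Hinf_products g ->
    Hinf_products (fun x => f x + g x).

Lemma HinfM f g : Hinf f -> Hinf g -> Hinf (fun x => f x * g x).
Proof.
move=> Hf Hg; apply: (@Hinf_coind _ _ Hinf_products); last exact: Hinf_product.
  move=> h; elim=> [p q Hp Hq|p q _ Lp _ Lq]; last exact: L2D.
  by apply: L2_mul_Hinf => //; exact: Hinf_L2.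
have SL h : Hinf_products h -> L2 h.
  elim=> [p q Hp Hq|p q _ Lp _ Lq]; last exact: L2D.
  by apply: L2_mul_Hinf => //; exact: Hinf_L2.
move=> h i; elim=> [p q Hp Hq|p q Sp [p' Sp' pp'] Sq [q' Sq' qq']].
  exists (fun x => wpartial i p x * q x + p x * wpartial i q x).
    by apply: Hinf_productsD; apply: Hinf_product => //; exact: Hinf_wpartial.
  exact: weak_partialM.
exists (fun x => p' x + q' x); first exact: Hinf_productsD.
apply/is_wderiv_dirac; apply: is_wderivD; try exact: SL; exact/is_wderiv_dirac.
Qed.

Lemma wpartialM i f g : Hinf f -> Hinf g -> {ae mu, forall x,
  wpartial i (fun x => f x * g x) x = wpartial i f x * g x + f x * wpartial i g x}.
Proof.
move=> Hf Hg; apply: wpartial_unique; [exact: HinfM| |exact: weak_partialM].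
by apply: L2D; apply: Hinf_L2; apply: HinfM => //; exact: Hinf_wpartial.
Qed.

Lemma cvg_test_rescale phi (x : Rn) : test_fun phi ->
  phi (k.+1%:R^-1 *: x + 0) @[k --> \oo] --> phi 0.
Proof.
move=> tp.
have c0 : k.+1%:R^-1 *: x + 0 @[k --> \oo] --> (0 : Rn).
  rewrite -[X in _ --> X](addr0 0); apply: cvgD; last exact: cvg_cst.
  by rewrite -[X in _ --> X](scale0r x); apply: cvgZr_tmp; exact: cvg_harmonic.
apply: (@continuous_cvg nat _ _ _ _ (fun k : nat => k.+1%:R^-1 *: x + 0) phi 0 _ c0).
by have cc := smooth_continuous (test_smooth tp); exact: cc.
Qed.

(** Integrate by parts against the test functions chi (x / k), which tend to
    the constant chi 0 while their derivatives are of order 1/k. *)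
Lemma Rintegral_weak_partial i h h' : L2 h -> L2 h' ->
  mu.-integrable setT (EFin \o h) -> mu.-integrable setT (EFin \o h') ->
  weak_partial i h h' -> \int[mu]_x h' x = 0.
Proof.
move=> Lh Lh' ih ih' hh'.
pose chi : Rn -> R := cube_bump 1.
have tchi : test_fun chi := test_cube_bump 1.
have chi0 : 0 < chi 0 by apply: cube_bump_gt0 => j; rewrite mxE normr0.
have [C C0 hC] := test_bounded tchi.
have [D D0 hD] := test_bounded (test_partial i tchi).
pose chik (k : nat) x := chi (k.+1%:R^-1 *: x + 0).
have tk k : test_fun (chik k).
  by apply: test_affine => //; rewrite invr_eq0 pnatr_eq0.
have dk k x : 'D_(e_ i) (chik k) x = k.+1%:R^-1 * 'D_(e_ i) chi (k.+1%:R^-1 *: x + 0).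
  by apply: derive_affine; exact: test_smooth.
have mh := measurable_int _ ih; have mh' := measurable_int _ ih'.
have c1 : \int[mu]_x (h' x * chik k x) @[k --> \oo] --> \int[mu]_x (h' x * chi 0).
  apply: (@Rintegral_dominated_cvg _ _ _ _ (fun x => C * `|h' x|)).
  - move=> k; apply: measurable_funM; last exact: test_measurable.
    exact/measurable_EFinP.
  - by move=> x; apply: cvgMr; exact: cvg_test_rescale.
  - rewrite /comp; under eq_fun do rewrite EFinM; apply: integrableZl => //.
    exact: integrable_norm.
  - by move=> k x; rewrite normrM mulrC ler_wpM2r// hC.
have c2 : \int[mu]_x (h x * 'D_(e_ i) (chik k) x) @[k --> \oo] --> \int[mu]_x (h x * 0).
  apply: (@Rintegral_dominated_cvg _ _ _ _ (fun x => D * `|h x|)).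
  - move=> k; apply: measurable_funM; first exact/measurable_EFinP.
    by apply: test_measurable; exact: test_partial.
  - move=> x; apply: cvgMr.
    rewrite (_ : (fun k => _) =
      (fun k : nat => k.+1%:R^-1 * 'D_(e_ i) chi (k.+1%:R^-1 *: x + 0))); last first.
      by apply/funext => k; exact: dk.
    rewrite -[X in _ --> X](mul0r ('D_(e_ i) chi 0)); apply: cvgM; first exact: cvg_harmonic.
    exact: (cvg_test_rescale x (test_partial i tchi)).
  - rewrite /comp; under eq_fun do rewrite EFinM; apply: integrableZl => //.
    exact: integrable_norm.
  - move=> k x; rewrite normrM mulrC ler_wpM2r// dk normrM.
    rewrite -[leRHS]mul1r ler_pM ?hD// ger0_norm ?invr_ge0//.
    by rewrite invf_le1// ler1n.
have E : (fun k => \int[mu]_x (h x * 'D_(e_ i) (chik k) x)) =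
    (fun k => - \int[mu]_x (h' x * chik k x)).
  by apply/funext => k; exact: hh'.
rewrite E in c2.
have e : \int[mu]_x (h x * 0) = - \int[mu]_x (h' x * chi 0).
  apply: etrans (esym (cvg_lim (@Rhausdorff R) c2)) _.
  exact: (cvg_lim (@Rhausdorff R) (cvgN c1)).
move: e; under eq_Rintegral do rewrite mulr0.
rewrite Rintegral_cst// mul0r RintegralZr// => /eqP.
by rewrite eq_sym oppr_eq0 mulf_eq0 (gt_eqF chi0) orbF => /eqP.
Qed.

Lemma integration_by_parts_Hinf i f g : Hinf f -> Hinf g ->
  \int[mu]_x (wpartial i f x * g x) = - \int[mu]_x (f x * wpartial i g x).
Proof.
move=> Hf Hg; have Hf1 := Hinf_wpartial i Hf; have Hg1 := Hinf_wpartial i Hg.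
have i1 := L2_integrableM (Hinf_L2 Hf1) (Hinf_L2 Hg).
have i2 := L2_integrableM (Hinf_L2 Hf) (Hinf_L2 Hg1).
apply/eqP; rewrite -addr_eq0 -RintegralD//; apply/eqP.
apply: (@Rintegral_weak_partial i (fun x => f x * g x)).
- by apply: Hinf_L2; exact: HinfM.
- by apply: Hinf_L2; apply: HinfD; exact: HinfM.
- by apply: L2_integrableM; exact: Hinf_L2.
- by rewrite /comp; under eq_fun do rewrite EFinD; exact: integrableD.
- exact: weak_partialM.
Qed.

End algebra.
(** * Smooth functionals on the dual *)

Section functionals.
Context {R : realType} {n : nat}.
Local Notation Rn := 'rV[R]_n.
Local Notation mu := (@leb R n).
Local Notation momdens := (@momdens R n).
Implicit Types (f g : Rn -> R) (m w : momdens).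

Let Q k f := \sum_(a : {ffun 'I_n -> 'I_k.+1} | (morder (fun i => a i : nat) <= k)%N)
    \int[mu]_x (wderiv (fun i => a i : nat) f x) ^+ 2.

Let Q_ge0 k f : 0 <= Q k f.
Proof. by apply: sumr_ge0 => a _; apply: Rintegral_ge0 => x _; exact: sqr_ge0. Qed.

Lemma Hnorm_ge0 k f : 0 <= Hnorm k f.
Proof. exact: sqrtr_ge0. Qed.

Lemma HnormZ_ae k (c : R) f g : Hinf f -> measurable_fun setT g ->
  {ae mu, forall x, c * f x = g x} -> Hnorm k g = `|c| * Hnorm k f.
Proof.
move=> Hf mg fg; rewrite -sqrtr_sqr /Hnorm -sqrtrM ?sqr_ge0//; congr Num.sqrt.
rewrite mulr_sumr; apply: eq_bigr => a _.
have Hcf := HinfZ c Hf; have Hg := Hinf_ae Hcf mg fg.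
have [Lf _] := wderivP (fun i => a i : nat) Hf.
have [Lg _] := wderivP (fun i => a i : nat) Hg.
rewrite -RintegralZl//; last exact: L2_integrable_sqr.
apply: eq_Rintegral_ae.
- by apply: measurable_funX; exact: (@L2_measurable R n).
- by apply: measurable_funM => //; apply: measurable_funX; exact: L2_measurable.
apply: filterS2 (wderivZ (fun i => a i : nat) c Hf)
  (wderiv_ae (fun i => a i : nat) Hcf mg fg) => x e1 e2.
by rewrite -e2 e1 exprMn.
Qed.

Let sqrD_le (p q : R) : (p + q) ^+ 2 <= 2 * (p ^+ 2 + q ^+ 2).
Proof. by have := sqr_ge0 (p - q); lra. Qed.

Let sqrt_add_le (p q : R) : 0 <= p -> 0 <= q ->
  Num.sqrt (2 * (p + q)) <= 2 * (Num.sqrt p + Num.sqrt q).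
Proof.
move=> p0 q0; have P0 := sqrtr_ge0 p; have P1 := sqrtr_ge0 q.
rewrite -[leRHS]ger0_norm; last by rewrite mulr_ge0// addr_ge0.
rewrite -sqrtr_sqr; apply: ler_wsqrtr.
rewrite -{1}(sqr_sqrtr p0) -{1}(sqr_sqrtr q0).
have := mulr_ge0 P0 P1; have := sqr_ge0 (Num.sqrt p); have := sqr_ge0 (Num.sqrt q).
by move: (Num.sqrt p) (Num.sqrt q) => r s; clear => h1 h2 h3; lra.
Qed.

(** The factor 2 comes from (p + q)^2 <= 2 (p^2 + q^2) and is harmless for
    questions of continuity at a point. *)
Lemma HnormD_le k f g : Hinf f -> Hinf g ->
  Hnorm k (fun x => f x + g x) <= 2 * (Hnorm k f + Hnorm k g).
Proof.
move=> Hf Hg.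
have H : Q k (fun x => f x + g x) <= 2 * (Q k f + Q k g).
  rewrite /Q -big_split/= mulr_sumr; apply: ler_sum => a _.
  have [Lf _] := wderivP (fun i => a i : nat) Hf.
  have [Lg _] := wderivP (fun i => a i : nat) Hg.
  have fi := L2_integrable_sqr Lf; have gi := L2_integrable_sqr Lg.
  rewrite -RintegralD// -RintegralZl//; last first.
    by rewrite /comp; under eq_fun do rewrite EFinD; exact: integrableD.
  rewrite (@eq_Rintegral_ae _ _ _ (fun x => (wderiv (fun i => a i : nat) f x +
    wderiv (fun i => a i : nat) g x) ^+ 2)).
  - apply: le_Rintegral => [| | |x _]; [by []| | |exact: sqrD_le].
    + by apply: L2_integrable_sqr; exact: L2D.
    + rewrite /comp; under eq_fun do rewrite EFinM; apply: integrableZl => //.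
      by under eq_fun do rewrite EFinD; exact: integrableD.
  - apply: measurable_funX; apply: (@L2_measurable R n).
    exact: (wderivP (fun i => a i : nat) (HinfD Hf Hg)).1.
  - by apply: measurable_funX; apply: (@L2_measurable R n); exact: L2D.
  - by apply: filterS (wderivD (fun i => a i : nat) Hf Hg) => x ->.
have QE h : Hnorm k h = Num.sqrt (Q k h) by [].
rewrite !QE; apply: le_trans (ler_wsqrtr H) _.
exact: sqrt_add_le (Q_ge0 k f) (Q_ge0 k g).
Qed.

Definition sscale (t : R) w : momdens := (fun x => t *: w.1 x, fun x => t * w.2 x).
Definition splus m w : momdens := (fun x => m.1 x + w.1 x, fun x => m.2 x + w.2 x).
Definition ae_eq_sd m w := (forall i, {ae mu, forall x, m.1 x ord0 i = w.1 x ord0 i}) /\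
  {ae mu, forall x, m.2 x = w.2 x}.

Lemma sadd_scaleE m t w : sadd_scale m t w = splus m (sscale t w).
Proof. by []. Qed.

Lemma sdual_scale t w : sdual w -> sdual (sscale t w).
Proof.
move=> [h1 h2]; split; last exact: HinfZ.
by move=> i; under [X in Hinf X]eq_fun do rewrite mxE; apply: HinfZ; exact: h1.
Qed.

Lemma sdual_plus m w : sdual m -> sdual w -> sdual (splus m w).
Proof.
move=> [h1 h2] [k1 k2]; split; last exact: HinfD.
by move=> i; under [X in Hinf X]eq_fun do rewrite mxE; apply: HinfD; [exact: h1|exact: k1].
Qed.

Lemma sdual_add_scale m t w : sdual m -> sdual w -> sdual (sadd_scale m t w).
Proof. by move=> hm hw; rewrite sadd_scaleE; apply: (sdual_plus hm); exact: sdual_scale. Qed.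

Lemma snorm_ge0 k m : 0 <= snorm k m.
Proof. by rewrite addr_ge0 ?Hnorm_ge0//; apply: sumr_ge0 => i _; exact: Hnorm_ge0. Qed.

Lemma snormZ k t w : sdual w -> snorm k (sscale t w) = `|t| * snorm k w.
Proof.
move=> [h1 h2]; rewrite /snorm mulrDr mulr_sumr; congr (_ + _).
  apply: eq_bigr => i _; apply: HnormZ_ae; first exact: h1.
    under eq_fun do rewrite mxE; apply: measurable_funM => //.
    by apply: Hinf_measurable; exact: h1.
  by apply: aeW => x; rewrite mxE.
apply: HnormZ_ae => //; last exact: aeW.
by apply: measurable_funM => //; exact: Hinf_measurable.
Qed.

Let sum_regroup (p q r s : R) : 2 * (p + q) + 2 * (r + s) <= 2 * ((p + r) + (q + s)).
Proof. by rewrite le_eqVlt; apply/orP; left; apply/eqP; ring. Qed.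

Lemma snormD_le k m w : sdual m -> sdual w ->
  snorm k (splus m w) <= 2 * (snorm k m + snorm k w).
Proof.
move=> [h1 h2] [k1 k2].
have H1 i : Hnorm k (fun x => (splus m w).1 x ord0 i) <=
    2 * (Hnorm k (fun x => m.1 x ord0 i) + Hnorm k (fun x => w.1 x ord0 i)).
  rewrite (_ : (fun x => (splus m w).1 x ord0 i) =
    fun x => m.1 x ord0 i + w.1 x ord0 i); last by apply/funext => x; rewrite mxE.
  by apply: HnormD_le; [exact: h1|exact: k1].
apply: le_trans (lerD (ler_sum _ (fun i _ => H1 i)) (HnormD_le k h2 k2)) _.
rewrite -mulr_sumr big_split/= /snorm.
exact: sum_regroup.
Qed.

Lemma snorm_ae0 k m : sdual m -> (forall i, {ae mu, forall x, m.1 x ord0 i = 0}) ->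
  {ae mu, forall x, m.2 x = 0} -> snorm k m = 0.
Proof.
move=> [h1 h2] z1 z2.
have Z g : Hinf g -> {ae mu, forall x, g x = 0} -> Hnorm k g = 0.
  move=> Hg g0; rewrite (@HnormZ_ae k 0 g g) ?normr0 ?mul0r//.
    exact: Hinf_measurable.
  by apply: filterS g0 => x ->; rewrite mul0r.
rewrite /snorm Z// addr0 big1// => i _; exact: Z.
Qed.

Lemma sdist_add k m w : sdist k (splus m w) m = snorm k w.
Proof.
congr snorm; rewrite /sadd_scale; case: w => w1 w2 /=; congr pair; apply/funext => x /=.
  by rewrite scaleN1r addrAC subrr add0r.
by rewrite mulN1r addrAC subrr add0r.
Qed.

Let sdual_nil (i : 'I_0) : sdual (tnth ([tuple] : 0.-tuple momdens) i).
Proof. by case: i. Qed.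

(** Continuity for the Sobolev seminorms cannot separate functions that are
    equal almost everywhere. *)
Lemma smooth_functional_ae (F : momdens -> R) m m' : smooth_functional F ->
  sdual m -> sdual m' -> ae_eq_sd m m' -> F m' = F m.
Proof.
move=> sF hm hm' [e1 e2]; have [_ cF] := sF 0%N.
apply/eqP; rewrite -subr_eq0 -normr_le0; apply/ler_addgt0Pl => e e0; rewrite addr0.
have [k [d [d0 hk]]] := cF [tuple] m sdual_nil hm e e0.
apply: ltW; apply: (hk [tuple] m' sdual_nil hm') => [|[]//].
rewrite /sdist snorm_ae0//.
- exact: sdual_add_scale.
- by move=> i; apply: filterS (e1 i) => x E; rewrite !mxE E mulN1r subrr.
- by apply: filterS e2 => x E /=; rewrite E mulN1r subrr.
Qed.

Lemma is_derive_functional (F : momdens -> R) m w (s : R) : smooth_functional F ->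
  sdual m -> sdual w ->
  is_derive s (1 : R) (fun t : R => F (sadd_scale m t w))
    (dirD F [:: w] (sadd_scale m s w)).
Proof.
move=> sF hm hw; have [dF _] := sF 0%N.
have hms : sdual (sadd_scale m s w) by exact: sdual_add_scale.
have := dF [tuple] w _ sdual_nil hw hms.
rewrite /= => /derivableP; rewrite -derive1E => d0; apply/is_derive_lineP.
rewrite (_ : (fun t : R => F (sadd_scale m (s + t *: 1) w)) =
  (fun t : R => F (sadd_scale (sadd_scale m s w) t w)))//.
apply/funext => t; congr F; rewrite /sadd_scale [t *: 1]mulr1 /=.
congr pair; apply/funext => x; first by rewrite scalerDl addrA.
by rewrite mulrDl addrA.
Qed.

Let norm_lt_add1 (y z : R) : `|y - z| < 1 -> `|y| < `|z| + 1.
Proof. by move=> yz; rewrite -{1}(subrK z y) (le_lt_trans (ler_normD _ _))// addrC ltrD2l. Qed.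

(** A smooth functional has the same derivative along the curve m + tA + t^2 B
    as along the line m + tA: by the mean value theorem the two differ by
    t^2 times a directional derivative in the fixed direction B, and this is
    bounded near m. *)
Lemma is_derive_parabola (F : momdens -> R) m A B (D : R) : smooth_functional F ->
  sdual m -> sdual A -> sdual B ->
  is_derive (0 : R) (1 : R) (fun t : R => F (sadd_scale m t A)) D ->
  is_derive (0 : R) (1 : R) (fun t : R => F (sadd_scale (sadd_scale m t A) (t ^+ 2) B)) D.
Proof.
move=> sF hm hA hB dA; have [_ cF] := sF 1%N.
have h1 : forall i, sdual (tnth [tuple B] i) by move=> i; rewrite (tnth_nth B) ord1.
have [k [d [d0 hk]]] := cF [tuple B] m h1 hm 1 ltr01.
pose S := snorm k A + snorm k B.
have S0 : 0 <= S by rewrite addr_ge0// snorm_ge0.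
pose K : R := `|dirD F [:: B] m| + 1.
pose e := Num.min 1 (d / (2 * S + 1)).
have S1 : 0 < 2 * S + 1 by rewrite ltr_wpDl// mulr_ge0.
have e0 : 0 < e by rewrite lt_min ltr01/= divr_gt0.
pose V t := F (sadd_scale (sadd_scale m t A) (t ^+ 2) B) - F (sadd_scale m t A).
have add0 (w w' : momdens) : sadd_scale w 0 w' = w.
  rewrite /sadd_scale; case: w => w1 w2 /=.
  by congr pair; apply/funext => x; rewrite ?scale0r ?mul0r addr0.
have dV : is_derive (0 : R) (1 : R) V 0.
  apply: (@is_derive_quadratic _ _ _ _ K e) => // t te.
  have V0 : V 0 = 0 by rewrite /V expr0n/= !add0 subrr.
  rewrite add0r mulr0 V0 !subr0.
  have [->|t0] := eqVneq t 0; first by rewrite V0 normr0 expr0n mulr0.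
  have t2 : 0 < t ^+ 2 by rewrite exprn_even_gt0.
  have hmA : sdual (sadd_scale m t A) by exact: sdual_add_scale.
  have [s /andP[s0 st] Vs] := MVT_increment t2 (fun s => is_derive_functional s sF hmA hB).
  rewrite add0 in Vs; rewrite /V Vs normrM gtr0_norm// mulrC ler_wpM2r ?ltW//.
  have tm : `|t| < 1 /\ `|t| * (2 * S + 1) < d.
    by move: te; rewrite lt_min => /andP[-> ]; rewrite ltr_pdivlMr.
  have := hk [tuple B] (sadd_scale (sadd_scale m t A) s B) h1 (sdual_add_scale s hmA hB).
  have -> : sadd_scale (sadd_scale m t A) s B = splus m (splus (sscale t A) (sscale s B)).
    by rewrite /sadd_scale /splus/=; congr pair; apply/funext => x; rewrite addrA.
  rewrite sdist_add => H.
  have /H{}H : snorm k (splus (sscale t A) (sscale s B)) < d.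
    apply: le_lt_trans (snormD_le _ (sdual_scale t hA) (sdual_scale s hB)) _.
    rewrite !snormZ// (gtr0_norm s0).
    have nA := snorm_ge0 k A; have nB := snorm_ge0 k B.
    have st1 : s <= `|t|.
      rewrite (le_trans (ltW st))// -real_normK ?num_real// expr2.
      by rewrite ler_piMr// ltW//; case: tm.
    case: tm => _; apply: le_lt_trans; rewrite /S.
    have := ler_wpM2r nB st1; have := normr_ge0 t.
    move: (snorm k A) (snorm k B) nA nB => p q p0 q0; lra.
  have {}H : `|dirD F [tuple B] (splus m (splus (sscale t A) (sscale s B))) -
      dirD F [tuple B] m| < 1.
    apply: H => i; rewrite (tnth_nth B) ord1 /= /sdist snorm_ae0//.
    - exact: sdual_add_scale.
    - by move=> j; apply: aeW => x; rewrite !mxE mulN1r subrr.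
    - by apply: aeW => x /=; rewrite mulN1r subrr.
  rewrite /K; exact: (@norm_lt_add1 (dirD F [:: B] _) (dirD F [:: B] m) H).
have := is_deriveD dA dV; rewrite addr0.
rewrite (_ : _ + V = (fun t : R => F (sadd_scale (sadd_scale m t A) (t ^+ 2) B)))//.
by apply/funext => t; rewrite /V !fctE addrC subrK.
Qed.

End functionals.
(** * The gradient of a functional of the Madelung variables *)

Section madelung_gradient.
Context {R : realType} {n : nat}.
Local Notation Rn := 'rV[R]_n.
Local Notation mu := (@leb R n).
Local Notation momdens := (@momdens R n).
Implicit Types (f g h : Rn -> R) (u v : Rn -> Rn) (psi phi : Rn -> R[i]).

Local Notation re psi := (fun x : Rn => complex.Re (psi x)).
Local Notation im psi := (fun x : Rn => complex.Im (psi x)).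

Lemma ae_ord (P : 'I_n -> Rn -> Prop) :
  (forall i, {ae mu, forall x, P i x}) -> {ae mu, forall x, forall i, P i x}.
Proof.
move=> h.
have H : forall k : nat, {ae mu, forall x, forall i : 'I_n, i = k :> nat -> P i x}.
  move=> k; case: (ltnP k n) => kn.
    apply: filterS (h (Ordinal kn)) => x Px i ik.
    by rewrite (_ : i = Ordinal kn)//; exact: val_inj.
  by apply: aeW => x i ik; move: (ltn_ord i); rewrite ik ltnNge kn.
by have := ae_foralln H; apply: filterS => x Hx i; exact: (Hx i i erefl).
Qed.

Lemma wpartialDZ i (c : R) f g : Hinf f -> Hinf g -> {ae mu, forall x,
  wpartial i (fun y => f y + c * g y) x = wpartial i f x + c * wpartial i g x}.
Proof.
move=> Hf Hg.
apply: filterS2 (wderivD (dirac_mi i) Hf (HinfZ c Hg)) (wderivZ (dirac_mi i) c Hg) => x.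
by rewrite /wpartial => -> ->.
Qed.

(** Divergences of products of two functions are the source of these. *)
Definition null_integral f := mu.-integrable setT (EFin \o f) /\ \int[mu]_x f x = 0.

Lemma null_integralD f g : null_integral f -> null_integral g ->
  null_integral (fun x => f x + g x).
Proof.
move=> [i1 e1] [i2 e2]; split; last by rewrite RintegralD// e1 e2 addr0.
by rewrite /comp; under eq_fun do rewrite EFinD; exact: integrableD.
Qed.

Lemma null_integralN f : null_integral f -> null_integral (fun x => - f x).
Proof.
move=> [i1 e1]; have E : (fun x => - f x) = (fun x => -1 * f x).
  by apply/funext => x; rewrite mulN1r.
rewrite E; split; last by rewrite RintegralZl// e1 mulr0.
by rewrite /comp; under eq_fun do rewrite EFinM; exact: integrableZl.
Qed.

Lemma null_integral_sum (I : Type) (r : seq I) (F : I -> Rn -> R) :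
  (forall i, null_integral (F i)) -> null_integral (fun x => \sum_(i <- r) F i x).
Proof.
move=> hF; elim: r => [|i r IH].
  under eq_fun do rewrite big_nil; split; first exact: integrable0.
  by rewrite Rintegral_cst// mul0r.
by under eq_fun do rewrite big_cons; exact: null_integralD.
Qed.

Lemma null_integral_divergence i f g : Hinf f -> Hinf g ->
  null_integral (wpartial i (fun x => f x * g x)).
Proof.
move=> Hf Hg; have Hf1 := Hinf_wpartial i Hf; have Hg1 := Hinf_wpartial i Hg.
have i1 := L2_integrableM (Hinf_L2 Hf1) (Hinf_L2 Hg).
have i2 := L2_integrableM (Hinf_L2 Hf) (Hinf_L2 Hg1).
have mw : measurable_fun setT (wpartial i (fun x => f x * g x)).
  by apply: Hinf_measurable; apply: Hinf_wpartial; exact: HinfM.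
have i12 : mu.-integrable setT (fun x => (wpartial i f x * g x + f x * wpartial i g x)%:E).
  by under eq_fun do rewrite EFinD; exact: integrableD.
have m12 : measurable_fun setT (fun x => wpartial i f x * g x + f x * wpartial i g x).
  by have /integrableP[/measurable_EFinP] := i12.
have E := wpartialM i Hf Hg; split.
  have /integrableP[mm foo] := i12.
  apply/integrableP; split; first exact/measurable_EFinP.
  rewrite (ae_eq_integral (fun x => `|(wpartial i f x * g x + f x * wpartial i g x)%:E|)%E)//.
  - by apply: measurableT_comp => //; exact/measurable_EFinP.
  - by apply: measurableT_comp => //; exact/measurable_EFinP.
  - by apply: filterS E => x e _ /=; rewrite e.
rewrite (eq_Rintegral_ae mw m12 E) RintegralD//.
by rewrite integration_by_parts_Hinf// addNr.
Qed.

Lemma eq_Rintegral_null f g h : measurable_fun setT f ->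
  mu.-integrable setT (EFin \o g) -> null_integral h ->
  {ae mu, forall x, f x = g x + h x} -> \int[mu]_x f x = \int[mu]_x g x.
Proof.
move=> mf ig [ih h0] E; have := RintegralD measurableT ig ih; rewrite h0 addr0 => <-.
apply: eq_Rintegral_ae => //.
have /integrableP[/measurable_EFinP mg _] := ig.
have /integrableP[/measurable_EFinP mh _] := ih.
exact: measurable_funD.
Qed.

Lemma integrable_Hinf2 f g : Hinf f -> Hinf g ->
  mu.-integrable setT (fun x => (f x * g x)%:E).
Proof. by move=> Hf Hg; apply: L2_integrableM; exact: Hinf_L2. Qed.

Lemma madelung1E psi x i : (madelung psi).1 x ord0 i =
  complex.Re (psi x) * wpartial i (im psi) x - complex.Im (psi x) * wpartial i (re psi) x.
Proof. by rewrite mxE /wpartialC; case: (psi x) => a b /=; rewrite mulNr. Qed.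

Lemma madelung2E psi x : (madelung psi).2 x =
  complex.Re (psi x) * complex.Re (psi x) + complex.Im (psi x) * complex.Im (psi x).
Proof. by rewrite /madelung/=; case: (psi x) => a b /=; rewrite mulNr opprK. Qed.

Lemma sdual_madelung psi : HinfC psi -> sdual (madelung psi).
Proof.
move=> [Ha Hb]; split=> [i|].
  under [X in Hinf X]eq_fun do rewrite madelung1E.
  by apply: HinfB; apply: HinfM => //; exact: Hinf_wpartial.
have -> : (madelung psi).2 = fun x => complex.Re (psi x) * complex.Re (psi x) +
    complex.Im (psi x) * complex.Im (psi x) by apply/funext => x; exact: madelung2E.
by apply: HinfD; exact: HinfM.
Qed.

(** The first variation of the transform at psi in the direction phi. *)
Definition dmadelung psi phi : momdens :=
  (fun x => \row_i (complex.Re (psi x) * wpartial i (im phi) x +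
                    complex.Re (phi x) * wpartial i (im psi) x -
                    (complex.Im (psi x) * wpartial i (re phi) x +
                     complex.Im (phi x) * wpartial i (re psi) x)),
   fun x => 2 * (complex.Re (psi x) * complex.Re (phi x) +
                 complex.Im (psi x) * complex.Im (phi x))).

Lemma sdual_dmadelung psi phi : HinfC psi -> HinfC phi -> sdual (dmadelung psi phi).
Proof.
move=> [Ha Hb] [Hp Hq]; split=> [i|]; last first.
  by apply: HinfZ; apply: HinfD; exact: HinfM.
under [X in Hinf X]eq_fun do rewrite mxE.
by apply: HinfB; apply: HinfD; apply: HinfM => //; exact: Hinf_wpartial.
Qed.

Lemma re_addZ psi phi (e : R) : re (fun y => psi y + (e%:C)%C * phi y) =
  (fun x => complex.Re (psi x) + e * complex.Re (phi x)).
Proof.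
by apply/funext => x; case: (psi x) (phi x) => a b [p q] /=; rewrite mul0r subr0.
Qed.

Lemma im_addZ psi phi (e : R) : im (fun y => psi y + (e%:C)%C * phi y) =
  (fun x => complex.Im (psi x) + e * complex.Im (phi x)).
Proof.
by apply/funext => x; case: (psi x) (phi x) => a b [p q] /=; rewrite mul0r addr0.
Qed.

Lemma HinfC_addZ psi phi (e : R) : HinfC psi -> HinfC phi ->
  HinfC (fun y => psi y + (e%:C)%C * phi y).
Proof.
move=> [Ha Hb] [Hp Hq]; split; rewrite ?re_addZ ?im_addZ.
  by apply: HinfD => //; exact: HinfZ.
by apply: HinfD => //; exact: HinfZ.
Qed.

Lemma sadd_scale1E (m w : momdens) (t : R) x i :
  (sadd_scale m t w).1 x ord0 i = m.1 x ord0 i + t * w.1 x ord0 i.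
Proof. by rewrite /sadd_scale/= !mxE. Qed.

Lemma sadd_scale2E (m w : momdens) (t : R) x :
  (sadd_scale m t w).2 x = m.2 x + t * w.2 x.
Proof. by []. Qed.

(** The transform is quadratic, so that the expansion is exact; the equality is
    almost everywhere because weak derivatives are representatives. *)
Lemma madelung_expansion psi phi (e : R) : HinfC psi -> HinfC phi ->
  ae_eq_sd (sadd_scale (sadd_scale (madelung psi) e (dmadelung psi phi)) (e ^+ 2) (madelung phi))
    (madelung (fun y => psi y + (e%:C)%C * phi y)).
Proof.
move=> [Ha Hb] [Hp Hq]; split=> [i|].
  apply: filterS2 (wpartialDZ i e Ha Hp) (wpartialDZ i e Hb Hq) => x E1 E2.
  rewrite madelung1E re_addZ im_addZ E1 E2.
  have -> : complex.Re (psi x + (e%:C)%C * phi x) =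
    complex.Re (psi x) + e * complex.Re (phi x).
    exact: (congr1 (fun h => h x) (re_addZ psi phi e)).
  have -> : complex.Im (psi x + (e%:C)%C * phi x) =
    complex.Im (psi x) + e * complex.Im (phi x).
    exact: (congr1 (fun h => h x) (im_addZ psi phi e)).
  rewrite 2!sadd_scale1E 2!madelung1E [(dmadelung _ _).1 _ _ _]mxE.
  move: (wpartial i (im psi) x) (wpartial i (re psi) x) => db da.
  move: (wpartial i (im phi) x) (wpartial i (re phi) x) => dq dp.
  ring.
apply: aeW => x; rewrite madelung2E.
have -> : complex.Re (psi x + (e%:C)%C * phi x) =
  complex.Re (psi x) + e * complex.Re (phi x).
  exact: (congr1 (fun h => h x) (re_addZ psi phi e)).
have -> : complex.Im (psi x + (e%:C)%C * phi x) =
  complex.Im (psi x) + e * complex.Im (phi x).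
  exact: (congr1 (fun h => h x) (im_addZ psi phi e)).
rewrite 2!sadd_scale2E 2!madelung2E [(dmadelung _ _).2 _]/=; ring.
Qed.

(** Twice the action of u on half-densities: 2 u . grad f + (div u) f. *)
Definition half_density_op u f : Rn -> R := fun x =>
  \sum_i (2 * (u x ord0 i * wpartial i f x) + wpartial i (fun y => u y ord0 i) x * f x).

Lemma Hinf_half_density_op u f : HinfV u -> Hinf f -> Hinf (half_density_op u f).
Proof.
move=> Hu Hf; apply: Hinf_sum => i; apply: HinfD.
  by apply: HinfZ; apply: HinfM; [exact: Hu|exact: Hinf_wpartial].
by apply: HinfM => //; apply: Hinf_wpartial; exact: Hu.
Qed.

(** For g = (u, f) this is 2 f psi - i (2 u . grad psi + (div u) psi). *)
Definition madelung_grad (g : momdens) psi : Rn -> R[i] := fun x =>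
  ((2 * (g.2 x * complex.Re (psi x)) + half_density_op g.1 (im psi) x) +i*
   (2 * (g.2 x * complex.Im (psi x)) - half_density_op g.1 (re psi) x))%C.

Lemma HinfC_madelung_grad (g : momdens) psi : HinfV g.1 -> Hinf g.2 -> HinfC psi ->
  HinfC (madelung_grad g psi).
Proof.
move=> H1 H2 [Ha Hb]; split.
  by apply: HinfD; [apply: HinfZ; exact: HinfM|exact: Hinf_half_density_op].
by apply: HinfB; [apply: HinfZ; exact: HinfM|exact: Hinf_half_density_op].
Qed.

Lemma innerCE psi phi : innerC psi phi = \int[mu]_x
  (complex.Re (psi x) * complex.Re (phi x) + complex.Im (psi x) * complex.Im (phi x)).
Proof.
rewrite /innerC/=; apply: eq_Rintegral => x _.
by case: (psi x) (phi x) => a b [p q] /=; rewrite mulNr opprK.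
Qed.

Lemma wpartialM3 i f g h : Hinf f -> Hinf g -> Hinf h -> {ae mu, forall x,
  wpartial i (fun x => f x * g x * h x) x =
  wpartial i f x * g x * h x + f x * wpartial i g x * h x + f x * g x * wpartial i h x}.
Proof.
move=> Hf Hg Hh.
apply: filterS2 (wpartialM i (HinfM Hf Hg) Hh) (wpartialM i Hf Hg) => x -> ->.
by rewrite mulrDl.
Qed.

Let sum_regroup_grad (u D s r z : 'I_n -> R) p q :
  (forall i, u i * D i = s i * p - r i * q + z i) ->
  \sum_i u i * D i = (\sum_i s i) * p - (\sum_i r i) * q + \sum_i z i.
Proof.
move=> h; rewrite !mulr_suml -sumrB -big_split/=.
by apply: eq_bigr => i _; exact: h.
Qed.

(** The difference of the two integrands is the divergence of the field
    u (Re psi Im phi - Im psi Re phi). *)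
Lemma half_density_duality (g : momdens) psi phi : HinfV g.1 -> Hinf g.2 ->
  HinfC psi -> HinfC phi ->
  \int[mu]_x (dotv (g.1 x) ((dmadelung psi phi).1 x) + g.2 x * (dmadelung psi phi).2 x) =
  innerC (madelung_grad g psi) phi.
Proof.
move=> H1 H2 Hpsi Hphi; have [Ha Hb] := Hpsi; have [Hp Hq] := Hphi.
have [D1 D2] := sdual_dmadelung Hpsi Hphi; have [X1 X2] := HinfC_madelung_grad H1 H2 Hpsi.
rewrite innerCE.
set u := fun i x => g.1 x ord0 i.
have Hu i : Hinf (u i) by exact: H1.
apply: (@eq_Rintegral_null _ _ (fun x =>
  \sum_i (wpartial i (fun y => u i y * complex.Re (psi y) * complex.Im (phi y)) x -
          wpartial i (fun y => u i y * complex.Im (psi y) * complex.Re (phi y)) x))).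
- apply: measurable_funD; last first.
    by apply: measurable_funM; exact: Hinf_measurable.
  apply: measurable_sum => i; apply: measurable_funM; apply: Hinf_measurable.
    exact: H1.
  exact: D1.
- rewrite /comp; under eq_fun do rewrite EFinD.
  by apply: integrableD => //; exact: integrable_Hinf2.
- apply: null_integral_sum => i; apply: null_integralD.
    by apply: null_integral_divergence => //; exact: HinfM.
  by apply: null_integralN; apply: null_integral_divergence => //; exact: HinfM.
have E : {ae mu, forall x, forall i,
  wpartial i (fun y => u i y * complex.Re (psi y) * complex.Im (phi y)) x =
    wpartial i (u i) x * complex.Re (psi x) * complex.Im (phi x) +
    u i x * wpartial i (re psi) x * complex.Im (phi x) +
    u i x * complex.Re (psi x) * wpartial i (im phi) x /\
  wpartial i (fun y => u i y * complex.Im (psi y) * complex.Re (phi y)) x =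
    wpartial i (u i) x * complex.Im (psi x) * complex.Re (phi x) +
    u i x * wpartial i (im psi) x * complex.Re (phi x) +
    u i x * complex.Im (psi x) * wpartial i (re phi) x}.
  apply: ae_ord => i.
  by apply: filterS2 (wpartialM3 i (Hu i) Ha Hq) (wpartialM3 i (Hu i) Hb Hp) => x.
apply: filterS E => x E.
rewrite /dotv /madelung_grad /half_density_op; cbn [complex.Re complex.Im].
rewrite (sum_regroup_grad (s := fun i => 2 * (g.1 x ord0 i * wpartial i (im psi) x) +
    wpartial i (fun y => g.1 y ord0 i) x * complex.Im (psi x))
  (r := fun i => 2 * (g.1 x ord0 i * wpartial i (re psi) x) +
    wpartial i (fun y => g.1 y ord0 i) x * complex.Re (psi x))
  (z := fun i => wpartial i (fun y => u i y * complex.Re (psi y) * complex.Im (phi y)) x -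
    wpartial i (fun y => u i y * complex.Im (psi y) * complex.Re (phi y)) x)
  (p := complex.Re (phi x)) (q := complex.Im (phi x))); last first.
  move=> i; have [-> ->] := E i; rewrite [(dmadelung _ _).1 _ _ _]mxE -/(u i x) -/(u i).
  move: (u i x) (wpartial i (u i) x) => ui dui.
  move: (wpartial i (im psi) x) (wpartial i (re psi) x) => db da.
  move: (wpartial i (im phi) x) (wpartial i (re phi) x) => dq dp.
  ring.
rewrite [(dmadelung _ _).2 _]/=.
move: (\sum_i _) (\sum_i _) (\sum_i _) => S1 S2 S3.
ring.
Qed.

(** Up to equality almost everywhere, the image of a line under the transform
    is a parabola, which contributes to the derivative only by its tangent. *)
Lemma is_gradC_madelung (F : momdens -> R) (g : momdens) psi : smooth_functional F ->
  HinfC psi -> is_sgrad F (madelung psi) g ->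
  is_gradC (F \o madelung) psi (madelung_grad g psi).
Proof.
move=> sF Hpsi [H1 H2 dF]; split; first exact: HinfC_madelung_grad.
move=> phi Hphi; have HA := sdual_dmadelung Hpsi Hphi.
have hm := sdual_madelung Hpsi; have hB := sdual_madelung Hphi.
rewrite -half_density_duality//.
have := is_derive_parabola sF hm HA hB (dF _ HA).
rewrite (_ : (fun t : R => F (sadd_scale (sadd_scale _ t _) _ _)) =
  (fun eps : R => (F \o madelung) (fun x => psi x + (eps%:C)%C * phi x)))//.
apply/funext => e /=; apply/esym; apply: (smooth_functional_ae sF).
- by apply: sdual_add_scale => //; exact: sdual_add_scale.
- by apply: sdual_madelung; exact: HinfC_addZ.
- exact: madelung_expansion.
Qed.

End madelung_gradient.
(** * The Poisson property *)

Section bracket_algebra.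
Context {R : realType} {n : nat}.
Variables (U V da db df dg : 'I_n -> R) (DU DV dda ddb : 'I_n -> 'I_n -> R).
Variables (f g a b : R).

Definition half_density_val (W : 'I_n -> R) (DW : 'I_n -> 'I_n -> R) (c : R) (dc : 'I_n -> R) :=
  \sum_i (2 * (W i * dc i) + DW i i * c).

Let m i := a * db i - b * da i.
Let dm j i := da j * db i + a * ddb j i - (db j * da i + b * dda j i).
Let rho := a * a + b * b.
Let drho i := da i * a + a * da i + (db i * b + b * db i).

(** The pointwise form of the identity, where D W i j stands for the derivative
    of the j-th component of W in direction i: the two brackets have densities
    that differ by the divergences of g rho U, of f rho V and of the fields
    built from the momentum density m. *)
Lemma bracket_pointwise :
  (forall i j, dda i j = dda j i) -> (forall i j, ddb i j = ddb j i) ->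
  2^-1 * ((2 * (f * a) + half_density_val U DU b db) *
          (2 * (g * b) - half_density_val V DV a da) -
          (2 * (f * b) - half_density_val U DU a da) *
          (2 * (g * a) + half_density_val V DV b db)) =
  (\sum_j m j * (\sum_i V i * DU i j - \sum_i U i * DV i j) +
   rho * (\sum_i V i * df i - \sum_i U i * dg i)) +
  (\sum_i ((DU i i * g * rho + U i * dg i * rho + U i * g * drho i) -
           (DV i i * f * rho + V i * df i * rho + V i * f * drho i)) +
   \sum_i \sum_j ((DU i i * V j * m j + U i * DV i j * m j + U i * V j * dm i j) -
                  (DU j i * V j * m i + U i * DV j j * m i + U i * V j * dm j i))).
Proof.
move=> sa sb.
set Ua := half_density_val U DU a da; set Ub := half_density_val U DU b db.
set Va := half_density_val V DV a da; set Vb := half_density_val V DV b db.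
have -> : 2^-1 * ((2 * (f * a) + Ub) * (2 * (g * b) - Va) -
    (2 * (f * b) - Ua) * (2 * (g * a) + Vb)) =
  (g * (a * Ua + b * Ub) - f * (a * Va + b * Vb)) + 2^-1 * (Ua * Vb - Ub * Va).
  by field.
have S1 (W dh : 'I_n -> R) (DW : 'I_n -> 'I_n -> R) (h : R) :
    h * (a * half_density_val W DW a da + b * half_density_val W DW b db) +
    rho * \sum_i W i * dh i =
    \sum_i (DW i i * h * rho + W i * dh i * rho + W i * h * drho i).
  rewrite /half_density_val !mulr_sumr -big_split/= mulr_sumr -big_split/=.
  by apply: eq_bigr => i _; rewrite /rho /drho; ring.
have S2 : 2^-1 * (Ua * Vb - Ub * Va) =
    \sum_j m j * (\sum_i V i * DU i j - \sum_i U i * DV i j) +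
    \sum_i \sum_j ((DU i i * V j * m j + U i * DV i j * m j + U i * V j * dm i j) -
                  (DU j i * V j * m i + U i * DV j j * m i + U i * V j * dm j i)).
  rewrite /Ua /Ub /Va /Vb /half_density_val !big_distrlr/= -sumrB mulr_sumr.
  have -> : \sum_j m j * (\sum_i V i * DU i j - \sum_i U i * DV i j) =
      \sum_i \sum_j (m i * (V j * DU j i) - m j * (U i * DV i j)).
    under eq_bigr do rewrite mulrBr !mulr_sumr.
    rewrite sumrB [X in _ - X]exchange_big/= -sumrB.
    by apply: eq_bigr => i _; rewrite -sumrB.
  rewrite -big_split/=; apply: eq_bigr => i _.
  rewrite -sumrB mulr_sumr -big_split/=; apply: eq_bigr => j _.
  by rewrite /dm /m (sa j i) (sb j i); field.
rewrite S2 sumrB -(S1 U dg DU g) -(S1 V df DV f) -/Ua -/Ub -/Va -/Vb; ring.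
Qed.

End bracket_algebra.

Section bracket.
Context {R : realType} {n : nat}.
Local Notation Rn := 'rV[R]_n.
Local Notation mu := (@leb R n).
Local Notation momdens := (@momdens R n).
Implicit Types (psi phi X Y : Rn -> R[i]).

Local Notation re psi := (fun x : Rn => complex.Re (psi x)).
Local Notation im psi := (fun x : Rn => complex.Im (psi x)).

Lemma innerC_half_i X Y : innerC X (fun x => - ('i%C / 2%:R) * Y x) =
  \int[mu]_x (2^-1 * (complex.Re (X x) * complex.Im (Y x) -
                      complex.Im (X x) * complex.Re (Y x))).
Proof.
have -> : 'i%C / 2%:R = (0 +i* 2^-1)%C :> R[i].
  have n2 : (2%:R : R[i]) != 0 by rewrite pnatr_eq0.
  apply: (mulIf n2); rewrite mulfVK// mulr_natr mulr2n.
  apply/eqP; rewrite eq_complex/= addr0 eqxx/=.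
  by apply/eqP; field.
rewrite innerCE; apply: eq_Rintegral => x _.
by case: (X x) (Y x) => a b [c d] /=; ring.
Qed.

(** Two gradients have the same product with every direction; take their
    difference as direction. *)
Lemma ae_gradC_unique (F : (Rn -> R[i]) -> R) psi X Y :
  is_gradC F psi X -> is_gradC F psi Y ->
  {ae mu, forall x, complex.Re (X x) = complex.Re (Y x) /\ complex.Im (X x) = complex.Im (Y x)}.
Proof.
move=> [[Xr Xi] hX] [[Yr Yi] hY].
pose Z x : R[i] := ((complex.Re (X x) - complex.Re (Y x)) +i*
               (complex.Im (X x) - complex.Im (Y x)))%C.
have HZ : HinfC Z by split; exact: HinfB.
have E : innerC X Z = innerC Y Z.
  have d1 := @derive_val _ _ _ _ _ _ _ (hX Z HZ).
  have d2 := @derive_val _ _ _ _ _ _ _ (hY Z HZ).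
  by rewrite -d1 -d2.
have [HZr HZi] := HZ.
pose N x := complex.Re (Z x) ^+ 2 + complex.Im (Z x) ^+ 2.
have iN : mu.-integrable setT (EFin \o N).
  rewrite /comp /N; under eq_fun do rewrite EFinD.
  by apply: integrableD => //; apply: L2_integrable_sqr; exact: Hinf_L2.
have N0 x : 0 <= N x by rewrite addr_ge0// sqr_ge0.
have IN : \int[mu]_x N x = 0.
  have iI (W : Rn -> R[i]) : HinfC W -> mu.-integrable setT (EFin \o (fun x =>
      complex.Re (W x) * complex.Re (Z x) + complex.Im (W x) * complex.Im (Z x))).
    move=> [Wr Wi]; rewrite /comp; under eq_fun do rewrite EFinD.
    by apply: integrableD => //; exact: integrable_Hinf2.
  move/eqP: E; rewrite -subr_eq0 !innerCE -RintegralB//; last 2 first.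
  - exact: (iI X).
  - exact: (iI Y).
  move=> /eqP <-; apply: eq_Rintegral => x _; rewrite /N /Z/=; ring.
have /ae_eq_integral_abs h : (\int[mu]_x `|(N x)%:E| = 0)%E.
  rewrite (eq_integral (fun x => (N x)%:E)); last first.
    by move=> x _; rewrite gee0_abs// lee_fin.
  rewrite -[LHS]fineK; last exact: integrable_fin_num iN.
  by rewrite -[fine _]/(\int[mu]_x N x) IN.
have := h measurableT (measurable_int _ iN).
apply: filterS => x /(_ I) [] /eqP; rewrite paddr_eq0 ?sqr_ge0// !sqrf_eq0/= !subr_eq0.
by move=> /andP[/eqP -> /eqP ->].
Qed.

(** Almost every point satisfies the hypotheses of [bracket_pointwise], and the
    divergences there have vanishing integrals. *)
Lemma bracket_integral (g1 g2 : momdens) psi :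
  HinfV g1.1 -> Hinf g1.2 -> HinfV g2.1 -> Hinf g2.2 -> HinfC psi ->
  \int[mu]_x (2^-1 *
    (complex.Re (madelung_grad g1 psi x) * complex.Im (madelung_grad g2 psi x) -
     complex.Im (madelung_grad g1 psi x) * complex.Re (madelung_grad g2 psi x))) =
  \int[mu]_x dotv ((madelung psi).1 x) (advectV g2.1 g1.1 x - advectV g1.1 g2.1 x) +
  \int[mu]_x ((madelung psi).2 x * (advect g2.1 g1.2 x - advect g1.1 g2.2 x)).
Proof.
move=> Hu Hf Hv Hg Hpsi; have [Ha Hb] := Hpsi.
have [Hm Hr] := sdual_madelung Hpsi.
pose u i x := g1.1 x ord0 i; pose v i x := g2.1 x ord0 i.
pose m i x := (madelung psi).1 x ord0 i; pose r := (madelung psi).2.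
have Hui i : Hinf (u i) by exact: Hu.
have Hvi i : Hinf (v i) by exact: Hv.
have Hmi i : Hinf (m i) by exact: Hm.
have Hadv (w : Rn -> Rn) (h : Rn -> R) : HinfV w -> Hinf h -> Hinf (advect w h).
  move=> Hw Hh; apply: Hinf_sum => i; apply: HinfM; [exact: Hw|exact: Hinf_wpartial].
have [X1 X2] := HinfC_madelung_grad Hu Hf Hpsi.
have [Y1 Y2] := HinfC_madelung_grad Hv Hg Hpsi.
have Hw j : Hinf (fun x => (advectV g2.1 g1.1 x - advectV g1.1 g2.1 x) ord0 j).
  rewrite (_ : (fun x => _) = fun x => advect g2.1 (u j) x - advect g1.1 (v j) x).
    by apply: HinfB; apply: Hadv.
  by apply/funext => x; rewrite !mxE.
have i1 : mu.-integrable setT (EFin \o (fun x =>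
    dotv ((madelung psi).1 x) (advectV g2.1 g1.1 x - advectV g1.1 g2.1 x))).
  rewrite /comp /dotv; under eq_fun do rewrite -sumEFin.
  by apply: integrable_sum => // j _; apply: integrable_Hinf2.
have i2 : mu.-integrable setT (EFin \o (fun x =>
    (madelung psi).2 x * (advect g2.1 g1.2 x - advect g1.1 g2.2 x))).
  by apply: integrable_Hinf2 => //; apply: HinfB; apply: Hadv.
rewrite -RintegralD//.
apply: (@eq_Rintegral_null _ _ _ _ (fun x =>
  \sum_i (wpartial i (fun y => u i y * g2.2 y * r y) x -
          wpartial i (fun y => v i y * g1.2 y * r y) x) +
  \sum_i \sum_j (wpartial i (fun y => u i y * v j y * m j y) x -
                 wpartial j (fun y => u i y * v j y * m i y) x))).
- apply: measurable_funM => //; apply: Hinf_measurable.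
  by apply: HinfB; exact: HinfM.
- by rewrite /comp; under eq_fun do rewrite EFinD; exact: integrableD.
- have D i p q s : Hinf p -> Hinf q -> Hinf s ->
      null_integral (wpartial i (fun y => p y * q y * s y)).
    by move=> Hp Hq Hs; apply: null_integral_divergence => //; exact: HinfM.
  apply: null_integralD; apply: null_integral_sum => i.
    by apply: null_integralD; [|apply: null_integralN]; exact: D.
  apply: null_integral_sum => j.
  by apply: null_integralD; [|apply: null_integralN]; exact: D.
have Er : {ae mu, forall x, forall i, wpartial i r x =
    wpartial i (re psi) x * complex.Re (psi x) + complex.Re (psi x) * wpartial i (re psi) x +
    (wpartial i (im psi) x * complex.Im (psi x) + complex.Im (psi x) * wpartial i (im psi) x)}.
  apply: ae_ord => i.
  have rE : r = (fun x => complex.Re (psi x) * complex.Re (psi x) +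
      complex.Im (psi x) * complex.Im (psi x)) by apply/funext => x; exact: madelung2E.
  rewrite rE.
  apply: filterS2 (wderivD (dirac_mi i) (HinfM Ha Ha) (HinfM Hb Hb))
    (filterI (wpartialM i Ha Ha) (wpartialM i Hb Hb)) => x e1 [e2 e3].
  by rewrite -e2 -e3; exact: e1.
have Em : {ae mu, forall x, forall j i, wpartial j (m i) x =
    wpartial j (re psi) x * wpartial i (im psi) x +
    complex.Re (psi x) * wpartial j (wpartial i (im psi)) x -
    (wpartial j (im psi) x * wpartial i (re psi) x +
     complex.Im (psi x) * wpartial j (wpartial i (re psi)) x)}.
  apply: ae_ord => j; apply: ae_ord => i.
  have mE : m i = (fun x => complex.Re (psi x) * wpartial i (im psi) x +
      -1 * (complex.Im (psi x) * wpartial i (re psi) x)).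
    by apply/funext => x; rewrite /m madelung1E mulN1r.
  rewrite mE; have Hda := Hinf_wpartial i Ha; have Hdb := Hinf_wpartial i Hb.
  apply: filterS2 (wpartialDZ j (-1) (HinfM Ha Hdb) (HinfM Hb Hda))
    (filterI (wpartialM j Ha Hdb) (wpartialM j Hb Hda)) => x -> [-> ->].
  by rewrite mulN1r.
have Es : {ae mu, forall x, forall i j,
    wpartial i (wpartial j (re psi)) x = wpartial j (wpartial i (re psi)) x /\
    wpartial i (wpartial j (im psi)) x = wpartial j (wpartial i (im psi)) x}.
  apply: ae_ord => i; apply: ae_ord => j.
  by apply: filterS2 (wpartial_comm i j Ha) (wpartial_comm i j Hb) => x.
have E1 : {ae mu, forall x, forall i,
    wpartial i (fun y => u i y * g2.2 y * r y) x =
      wpartial i (u i) x * g2.2 x * r x + u i x * wpartial i g2.2 x * r x +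
      u i x * g2.2 x * wpartial i r x /\
    wpartial i (fun y => v i y * g1.2 y * r y) x =
      wpartial i (v i) x * g1.2 x * r x + v i x * wpartial i g1.2 x * r x +
      v i x * g1.2 x * wpartial i r x}.
  apply: ae_ord => i.
  by apply: filterS2 (wpartialM3 i (Hui i) Hg Hr) (wpartialM3 i (Hvi i) Hf Hr) => x.
have E2 : {ae mu, forall x, forall i j,
    wpartial i (fun y => u i y * v j y * m j y) x =
      wpartial i (u i) x * v j x * m j x + u i x * wpartial i (v j) x * m j x +
      u i x * v j x * wpartial i (m j) x /\
    wpartial j (fun y => u i y * v j y * m i y) x =
      wpartial j (u i) x * v j x * m i x + u i x * wpartial j (v j) x * m i x +
      u i x * v j x * wpartial j (m i) x}.
  apply: ae_ord => i; apply: ae_ord => j.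
  by apply: filterS2 (wpartialM3 i (Hui i) (Hvi j) (Hmi j))
    (wpartialM3 j (Hui i) (Hvi j) (Hmi i)) => x.
apply: filterS2 (filterI Er Em) (filterI Es (filterI E1 E2)) => x [er em] [es [e1 e2]].
have := @bracket_pointwise R n (fun i => u i x) (fun i => v i x)
  (fun i => wpartial i (re psi) x) (fun i => wpartial i (im psi) x)
  (fun i => wpartial i g1.2 x) (fun i => wpartial i g2.2 x)
  (fun i j => wpartial i (u j) x) (fun i j => wpartial i (v j) x)
  (fun i j => wpartial i (wpartial j (re psi)) x)
  (fun i j => wpartial i (wpartial j (im psi)) x)
  (g1.2 x) (g2.2 x) (complex.Re (psi x)) (complex.Im (psi x))
  (fun i j => (es i j).1) (fun i j => (es i j).2).
rewrite /half_density_val => P; apply: etrans P _; congr (_ + _ + (_ + _)).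
- apply: eq_bigr => j _; rewrite -madelung1E; congr (_ * _).
  by rewrite !mxE.
- by rewrite madelung2E.
- apply: eq_bigr => i _; have [-> ->] := e1 i.
  by rewrite er /r madelung2E.
- apply: eq_bigr => i _; apply: eq_bigr => j _; have [-> ->] := e2 i j.
  by rewrite !em /m !madelung1E.
Qed.

End bracket.

Theorem corollary3p7 (R : realType) (n : nat) :
  (forall psi : 'rV[R]_n -> R[i], HinfC psi -> sdual (madelung psi)) /\
  (forall F G : @momdens R n -> R, admissible F -> admissible G ->
   forall psi : 'rV[R]_n -> R[i], HinfC psi ->
     (exists g, is_gradC (F \o madelung) psi g) /\
     (exists g, is_gradC (G \o madelung) psi g) /\
     bracket_NLS (F \o madelung) (G \o madelung) psi =
     bracket_CF F G (madelung psi)).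
Proof.
split=> [psi|F G [sF aF] [sG aG] psi Hpsi]; first exact: sdual_madelung.
have hm := sdual_madelung Hpsi.
have sgradP (H : @momdens R n -> R) : (exists g, is_sgrad H (madelung psi) g) ->
    is_sgrad H (madelung psi) (sgrad H (madelung psi)).
  by move=> [g hg]; exact: (@xgetPex _ (fun=> 0, fun=> 0)
    [set g | is_sgrad H (madelung psi) g] (ex_intro _ g hg)).
have gF := sgradP F (aF _ hm); have gG := sgradP G (aG _ hm).
have XF := is_gradC_madelung sF Hpsi gF; have XG := is_gradC_madelung sG Hpsi gG.
split; first by exists (madelung_grad (sgrad F (madelung psi)) psi).
split; first by exists (madelung_grad (sgrad G (madelung psi)) psi).
have gradP (H : ('rV[R]_n -> R[i]) -> R) X : is_gradC H psi X -> is_gradC H psi (gradC H psi).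
  by move=> hX; exact: (@xgetPex _ (fun=> 0) [set g | is_gradC H psi g] (ex_intro _ X hX)).
have YF := gradP _ _ XF; have YG := gradP _ _ XG.
have [[Hu Hf _] [Hv Hg _]] := (gF, gG).
rewrite /bracket_NLS innerC_half_i /bracket_CF -bracket_integral//.
have [[[p1 p2] _] [[q1 q2] _]] := (XF, XG).
have [[[p3 p4] _] [[q3 q4] _]] := (YF, YG).
apply: eq_Rintegral_ae.
- by apply: measurable_funM => //; apply: Hinf_measurable; apply: HinfB; exact: HinfM.
- by apply: measurable_funM => //; apply: Hinf_measurable; apply: HinfB; exact: HinfM.
apply: filterS2 (ae_gradC_unique YF XF) (ae_gradC_unique YG XG) => x [-> ->] [-> ->].
by [].
Qed.
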